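(* Let $M$ be a compact, connected, smooth Riemannian manifold without boundary, with Riemannian distance $d$, let $m\ge 2$, and let $\mu_1,\dots,\mu_m$ be Borel probability measures on $M$. Consider the Kantorovich problem (K) and the Monge problem (M) with marginals $\mu_1,\dots,\mu_m$ and cost function $$c(x_1,\dots,x_m)=\inf_{y\in M}\sum_{i=1}^m \tfrac12 d^2(x_i,y).$$ Assume $\mu_1$ is absolutely continuous with respect to local coordinates. Then the solution $\gamma$ of (K) is concentrated on the graph of a mapping $(F_2,\dots,F_m):M\to M^{m-1}$ over the first variable, i.e. on $\{(x_1,F_2(x_1),\dots,F_m(x_1))\}$. This mapping is a solution of (M). Moreover the solutions of both (K) and (M) are unique (for (M), up to modification on $\mu_1$-null sets).
   Context: Problem (K): minimize $\int_{M^m}c(x_1,\dots,x_m)\,d\gamma(x_1,\dots,x_m)$ over all Borel probability measures $\gamma$ on $M^m$ whose $i$-th marginal is $\mu_i$ for every $i=1,\dots,m$. Problem (M): minimize $\int_M c(x_1,F_2(x_1),\dots,F_m(x_1))\,d\mu_1(x_1)$ over all $(m-1)$-tuples of Borel maps $F_i:M\to M$ with $(F_i)_\#\mu_1=\mu_i$, i.e. $\mu_1(F_i^{-1}(A))=\mu_i(A)$ for all Borel $A\subseteq M$, $i=2,\dots,m$ (all maps being understood up to $\mu_1$-null sets). ''Absolutely continuous with respect to local coordinates'' means absolutely continuous with respect to Lebesgue measure in coordinate charts, equivalently with respect to the Riemannian volume measure. *)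

(* Defs.v *)
From HB Require Import structures.
From mathcomp Require Import all_boot all_order all_algebra.
From mathcomp Require Import all_classical all_reals all_analysis.

Set Implicit Arguments.
Unset Strict Implicit.
Unset Printing Implicit Defensive.

Import Order.TTheory GRing.Theory Num.Theory.
Import numFieldNormedType.Exports.

Local Open Scope classical_set_scope.
Local Open Scope ring_scope.

(* Used for open U only, where pointwise continuity on U and two-sided
   directional derivatives are the usual notions. *)
Fixpoint Ck_on (R : realType) (V W : normedModType R) (k : nat)
    (U : set V) (f : V -> W) : Prop :=
  {in U, continuous f} /\
  match k with
  | 0 => True
  | k'.+1 => forall v : V,
      (forall x, U x -> derivable f x v) /\
      Ck_on k' U (fun x => 'D_v f x)
  end.

Definition smooth_on (R : realType) (V W : normedModType R)
    (U : set V) (f : V -> W) : Prop := forall k, Ck_on k U f.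

(* The total functions [chart i] and [chart_inv i] are only meaningful on
   [chart_dom i] and on its image; [chart_at] selects a chart around every
   point, so that the domains cover M. *)
Record smooth_atlas (R : realType) (n : nat) (M : topologicalType) :=
  SmoothAtlas {
  chart_index : Type;
  chart_dom : chart_index -> set M;
  chart : chart_index -> M -> 'rV[R]_n;
  chart_inv : chart_index -> 'rV[R]_n -> M;
  chart_at : M -> chart_index;
  chart_at_dom : forall p, chart_dom (chart_at p) p;
  chart_dom_open : forall i, open (chart_dom i);
  chart_image_open : forall i, open (chart i @` chart_dom i);
  chartK : forall i p, chart_dom i p -> chart_inv i (chart i p) = p;
  chart_continuous : forall i, {in chart_dom i, continuous (chart i)};
  chart_inv_continuous : forall i,
    {in chart i @` chart_dom i, continuous (chart_inv i)};
  transition_smooth : forall i j,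
    smooth_on (chart i @` (chart_dom i `&` chart_dom j))
              (chart j \o chart_inv i)
}.

Definition bilin (R : realType) (n : nat) (G : 'M[R]_n) (u v : 'rV[R]_n) : R :=
  (u *m G *m v^T) 0 0.

(* [metric g i x] is the Gram matrix of the metric in chart i at the point of
   coordinates x; [metric_transition] is the tensor transformation rule. *)
Record riemannian_metric (R : realType) (n : nat) (M : topologicalType)
    (A : smooth_atlas R n M) := RiemannianMetric {
  metric : chart_index A -> 'rV[R]_n -> 'M[R]_n;
  metric_smooth : forall i, smooth_on (chart i @` chart_dom i) (metric i);
  metric_sym : forall i p, chart_dom i p ->
    (metric i (chart i p))^T = metric i (chart i p);
  metric_pos : forall i p, chart_dom i p ->
    forall v : 'rV[R]_n, v != 0 -> 0 < bilin (metric i (chart i p)) v v;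
  metric_transition : forall i j p, chart_dom i p -> chart_dom j p ->
    forall u v : 'rV[R]_n,
      bilin (metric i (chart i p)) u v =
      bilin (metric j (chart j p))
            ('D_u (chart j \o chart_inv i) (chart i p))
            ('D_v (chart j \o chart_inv i) (chart i p))
}.

Section RiemannianDistance.
Context (R : realType) (n : nat) (M : topologicalType).
Context (A : smooth_atlas R n M) (g : riemannian_metric A).

(* A C^1 curve on [0, 1] is a curve that is C^1 on a neighbourhood of [0, 1]:
   one-sidedly C^1 curves extend past both endpoints.  Its velocity may vanish,
   so piecewise C^1 curves can be reparametrized into C^1 ones and give the
   same infimum of lengths. *)
Definition C1_curve (w : R -> M) : Prop :=
  forall t : R, 0 <= t <= 1 ->
    {for t, continuous w} /\
    forall i : chart_index A, chart_dom i (w t) ->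
      (\forall s \near t, derivable (chart i \o w) s 1) /\
      {for t, continuous (derive1 (chart i \o w))}.

(* For a C^1 curve this does not depend on the chart around w t, by
   [metric_transition]. *)
Definition speed (w : R -> M) (t : R) : R :=
  let i := chart_at A (w t) in
  let v := derive1 (chart i \o w) t in
  Num.sqrt (bilin (metric g i (chart i (w t))) v v).

Definition curve_length (w : R -> M) : R :=
  (\int[lebesgue_measure]_(t in `[0%R, 1%R]) speed w t)%R.

Definition rdist (x y : M) : R :=
  inf [set curve_length w | w in
        [set w : R -> M | [/\ C1_curve w, w 0 = x & w 1 = y]]].

Definition cost (m : nat) (x : 'I_m -> M) : R :=
  inf (range (fun y : M => \sum_(i < m) 2^-1 * rdist (x i) y ^+ 2)).

End RiemannianDistance.

Arguments cost {R n M A} g m x.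

(* The set D of indices allows finite and empty covers, which matters in
   dimension 0, where every box has volume 1. *)
Definition lebesgue_null (R : realType) (n : nat) (N : set 'rV[R]_n) : Prop :=
  forall e : R, 0 < e -> exists (D : set nat) (a b : nat -> 'rV[R]_n),
    [/\ forall k j, a k 0 j <= b k 0 j,
        N `<=` \bigcup_(k in D) [set x | forall j, a k 0 j <= x 0 j <= b k 0 j]
      & (\esum_(k in D) (\prod_j (b k 0 j - a k 0 j))%:E <= e%:E)%E].

Notation borel T := (g_sigma_algebraType (@open T)).

(* M^m with the product topology. *)
Notation power m M := (prod_topology (fun _ : 'I_m => M)).

Definition abs_continuous (R : realType) (n : nat) (M : ptopologicalType)
    (A : smooth_atlas R n M) (mu : probability (borel M) R) : Prop :=
  forall (i : chart_index A) (B : set (borel M)), measurable B ->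
    B `<=` chart_dom i -> lebesgue_null (chart i @` B) -> mu B = 0%E.

Section TransportProblems.
Context (R : realType) (M : ptopologicalType).

Definition coupling (m : nat) (mu : 'I_m -> probability (borel M) R)
    (gamma : probability (borel (power m M)) R) : Prop :=
  forall (i : 'I_m) (B : set (borel M)), measurable B ->
    gamma [set x | B (x i)] = mu i B.

Definition kantorovich_solution (m : nat) (c : ('I_m -> M) -> R)
    (mu : 'I_m -> probability (borel M) R)
    (gamma : probability (borel (power m M)) R) : Prop :=
  coupling mu gamma /\
  forall gamma' : probability (borel (power m M)) R, coupling mu gamma' ->
    (\int[gamma]_x (c x)%:E <= \int[gamma']_x (c x)%:E)%E.

(* The first marginal has index [ord0] and the j-th component of F is the map
   transporting it to the marginal of index [lift ord0 j]. *)
Definition graph_map (m : nat) (F : 'I_m -> M -> M) (x : M) : 'I_m.+1 -> M :=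
  fun i => if unlift ord0 i is Some j then F j x else x.

Definition monge_admissible (m : nat)
    (mu : 'I_m.+1 -> probability (borel M) R) (F : 'I_m -> M -> M) : Prop :=
  forall j : 'I_m,
    measurable_fun [set: borel M] (F j : borel M -> borel M) /\
    forall B : set (borel M), measurable B ->
      mu ord0 (F j @^-1` B) = mu (lift ord0 j) B.

Definition monge_solution (m : nat) (c : ('I_m.+1 -> M) -> R)
    (mu : 'I_m.+1 -> probability (borel M) R) (F : 'I_m -> M -> M) : Prop :=
  monge_admissible mu F /\
  forall F' : 'I_m -> M -> M, monge_admissible mu F' ->
    (\int[mu ord0]_x (c (graph_map F x))%:E <=
     \int[mu ord0]_x (c (graph_map F' x))%:E)%E.

End TransportProblems.

(* Main.v *)
(* Let [u] maximize [\sum_l \int u_l dmu_l] among the tuples with [\sum_l u_l (x_l) <= c x], and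
   call [x] a contact tuple if equality holds.  A maximizer exists with every [u_l] Lipschitz and
   [u_0] a [c]-transform.  If [y] realizes the infimum in [c x] for a contact tuple [x], then
   [d^2(y, .) / 2] touches [u_0] from above at [x_0], up to a constant.  So if [u_0] has only one
   superdifferential at [x_0], so has [d^2(y, .) / 2], and this determines [y] (the twist
   condition).  If [x'] is another contact tuple over [x_0], then [y] also realizes the infimum for
   [x] with [x_l] replaced by [x'_l]; hence [d^2(x_l, .) / 2] and [d^2(x'_l, .) / 2] have the same
   only superdifferential at [y], and [x_l = x'_l].  The semiconcave function [u_0] has a unique
   superdifferential off a null set, where contact tuples are thus given by a map [G] of [x_0].
   Comparing [u] with the [c]-transform of [u] perturbed in its [l]-th component shows, by
   maximality, that [G_l] pushes [mu_0] to [mu_l]; no optimal coupling is needed.  Integrating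
   [c - \sum_l u_l >= 0] then gives optimality and uniqueness in both problems.

   The exponential map is avoided.  Moving a nearly minimal curve linearly in a chart expands
   [d^2 / 2] to second order around a pair of nearby points.  Along the points that divide a
   minimal geodesic into [N] equal parts, these expansions form an Euler scheme of the cogeodesic
   flow with error [O(1 / N)], so the endpoint depends only on the initial momentum. *)
Require Import Defs.
From HB Require Import structures.
From mathcomp Require Import all_boot all_order all_algebra.
From mathcomp Require Import all_classical all_reals all_analysis.
From mathcomp Require Import measurable_realfun ring lra.

Set Implicit Arguments.
Unset Strict Implicit.
Unset Printing Implicit Defensive.

Import Order.TTheory GRing.Theory Num.Theory.
Import numFieldNormedType.Exports.

Local Open Scope classical_set_scope.
Local Open Scope ring_scope.

(** * Calculus on row vectors *)

(** The obstacle is the cut locus: [d^2 / 2] is only semiconcave, so superdifferentials with a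
    quadratic remainder replace gradients throughout. At an inner point of a division of a geodesic
    the sum of the half squared distances to the two neighbours is minimal, so their
    superdifferentials are opposite; this links the separate expansions into a chain that carries
    one momentum. For the errors to add up to [O(1 / N)], the expansion must control the change of
    momentum up to the third power of the step. It is proved for curves of length close to [d + e],
    whose covectors are bounded; their limit points as [e] tends to 0 stand in for minimizing
    curves.

    A chart gives the twist condition for short distances only. A unique superdifferential of
    [d^2(y, .) / 2] at [x] determines the first short piece of a geodesic towards [y]; at the end of
    this piece the superdifferential is again unique, being forced by the piece already travelled.
    So an induction on the distance applies.

    Kinks of a given size form compact sets, which makes the exceptional set Borel. *)

Section ChainRule.
Context {R : realType}.

Lemma is_derive_comp (V W : normedModType R) (f : V -> W) (c : R -> V) (x : R) dc :
  differentiable f (c x) -> is_derive x 1 c dc ->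
  is_derive x 1 (f \o c) ('D_dc f (c x)).
Proof.
move=> fd [cd cE].
have cd' : differentiable c x by exact/derivable1_diffP.
have fcd : differentiable (f \o c) x by exact: differentiable_comp.
split; first exact/derivable1_diffP.
have E : 'd c x 1 = dc by rewrite -cE deriveE.
by rewrite !deriveE// diff_comp//= E.
Qed.

Lemma is_derive_comp1 (W : normedModType R) (f : R -> W) (c : R -> R) (x : R) df dc :
  is_derive (c x) 1 f df -> is_derive x 1 c dc ->
  is_derive x 1 (f \o c) (dc *: df).
Proof.
move=> [fd fE] Hc; have fd' : differentiable f (c x) by exact/derivable1_diffP.
have -> : dc *: df = 'D_dc f (c x).
  by rewrite -fE !deriveE// -linearZ/= [_ *: 1]mulr1.
exact: is_derive_comp.
Qed.

End ChainRule.

Section RowVectors.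
Context {R : realType} {n : nat}.
Implicit Types (u v x y z : 'rV[R]_n).

Lemma rV_coord_le v j : `|v 0 j| <= `|v|.
Proof.
by rewrite [leRHS]/Num.Def.normr/= mx_normrE; apply: (le_bigmax _ _ (0, j)).
Qed.

Lemma rV_norm_le v e : 0 <= e -> (forall j, `|v 0 j| <= e) -> `|v| <= e.
Proof.
move=> e0 H; rewrite [leLHS]/Num.Def.normr/= mx_normrE.
by apply: bigmax_le => // -[i j] _; rewrite /= ord1.
Qed.

Lemma rV_norm_lt v e : 0 < e -> (forall j, `|v 0 j| < e) -> `|v| < e.
Proof.
move=> e0 H; rewrite [ltLHS]/Num.Def.normr/= mx_normrE.
by apply: bigmax_lt => // -[i j] _; rewrite /= ord1.
Qed.

Lemma is_derive_line (W : normedModType R) (f : 'rV[R]_n -> W) z v (s : R) :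
  derivable f (z + s *: v) v ->
  is_derive s 1 (fun s => f (z + s *: v)) ('D_v f (z + s *: v)).
Proof.
move=> fd.
have E : (fun h : R => h^-1 *: (((fun s => f (z + s *: v)) \o shift s) (h *: 1) - f (z + s *: v))) =
    (fun h => h^-1 *: ((f \o shift (z + s *: v)) (h *: v) - f (z + s *: v))).
  apply/funext => h /=; congr (_ *: (f _ - _)).
  by rewrite scalerDl [_ *: 1]mulr1 addrCA.
by split; rewrite ?/derivable ?/derive E.
Qed.

(** Rescaling the parameter by [t] to the unit interval covers both signs of [t] and 0. *)
Lemma mvt_line (f : 'rV[R]_n -> R) z v (t : R) :
  (forall th : R, 0 <= th <= 1 -> derivable f (z + (th * t) *: v) v) ->
  exists2 th : R, 0 <= th <= 1 &
    f (z + t *: v) - f z = t * 'D_v f (z + (th * t) *: v).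
Proof.
move=> fd.
pose g (s : R) : R := f (z + (s * t) *: v).
pose dg (s : R) : R := t * 'D_v f (z + (s * t) *: v).
have gd (s : R) : 0 <= s <= 1 -> is_derive s 1 g (dg s).
  move=> st; have h1 : is_derive (s * t) 1 (fun s : R => f (z + s *: v)) ('D_v f (z + (s * t) *: v)).
    by apply: is_derive_line; exact: fd.
  have h2 : is_derive s 1 (fun s : R => s * t) t.
    by apply: is_derive_eq; rewrite scaler0 add0r /GRing.scale/= mulr1.
  exact: (@is_derive_comp1 _ _ (fun s : R => f (z + s *: v)) (fun s : R => s * t)).
have gc : {within `[0, 1], continuous g}.
  apply: derivable_within_continuous => s; rewrite in_itv/= => st.
  by have [] := gd s st.
have [s|th] := @MVT_segment _ g dg 0 1 ler01 _ gc.
  by rewrite in_itv/= => /andP[? ?]; apply: gd; rewrite !ltW.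
rewrite in_itv/= => th01 E; exists th => //.
by move: E; rewrite subr0 mulr1 /g /dg mul1r mul0r scale0r addr0.
Qed.

Definition rmix (k : nat) x y : 'rV[R]_n :=
  \row_j (if (j < k)%N then x 0 j else y 0 j).

(* A sup-norm ball is a box: moving from [y] to [x] one coordinate at a time stays inside it. *)
Lemma sum_mvt (f : 'rV[R]_n -> R) c (r : R) x y :
  (forall z j, `|z - c| < r -> derivable f z (delta_mx 0 j)) ->
  `|x - c| < r -> `|y - c| < r ->
  exists2 xi : 'I_n -> 'rV[R]_n,
    (forall k, `|xi k - c| < r /\ `|xi k - y| <= `|x - y|) &
    f x - f y = \sum_k (x 0 k - y 0 k) * 'D_(delta_mx 0 k) f (xi k).
Proof.
move=> fd xr yr; have r0 : 0 < r by exact: le_lt_trans xr.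
have key (k : 'I_n) : exists xi : 'rV[R]_n, [/\ `|xi - c| < r, `|xi - y| <= `|x - y| &
   f (rmix k.+1 x y) - f (rmix k x y) = (x 0 k - y 0 k) * 'D_(delta_mx 0 k) f xi].
  have E : rmix k.+1 x y = rmix k x y + (x 0 k - y 0 k) *: delta_mx 0 k.
    apply/rowP => j; rewrite !mxE eqxx/= ltnS.
    have [->|jk] := eqVneq j k; first by rewrite leqnn ltnn mulr1 addrC subrK.
    by rewrite mulr0 addr0 leq_eqVlt val_eqE (negbTE jk).
  have bnd th : 0 <= th <= 1 ->
     `|rmix k x y + (th * (x 0 k - y 0 k)) *: delta_mx 0 k - y| <= `|x - y|.
    move=> /andP[th0 th1]; apply: rV_norm_le => // j; rewrite !mxE eqxx/=.
    have := rV_coord_le (x - y) j; rewrite !mxE.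
    have [->|jk] := eqVneq j k.
      rewrite ltnn mulr1 addrAC subrr add0r normrM (ger0_norm th0).
      by apply: le_trans; rewrite ler_piMl.
    rewrite mulr0 addr0; case: ifP => // _; by rewrite subrr normr0.
  have inb th : 0 <= th <= 1 ->
     `|rmix k x y + (th * (x 0 k - y 0 k)) *: delta_mx 0 k - c| < r.
    move=> /andP[th0 th1]; apply: rV_norm_lt => // j; rewrite !mxE eqxx/=.
    have xj := le_lt_trans (rV_coord_le (x - c) j) xr.
    have yj := le_lt_trans (rV_coord_le (y - c) j) yr.
    move: xj yj; rewrite !mxE => xj yj.
    have [jk|jk] := eqVneq j k; last by rewrite mulr0 addr0; case: ifP.
    rewrite jk ltnn mulr1; move: xj yj; rewrite jk => xj yj.
    have -> : y 0 k + th * (x 0 k - y 0 k) - c 0 k =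
      th * (x 0 k - c 0 k) + (1 - th) * (y 0 k - c 0 k) by ring.
    move: xj yj; rewrite !ltr_norml; set u := x 0 k - _; set w := y 0 k - _.
    move=> /andP[? ?] /andP[? ?].
    by have [->|th0'] := eqVneq th 0; [lra|]; apply/andP; split; nra.
  have [th th01 H] := @mvt_line f (rmix k x y) (delta_mx 0 k) (x 0 k - y 0 k)
     (fun th th01 => fd _ k (inb th th01)).
  by exists (rmix k x y + (th * (x 0 k - y 0 k)) *: delta_mx 0 k); split;
    [exact: inb|exact: bnd|rewrite E].
have [xi Hxi] := choice key.
exists xi => [k|]; first by have [] := Hxi k.
transitivity (\sum_(k < n) (f (rmix k.+1 x y) - f (rmix k x y))); last first.
  by apply: eq_bigr => k _; have [_ _] := Hxi k.
rewrite -(big_mkord xpredT (fun k => f (rmix k.+1 x y) - f (rmix k x y))).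
rewrite telescope_sumr//; congr (f _ - f _); apply/rowP => j; rewrite !mxE//.
by rewrite ltn_ord.
Qed.

Lemma lipschitz_box (f : 'rV[R]_n -> R) c (r K : R) :
  0 <= K -> (forall z j, `|z - c| < r -> derivable f z (delta_mx 0 j)) ->
  (forall z j, `|z - c| < r -> `|'D_(delta_mx 0 j) f z| <= K) ->
  forall x y, `|x - c| < r -> `|y - c| < r ->
  `|f x - f y| <= n%:R * K * `|x - y|.
Proof.
move=> K0 fd fK x y xr yr.
have [xi Hxi ->] := sum_mvt fd xr yr.
apply: (le_trans (ler_norm_sum _ _ _)).
apply: (@le_trans _ _ (\sum_(k < n) K * `|x - y|)).
  apply: ler_sum => k _; rewrite normrM mulrC ler_pM//.
    by apply: fK; have [] := Hxi k.
  by have := rV_coord_le (x - y) k; rewrite !mxE.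
by rewrite sumr_const card_ord -[leLHS]mulr_natl mulrA.
Qed.

(** [K] only bounds the oscillation of the partial derivatives within distance [|x - y|] of [y]; a
    value proportional to [|x - y|] makes the remainder quadratic. *)
Lemma taylor_box (f : 'rV[R]_n -> R) c (r K : R) :
  0 <= K -> (forall z j, `|z - c| < r -> derivable f z (delta_mx 0 j)) ->
  forall x y, `|x - c| < r -> `|y - c| < r ->
  (forall z j, `|z - c| < r -> `|z - y| <= `|x - y| ->
     `|'D_(delta_mx 0 j) f z - 'D_(delta_mx 0 j) f y| <= K) ->
  `|f x - f y - \sum_j (x - y) 0 j * 'D_(delta_mx 0 j) f y| <= n%:R * K * `|x - y|.
Proof.
move=> K0 fd x y xr yr fK.
have [xi Hxi ->] := sum_mvt fd xr yr.
rewrite -sumrB; apply: (le_trans (ler_norm_sum _ _ _)).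
apply: (@le_trans _ _ (\sum_(k < n) K * `|x - y|)).
  apply: ler_sum => k _; rewrite !mxE -mulrBr normrM mulrC ler_pM//.
    by apply: fK; have [] := Hxi k.
  by have := rV_coord_le (x - y) k; rewrite !mxE.
by rewrite sumr_const card_ord -[leLHS]mulr_natl mulrA.
Qed.

Definition dotr u v : R := \sum_j u 0 j * v 0 j.

Lemma dotr_linear u : linear (dotr u).
Proof.
move=> k v w; rewrite /dotr /GRing.scale/= mulr_sumr -big_split/=.
by apply: eq_bigr => j _; rewrite !mxE mulrDr mulrCA.
Qed.

HB.instance Definition _ u :=
  @GRing.isLinear.Build R 'rV[R]_n R _ (dotr u) (dotr_linear u).

Lemma dotr_norm u v : `|dotr u v| <= n%:R * `|u| * `|v|.
Proof.
apply: (le_trans (ler_norm_sum _ _ _)).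
apply: (@le_trans _ _ (\sum_(k < n) `|u| * `|v|)).
  by apply: ler_sum => k _; rewrite normrM ler_pM// rV_coord_le.
by rewrite sumr_const card_ord -[leLHS]mulr_natl mulrA.
Qed.

Lemma dotr_continuous u : continuous (dotr u).
Proof.
apply: bounded_linear_continuous.
apply/linear_boundedP; exists (n%:R * `|u|); split; first by rewrite num_real.
by move=> x /ltW xle v; apply: (le_trans (dotr_norm _ _)); rewrite ler_wpM2r.
Qed.

(** [Ck_on] provides directional derivatives only; continuity of the partial ones upgrades them to a
    differential, through which the chain rule applies. *)
Lemma C1_differentiable (f : 'rV[R]_n -> R) (U : set 'rV[R]_n) x :
  open U -> U x -> (forall z j, U z -> derivable f z (delta_mx 0 j)) ->
  (forall j, {for x, continuous ('D_(delta_mx 0 j) f)}) ->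
  differentiable f x /\ forall v, 'D_v f x = dotr (\row_j 'D_(delta_mx 0 j) f x) v.
Proof.
move=> oU Ux fd fc.
pose df : {linear 'rV[R]_n -> R} := dotr (\row_j 'D_(delta_mx 0 j) f x).
have dfc : continuous df by exact: dotr_continuous.
have key : f \o shift x = cst (f x) + df +o_ (0 : 'rV[R]_n) id.
  apply/eqaddoP => e e0.
  have : \forall z \near x, U z /\ forall j,
     `|'D_(delta_mx 0 j) f x - 'D_(delta_mx 0 j) f z| < e / n.+1%:R.
    apply: filterI; first exact: open_nbhs_nbhs.
    apply: (@filter_forall _ _ _ (nbhs x)) => j; move/cvgrPdist_lt : (fc j); apply.
    by rewrite divr_gt0.
  move=> /nbhs_ballP[r r0 Hr]; apply/nbhs_ballP; exists r => // h.
  rewrite -ball_normE/= sub0r normrN => hr.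
  rewrite [X in `|X|](_ : _ = f (h + x) - f x - \sum_j ((h + x) - x) 0 j * 'D_(delta_mx 0 j) f x); last first.
    rewrite addrK /= !fctE opprD addrA; congr (_ - _ - _).
    by apply: eq_bigr => j _; rewrite mxE mulrC.
  have bE z : `|z - x| < r -> ball x r z by rewrite -ball_normE/= distrC.
  have /(le_trans _) : n%:R * (e / n.+1%:R) * `|h + x - x| <= e * `|h|.
    rewrite addrK ler_wpM2r// mulrCA ler_piMr//; first exact: ltW.
    by rewrite ler_pdivrMr// mul1r ler_nat.
  apply; apply: (@taylor_box f x r).
  - by rewrite divr_ge0// ltW.
  - by move=> z j /bE/Hr[/fd].
  - by rewrite addrK.
  - by rewrite subrr normr0.
  - by move=> z j /bE/Hr[_ /(_ j)/ltW]; rewrite distrC.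
have dE : 'd f x = df :> ('rV[R]_n -> R) by exact: diff_unique.
have dd : differentiable f x by apply/diff_locallyP; rewrite dE.
by split => // v; rewrite deriveE// dE.
Unshelve. all: by end_near. Qed.

End RowVectors.

Lemma near_eq_continuous_at (T U : topologicalType) (f g : T -> U) x :
  (\forall y \near x, f y = g y) -> {for x, continuous f} -> {for x, continuous g}.
Proof.
move=> fg fc; rewrite /prop_for/continuous_at -(nbhs_singleton fg).
exact: cvg_trans (near_eq_cvg fg) fc.
Qed.

Lemma eq_continuous_at (T U : topologicalType) (f g : T -> U) x :
  (forall y, f y = g y) -> {for x, continuous f} -> {for x, continuous g}.
Proof. by move=> /funext ->. Qed.

(** * Differentials of matrix-valued maps *)

Section SmoothMaps.
Context {R : realType} {n p q : nat}.
Implicit Types (T : 'rV[R]_n -> 'M[R]_(p, q)) (U : set 'rV[R]_n).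

Lemma continuous_entry (X : topologicalType) (T : X -> 'M[R]_(p, q)) x k l :
  {for x, continuous T} -> {for x, continuous (fun y => T y k l : R)}.
Proof.
move=> Tc; apply: (@continuous_comp X _ _ T (fun N : 'M[R]_(p, q) => N k l : R)) => //.
exact: coord_continuous.
Qed.

Lemma Ck1_entry U T x k l : open U -> Ck_on 1 U T -> U x ->
  differentiable (fun y => T y k l : R) x /\
  forall v, ('D_v T x) k l = 'D_v (fun y => T y k l) x.
Proof.
move=> oU [Tc HT] Ux.
have Td y v : U y -> derivable T y v by move=> Uy; have [+ _] := HT v; exact.
have DE y v : U y -> ('D_v T y) k l = 'D_v (fun y => T y k l) y.
  by move=> Uy; rewrite derive_mx ?mxE//; exact: Td.
split; last by move=> v; exact: DE.
have [] := @C1_differentiable R n (fun y => T y k l) U x oU Ux => //.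
  by move=> z j Uz; have /derivable_mxP := Td z (delta_mx 0 j) Uz; exact.
move=> j; have [_ [Dc _]] := HT (delta_mx 0 j).
have H := @continuous_entry _ ('D_(delta_mx 0 j) T) x k l (Dc x (mem_set Ux)).
apply: near_eq_continuous_at H; near=> y; apply: DE; near: y.
exact: open_nbhs_nbhs.
Unshelve. all: by end_near. Qed.

Lemma Ck1_derive_sum U T x v : open U -> Ck_on 1 U T -> U x ->
  'D_v T x = \sum_j v 0 j *: 'D_(delta_mx 0 j) T x.
Proof.
move=> oU HT Ux; apply/matrixP => k l.
have [Td DE] := Ck1_entry k l oU HT Ux.
rewrite summxE DE {1}(row_sum_delta v) deriveE// linear_sum.
by apply: eq_bigr => j _; rewrite mxE DE deriveE// linearZ.
Qed.

Lemma is_derive_comp_Ck1 U T (c : R -> 'rV[R]_n) s dc :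
  open U -> Ck_on 1 U T -> U (c s) -> is_derive s 1 c dc ->
  is_derive s 1 (T \o c) ('D_dc T (c s)).
Proof.
move=> oU HT Ux cd.
have H k l : is_derive s 1 (fun t => T (c t) k l) (('D_dc T (c s)) k l).
  have [Td DE] := Ck1_entry k l oU HT Ux.
  by rewrite DE; exact: (is_derive_comp Td cd).
have dTc : derivable (T \o c) s 1 by apply/derivable_mxP => k l; have [] := H k l.
split => //; rewrite derive_mx//; apply/matrixP => k l; rewrite mxE.
by have [] := H k l.
Qed.

End SmoothMaps.

(** * Continuously differentiable curves in a normed space *)

Section C1At.
Context {R : realType}.

(** The condition that [C1_curve] imposes on the expression of the curve in each chart. *)
Definition C1_at (V : normedModType R) (c : R -> V) (t : R) : Prop :=
  (\forall s \near t, derivable c s 1) /\ {for t, continuous (derive1 c)}.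

Lemma C1_at_eq (V : normedModType R) (c b : R -> V) t :
  (\forall s \near t, c s = b s) -> C1_at c t -> C1_at b t.
Proof.
move=> cb [cd cc].
have cb' : \forall s \near t, \forall u \near s, c u = b u by exact: near_join.
have E : \forall s \near t, derive1 c s = derive1 b s.
  near=> s; rewrite !derive1E; apply: near_eq_derive.
  by near: s.
split; last exact: near_eq_continuous_at cc.
near=> s; apply: (@near_eq_derivable _ _ _ c); by near: s.
Unshelve. all: by end_near. Qed.

Lemma C1_at_derive (V : normedModType R) (c dc : R -> V) t :
  (\forall s \near t, is_derive (s : R) (1 : R) c (dc s)) -> {for t, continuous dc} ->
  C1_at c t.
Proof.
move=> cd dcc; split; first by near=> s; have [] : is_derive (s : R) (1 : R) c (dc s) by near: s.
have E : \forall s \near t, dc s = derive1 c s.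
  by near=> s; rewrite derive1E; have [] : is_derive (s : R) (1 : R) c (dc s) by near: s.
exact: near_eq_continuous_at dcc.
Unshelve. all: by end_near. Qed.

Lemma C1_at_is_derive (V : normedModType R) (c : R -> V) t :
  C1_at c t -> \forall s \near t, is_derive (s : R) (1 : R) c (derive1 c s).
Proof. by case=> cd _; near=> s; rewrite derive1E; split => //; near: s.
Unshelve. all: by end_near. Qed.

Lemma C1_at_continuous (V : normedModType R) (c : R -> V) t :
  C1_at c t -> {for t, continuous c}.
Proof.
case=> /nbhs_singleton + _ => cd.
by apply: differentiable_continuous; exact/derivable1_diffP.
Qed.

Lemma C1_atD (V : normedModType R) (b c : R -> V) t :
  C1_at b t -> C1_at c t -> C1_at (fun s => b s + c s) t.
Proof.
move=> Hb Hc; apply: (@C1_at_derive _ _ (fun s => derive1 b s + derive1 c s)).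
  have := C1_at_is_derive Hb; have := C1_at_is_derive Hc => cd bd.
  near=> s; have bs : is_derive (s : R) (1 : R) b (derive1 b s) by near: s.
  have cs : is_derive (s : R) (1 : R) c (derive1 c s) by near: s.
  exact: is_deriveD.
by case: Hb => _ Hb; case: Hc => _ Hc; exact: cvgD.
Unshelve. all: by end_near. Qed.

Lemma C1_at_comp (V : normedModType R) (c : R -> V) (th : R -> R) t :
  C1_at c (th t) -> C1_at th t -> C1_at (c \o th) t.
Proof.
move=> Hc Hth; apply: (@C1_at_derive _ _ (fun s => derive1 th s *: derive1 c (th s))).
  have cth := C1_at_continuous Hth (C1_at_is_derive Hc).
  have thd := C1_at_is_derive Hth.
  near=> s; apply: is_derive_comp1; by near: s.
case: (Hth) => _ Hth'; case: Hc => _ Hc.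
apply: cvgZ => //; apply: (@continuous_comp _ _ _ th (derive1 c)) => //.
exact: C1_at_continuous.
Unshelve. all: by end_near. Qed.

Lemma C1_at_comp_Ck1 (n p q : nat) (U : set 'rV[R]_n)
    (T : 'rV[R]_n -> 'M[R]_(p, q)) (c : R -> 'rV[R]_n) t :
  open U -> Ck_on 1 U T -> U (c t) -> C1_at c t -> C1_at (T \o c) t.
Proof.
move=> oU HT Ut Hc; have cc := C1_at_continuous Hc.
have Us : \forall s \near t, U (c s) by apply: cc; exact: open_nbhs_nbhs.
have cd := C1_at_is_derive Hc.
apply: (@C1_at_derive _ _ (fun s => 'D_(derive1 c s) T (c s))).
  near=> s; apply: (is_derive_comp_Ck1 oU HT); by near: s.
(* [Ck_on] gives continuity for each fixed direction; the moving velocity is therefore expanded in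
   the basis. *)
have E : \forall s \near t, \sum_j (derive1 c s) 0 j *: 'D_(delta_mx 0 j) T (c s) =
   'D_(derive1 c s) T (c s).
  by near=> s; rewrite -(Ck1_derive_sum _ oU HT)//; near: s.
apply: near_eq_continuous_at E _.
apply: cvg_big => [|j _]; first exact: add_continuous.
apply: cvgZ.
  apply: (@continuous_entry _ _ _ _ (derive1 c)); by case: Hc.
apply: (@continuous_comp _ _ _ c ('D_(delta_mx 0 j) T)) => //.
by case: HT => _ /(_ (delta_mx 0 j))[_ [+ _]]; apply; exact: mem_set.
Unshelve. all: by end_near. Qed.

End C1At.

(** * Integrals over the unit interval *)

Section UnitIntegral.
Context {R : realType}.
Implicit Types f g F : R -> R.

Definition unit_continuous f := forall t : R, 0 <= t <= 1 -> {for t, continuous f}.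

Definition unit_int f : R := (\int[lebesgue_measure]_(t in `[0%R, 1%R]) f t)%R.

Lemma unit_continuous_cst (k : R) : unit_continuous (fun=> k).
Proof. by move=> t _; exact: cvg_cst. Qed.

Lemma unit_continuousD f g : unit_continuous f -> unit_continuous g ->
  unit_continuous (fun t => f t + g t).
Proof. by move=> fc gc t t01; apply: cvgD; [exact: fc|exact: gc]. Qed.

Lemma unit_continuousZ k f : unit_continuous f -> unit_continuous (fun t => k * f t).
Proof. by move=> fc t t01; apply: cvgM; [exact: cvg_cst|exact: fc]. Qed.

Lemma unit_intE f : (\int[lebesgue_measure]_(t in `[0%R, 1%R]) f t)%R = unit_int f.
Proof. by []. Qed.

Lemma unit_continuous_within f : unit_continuous f -> {within `[0, 1], continuous f}.
Proof.
move=> fc; apply: continuous_in_subspaceT => t.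
by rewrite inE/= in_itv/= => /fc.
Qed.

Lemma unit_integrable f : unit_continuous f ->
  lebesgue_measure.-integrable `[0, 1] (EFin \o f).
Proof.
move=> fc; apply: continuous_compact_integrable; first exact: segment_compact.
exact: unit_continuous_within.
Qed.

Lemma unit_int_le f g : unit_continuous f -> unit_continuous g ->
  (forall t, 0 <= t <= 1 -> f t <= g t) -> unit_int f <= unit_int g.
Proof.
move=> fc gc fg; apply: le_Rintegral => //; try exact: unit_integrable.
Qed.

Lemma unit_int_eq f g :
  (forall t, 0 <= t <= 1 -> f t = g t) -> unit_int f = unit_int g.
Proof.
by move=> fg; apply: eq_Rintegral => t; rewrite inE/= in_itv/=; exact: fg.
Qed.

Lemma unit_intD f g : unit_continuous f -> unit_continuous g ->
  unit_int (fun t => f t + g t) = unit_int f + unit_int g.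
Proof.
by move=> fc gc; apply: RintegralD => //; exact: unit_integrable.
Qed.

Lemma unit_intZ f k : unit_continuous f ->
  unit_int (fun t => k * f t) = k * unit_int f.
Proof. by move=> fc; apply: RintegralZl => //; exact: unit_integrable. Qed.

Lemma unit_int_cst k : unit_int (fun=> k) = k.
Proof.
rewrite /unit_int Rintegral_cst//= lebesgue_measure_itv/=.
by rewrite lte_fin ltr01 oppr0 adde0/= mulr1.
Qed.

Lemma unit_int_derive F f :
  (forall t, 0 <= t <= 1 -> is_derive (t : R) (1 : R) F (f t)) ->
  unit_continuous f -> unit_int f = F 1 - F 0.
Proof.
move=> Fd fc; rewrite /unit_int /Rintegral.
have Fc t : 0 <= t <= 1 -> {for t, continuous F}.
  move=> /Fd[Fdt _]; apply: differentiable_continuous; exact/derivable1_diffP.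
rewrite (@continuous_FTC2 _ f F 0 1)//; first exact: unit_continuous_within.
- split.
  + by move=> t; rewrite in_itv/= => /andP[t0 t1]; have [] := Fd t; rewrite ?ltW.
  + by apply: cvg_at_right_filter; apply: Fc; rewrite lexx ler01.
  + by apply: cvg_at_left_filter; apply: Fc; rewrite lexx ler01.
- move=> t; rewrite in_itv/= => /andP[t0 t1]; rewrite derive1E.
  by have [] := Fd t; rewrite ?ltW.
Qed.

Lemma is_derive_integral f a x : continuous f -> a < x ->
  is_derive (x : R) (1 : R) (fun y => (\int[lebesgue_measure]_(t in `[a, y]) f t)%R) (f x).
Proof.
move=> fc ax.
have fi : lebesgue_measure.-integrable `[a, (x + 1)] (EFin \o f).
  apply: continuous_compact_integrable; first exact: segment_compact.
  exact: continuous_subspaceT.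
have xx : x < x + 1 by rewrite ltrDl.
have [Fd FE] := continuous_FTC1_closed xx fi ax (fc x).
by split; [exact: Fd|rewrite -FE derive1E].
Qed.

Lemma continuous_antiderivative f a : continuous f ->
  exists2 F, F 0 = 0 & forall x : R, a < x -> is_derive (x : R) (1 : R) F (f x).
Proof.
move=> fc.
exists (fun x => (\int[lebesgue_measure]_(t in `[a, x]) f t)%R -
   (\int[lebesgue_measure]_(t in `[a, 0%R]) f t)%R); first by rewrite subrr.
move=> x x1; have := is_derive_integral fc x1.
by move=> H; rewrite -[f x]subr0; exact: is_deriveB.
Qed.

(** Composition with the clamp of the line onto the unit interval. The extension has a primitive
    that is differentiable at 0 and 1 as well. *)
Lemma unit_extension f : unit_continuous f ->
  exists h : R -> R, [/\ continuous h, forall t, 0 <= t <= 1 -> h t = f t &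
    (forall t, 0 <= t <= 1 -> 0 <= f t) -> forall t, 0 <= h t].
Proof.
move=> fc.
pose kp (t : R) : R := Order.max 0 (Order.min t 1).
have kp01 t : 0 <= kp t <= 1.
  by rewrite /kp le_max lexx/= ge_max ler01 ge_min lexx orbT.
have kpE t : 0 <= t <= 1 -> kp t = t.
  by move=> /andP[t0 t1]; rewrite /kp min_l// max_r.
have kpc : continuous kp.
  move=> t; apply: (@continuous_max R R (cst 0) ((id : R -> R^o) \min cst 1)); first exact: cvg_cst.
  by apply: continuous_min; [exact: cvg_id|exact: cvg_cst].
have fkc : continuous (f \o kp).
  by move=> t; exact: (continuous_comp (kpc t) (fc _ (kp01 t))).
exists (f \o kp); split => //= [t /kpE ->//|f0 t]; exact: f0.
Qed.

Lemma unit_int_subst f (th : R -> R) : unit_continuous f -> th 0 = 0 -> th 1 = 1 ->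
  (forall t, 0 <= t <= 1 -> 0 <= th t <= 1 /\ C1_at th t) ->
  unit_int (fun t => derive1 th t * f (th t)) = unit_int f.
Proof.
move=> fc th0 th1 thP.
have [h [hc hE _]] := unit_extension fc.
have [F F0 Fd] := continuous_antiderivative (-1) hc.
have Fd1 t : 0 <= t <= 1 -> is_derive (t : R) (1 : R) F (h t).
  by move=> /andP[t0 _]; apply: Fd; rewrite (lt_le_trans _ t0)// ltrN10.
rewrite (@unit_int_eq f h); last by move=> t /hE.
rewrite (unit_int_derive Fd1 (fun t _ => hc t)) -th1 -[in F 0]th0.
rewrite (@unit_int_eq _ (fun t => derive1 th t * h (th t))); last first.
  by move=> t t01; rewrite hE//; have [] := thP t t01.
apply: (@unit_int_derive (F \o th)).
  move=> t t01; have [t01' tC] := thP t t01.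
  apply: (is_derive_comp1 (Fd1 _ t01')).
  exact: nbhs_singleton (C1_at_is_derive tC).
move=> t t01; have [t01' tC] := thP t t01.
apply: cvgM; first by case: tC.
exact: (continuous_comp (C1_at_continuous tC) (hc _)).
Qed.

(** The inverse of the normalized arclength. Adding [e] to the speed gives the arclength a positive
    derivative, so that its inverse is C^1 even where the curve stops; the bound on the new speed
    pays for this with [e]. *)
Lemma arclength_reparam f e : 0 < e -> unit_continuous f ->
  (forall t, 0 <= t <= 1 -> 0 <= f t) ->
  exists th : R -> R, [/\ th 0 = 0, th 1 = 1 &
    forall t, 0 <= t <= 1 -> [/\ 0 <= th t <= 1, C1_at th t, 0 <= derive1 th t &
      derive1 th t * f (th t) <= unit_int f + e]].
Proof.
move=> e0 fc f0.
have [ff [ffc ffE ff0]] := unit_extension fc.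
pose h t := ff t + e.
have hc : continuous h.
  move=> t; apply: cvgD; last exact: cvg_cst.
  exact: ffc.
have hgt t : e <= h t by rewrite /h lerDr ff0.
have hgt0 t : 0 < h t by exact: lt_le_trans (hgt t).
have [F F0 Fd] := continuous_antiderivative (-1) hc.
have FL : F 1 = unit_int f + e.
  have <- : unit_int h = F 1.
    have Fd' t : 0 <= t <= 1 -> is_derive (t : R) (1 : R) F (h t).
      by move=> /andP[t0 _]; apply: Fd; rewrite (lt_le_trans _ t0)// ltrN10.
    by rewrite (unit_int_derive Fd' (fun t _ => hc t)) F0 subr0.
  rewrite /h unit_intD; last 2 first.
    + by move=> t _; exact: ffc.
    + by move=> t _; exact: cvg_cst.
    by rewrite unit_int_cst; congr (_ + _); exact: unit_int_eq.
set L := F 1.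
have Fmono x y : -1 < x -> x < y -> F x < F y.
  move=> x1 xy.
  have xz z : z \in `[x, y] -> -1 < z by rewrite in_itv/= => /andP[+ _]; exact: lt_le_trans.
  have [z||] := @MVT _ F h x y xy.
  - by move=> zxy; apply: Fd; apply: xz; move: z zxy; exact: subset_itv_oo_cc.
  - apply: derivable_within_continuous => z /xz z1.
    by have [] := Fd z z1.
  move=> c cxy E; by rewrite -subr_gt0 E mulr_gt0// subr_gt0.
have L0 : 0 < L by rewrite -F0; apply: Fmono; rewrite ?ltrN10.
pose s x := F x / L.
have sd x : -1 < x -> is_derive (x : R) (1 : R) s (h x / L).
  move=> x1; have := Fd x x1 => Fdx.
  have -> : s = (fun x => L^-1 *: F x) by apply/funext => y; rewrite /s mulrC.
  by rewrite mulrC; apply: is_deriveZ.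
have smono x y : -1 < x -> x < y -> s x < s y.
  by move=> x1 xy; rewrite ltr_pM2r ?invr_gt0//; exact: Fmono.
have s0 : s 0 = 0 by rewrite /s F0 mul0r.
have s1 : s 1 = 1 by rewrite /s divff// gt_eqF.
(* The inverse must be C^1 on a neighbourhood of the unit interval; the primitive is available
   beyond -1, which leaves room for [-1/2, 3/2]. *)
pose a : R := -2^-1; pose b : R := 3 / 2.
have a1 : -1 < a by rewrite /a; lra.
have ab : a < b by rewrite /a /b; lra.
have sc x : -1 < x -> {for x, continuous s}.
  by move=> /sd[sdx _]; apply: differentiable_continuous; exact/derivable1_diffP.
have sinj x y : -1 < x -> -1 < y -> s x = s y -> x = y.
  move=> x1 y1 E; have [xy|yx|//] := ltgtP x y.
    by have := smono _ _ x1 xy; rewrite E ltxx.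
  by have := smono _ _ y1 yx; rewrite E ltxx.
have ex u : s a <= u <= s b -> exists x, x \in `[a, b] /\ s x = u.
  move=> u01; have [||x xab xu] := @IVT R s a b u (ltW ab).
  - apply: derivable_within_continuous => x; rewrite in_itv/= => /andP[ax _].
    by have [] := sd x (lt_le_trans a1 ax).
  - move/andP: u01 => [u0 u1]; rewrite ge_min u0 le_max u1 orbT//.
  by exists x.
pose th u := xget 0 [set x | x \in `[a, b] /\ s x = u].
have thP u : s a <= u <= s b -> th u \in `[a, b] /\ s (th u) = u.
  by move=> /ex[x xP]; exact: (@xgetPex _ 0 [set x | x \in `[a, b] /\ s x = u] (ex_intro _ x xP)).
have thK x : x \in `[a, b] -> th (s x) = x.
  rewrite in_itv/= => /andP[ax xb].
  have [|thab thE] := thP (s x).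
    by apply/andP; split; [move: ax|move: xb]; rewrite le_eqVlt => /predU1P[->//|/smono H];
       apply/ltW/H => //; apply: lt_le_trans ax.
  apply: sinj thE; last exact: lt_le_trans ax.
  by move: thab; rewrite in_itv/= => /andP[+ _]; exact: lt_le_trans.
have thd x : a < x < b -> is_derive (s x) (1 : R) th (L / h x).
  move=> /andP[ax xb]; have x1 := lt_trans a1 ax.
  rewrite -[L / h x]invrK invf_div.
  have nx : \forall y \near x, y \in `]a, b[ by apply: near_in_itvoo; rewrite in_itv/= ax.
  apply: is_derive_inverse.
  - by near=> y; apply: thK; apply: subset_itv_oo_cc; near: y.
  - near=> y; apply: sc; have : y \in `]a, b[ by near: y.
    by rewrite in_itv/= => /andP[+ _]; exact: lt_trans.
  - exact: sd.
  - by rewrite gt_eqF// divr_gt0.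
have thd' u : s a < u < s b -> is_derive (u : R) (1 : R) th (L / h (th u)).
  move=> /andP[au ub]; have [|thab thE] := thP u; first by rewrite !ltW.
  rewrite -{1}thE; apply: thd; move: thab; rewrite in_itv/= => /andP[].
  rewrite !le_eqVlt => /predU1P[E|->]; first by move: au; rewrite {1}E thE ltxx.
  by move=> /predU1P[E|->//]; move: ub; rewrite -{1}E thE ltxx.
have sa : s a < 0 by rewrite -s0; apply: smono => //; rewrite /a; lra.
have sb : 1 < s b by rewrite -s1; apply: smono => //; rewrite /b; lra.
have th01 t : 0 <= t <= 1 -> 0 <= th t <= 1.
  move=> /andP[t0 t1]; have [|] := thP t.
    by rewrite (le_trans (ltW sa) t0) (le_trans t1 (ltW sb)).
  rewrite in_itv/= => /andP[ath _] E; apply/andP; split.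
    rewrite leNgt; apply/negP => /(smono _ _ (lt_le_trans a1 ath)).
    by rewrite E s0 ltNge t0.
  rewrite leNgt; apply/negP => H; have := smono 1 (th t) (lt_trans (ltrN10 _) ltr01) H.
  by rewrite E s1 ltNge t1.
have thd1 (t : R) : 0 <= t <= 1 -> \forall u \near t, is_derive (u : R) (1 : R) th (L / h (th u)).
  move=> /andP[t0 t1].
  have nx : \forall u \near t, u \in `]s a, s b[.
    by apply: near_in_itvoo; rewrite in_itv/= (lt_le_trans sa t0) (le_lt_trans t1 sb).
  by near=> u; apply: thd'; have : u \in `]s a, s b[ by near: u.
have dth t : 0 <= t <= 1 -> derive1 th t = L / h (th t).
  by move=> /thd1/nbhs_singleton[_]; rewrite derive1E.
exists th; split.
- by rewrite -s0 thK// in_itv/= /a /b; lra.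
- by rewrite -s1 thK// in_itv/= /a /b; lra.
move=> t t01; split; first exact: th01.
- apply: (C1_at_derive (thd1 _ t01)).
  have thc : {for t, continuous th}.
    have [thdt _] := nbhs_singleton (thd1 t t01).
    by apply: differentiable_continuous; exact/derivable1_diffP.
  apply: cvgM; first exact: cvg_cst.
  apply: cvgV; first by rewrite gt_eqF.
  by apply: (@continuous_comp _ _ _ th h) => //; exact: hc.
- by rewrite dth// divr_ge0// ltW.
- rewrite dth// -FL -/L mulrAC -mulrA ler_piMr//; first exact: ltW.
  by rewrite ler_pdivrMr// mul1r /h ffE ?th01// lerDl ltW.
Unshelve. all: by end_near. Qed.

End UnitIntegral.

Arguments unit_continuous_cst {R} k t _.
Arguments unit_continuousZ {R} k {f} _ t _.
Arguments unit_continuousD {R f g} _ _ t _.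

(* Unification must not unfold the integral. *)
Opaque unit_int.

(** * Curves and the Riemannian distance *)

Section Bilin.
Context {R : realType} {n : nat}.
Implicit Types (G H : 'M[R]_n) (u v w : 'rV[R]_n).

Lemma bilinE G u v : bilin G u v = \sum_k \sum_l u 0 k * G k l * v 0 l.
Proof.
rewrite /bilin mxE exchange_big/=; apply: eq_bigr => l _.
by rewrite !mxE mulr_suml; apply: eq_bigr.
Qed.

Lemma bilinDl G u v w : bilin G (u + v) w = bilin G u w + bilin G v w.
Proof. by rewrite /bilin !mulmxDl mxE. Qed.

Lemma bilinDr G u v w : bilin G u (v + w) = bilin G u v + bilin G u w.
Proof. by rewrite /bilin linearD/= mulmxDr mxE. Qed.

Lemma bilinZl G k u v : bilin G (k *: u) v = k * bilin G u v.
Proof. by rewrite /bilin -!scalemxAl mxE. Qed.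

Lemma bilinZr G k u v : bilin G u (k *: v) = k * bilin G u v.
Proof. by rewrite /bilin linearZ/= -scalemxAr mxE. Qed.

Lemma bilinNl G u v : bilin G (- u) v = - bilin G u v.
Proof. by rewrite -scaleN1r bilinZl mulN1r. Qed.

Lemma bilinNr G u v : bilin G u (- v) = - bilin G u v.
Proof. by rewrite -scaleN1r bilinZr mulN1r. Qed.

Lemma bilin0l G v : bilin G 0 v = 0.
Proof. by rewrite -(scale0r v) bilinZl mul0r. Qed.

Lemma bilinDm G H u v : bilin (G + H) u v = bilin G u v + bilin H u v.
Proof. by rewrite /bilin mulmxDr mulmxDl mxE. Qed.

Lemma bilinNm G u v : bilin (- G) u v = - bilin G u v.
Proof. by rewrite /bilin mulmxN mulNmx mxE. Qed.

Lemma bilinZm G k u v : bilin (k *: G) u v = k * bilin G u v.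
Proof. by rewrite /bilin -scalemxAr -scalemxAl mxE. Qed.

Lemma bilin_sym G u v : G^T = G -> bilin G u v = bilin G v u.
Proof.
move=> GT; rewrite !bilinE exchange_big/=; apply: eq_bigr => k _.
apply: eq_bigr => l _; rewrite -[in RHS]GT mxE; ring.
Qed.

Lemma bilin_continuous (X : topologicalType) (G : X -> 'M[R]_n)
    (u v : X -> 'rV[R]_n) x :
  {for x, continuous G} -> {for x, continuous u} -> {for x, continuous v} ->
  {for x, continuous (fun y => bilin (G y) (u y) (v y))}.
Proof.
move=> Gc uc vc.
apply: (@near_eq_continuous_at _ _ (fun y => \sum_k \sum_l u y 0 k * G y k l * v y 0 l)).
  by apply: nearW => y; rewrite bilinE.
apply: cvg_big => [|k _]; first exact: add_continuous.
apply: cvg_big => [|l _]; first exact: add_continuous.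
by apply: cvgM; [apply: cvgM|]; exact: continuous_entry.
Qed.

Lemma bilin_bound G (K : R) u v : 0 <= K -> (forall k l, `|G k l| <= K) ->
  `|bilin G u v| <= n%:R ^+ 2 * K * `|u| * `|v|.
Proof.
move=> K0 GK; rewrite bilinE.
have -> : n%:R ^+ 2 * K * `|u| * `|v| = \sum_(k < n) \sum_(l < n) `|u| * K * `|v|.
  under eq_bigr do rewrite sumr_const card_ord -[_ *+ n]mulr_natl.
  by rewrite sumr_const card_ord -[RHS]mulr_natl; ring.
apply: (le_trans (ler_norm_sum _ _ _)); apply: ler_sum => k _.
apply: (le_trans (ler_norm_sum _ _ _)); apply: ler_sum => l _.
by rewrite !normrM ler_pM ?rV_coord_le// ler_pM// rV_coord_le.
Qed.

End Bilin.

(** * Speed of curves in charts *)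

Section Curves.
Context {R : realType} {n : nat} {M : topologicalType}.
Context {A : smooth_atlas R n M} (g : riemannian_metric A).
Implicit Types (i j : chart_index A) (w : R -> M) (c : R -> 'rV[R]_n) (x y z : M).

Local Notation img i := (chart i @` chart_dom i).

Lemma chart_imgP i (a : 'rV[R]_n) : img i a ->
  chart_dom i (chart_inv i a) /\ chart i (chart_inv i a) = a.
Proof. by case=> p ip <-; rewrite chartK. Qed.

Definition trans_dom i j := chart i @` (chart_dom i `&` chart_dom j).

Lemma trans_domE i j a : trans_dom i j a <-> img i a /\ chart_dom j (chart_inv i a).
Proof.
split; first by case=> p [ip jp] <-; rewrite chartK//; split => //; exists p.
by case=> [[p ip <-]]; rewrite chartK// => jp; exists p.
Qed.

Lemma near_chart_dom w t i : {for t, continuous w} -> chart_dom i (w t) ->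
  \forall s \near t, chart_dom i (w s).
Proof.
by move=> wc it; apply: wc; apply: open_nbhs_nbhs; split => //; exact: chart_dom_open.
Qed.

Lemma trans_dom_open i j : open (trans_dom i j).
Proof.
rewrite openE => a /trans_domE[ia ja]; rewrite /interior.
have H : \forall b \near a, img i b.
  by apply: open_nbhs_nbhs; split => //; exact: chart_image_open.
have H' : \forall b \near a, chart_dom j (chart_inv i b).
  apply: (@chart_inv_continuous _ _ _ A i a (mem_set ia)).
  by apply: open_nbhs_nbhs; split => //; exact: chart_dom_open.
by near=> b; apply/trans_domE; split; near: b.
Unshelve. all: by end_near. Qed.

Lemma trans_Ck1 i j : Ck_on 1 (trans_dom i j) (chart j \o chart_inv i).
Proof. exact: transition_smooth. Qed.

Lemma chart_continuous_at i x : chart_dom i x -> {for x, continuous (chart i)}.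
Proof. by move=> ix; apply: chart_continuous; exact: mem_set. Qed.

Lemma chart_inv_continuous_at i a : img i a -> {for a, continuous (chart_inv i)}.
Proof. by move=> ix; apply: chart_inv_continuous; exact: mem_set. Qed.

Lemma near_chart_change w t i j : {for t, continuous w} ->
  chart_dom i (w t) ->
  \forall s \near t, (chart j \o w) s = ((chart j \o chart_inv i) \o (chart i \o w)) s.
Proof.
move=> wc it; have H := near_chart_dom wc it.
by near=> s; rewrite /= chartK//; near: s.
Unshelve. all: by end_near. Qed.

Definition chart_speed i w t :=
  let v := derive1 (chart i \o w) t in
  Num.sqrt (bilin (metric g i (chart i (w t))) v v).

Lemma speedE w t i : {for t, continuous w} -> chart_dom i (w t) ->
  derivable (chart i \o w) t 1 -> speed g w t = chart_speed i w t.
Proof.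
move=> wc it id; rewrite /speed /chart_speed; set j := chart_at A (w t).
have jt : chart_dom j (w t) by exact: chart_at_dom.
congr Num.sqrt.
rewrite (metric_transition g it jt).
have E : derive1 (chart j \o w) t =
  'D_(derive1 (chart i \o w) t) (chart j \o chart_inv i) (chart i (w t)).
  rewrite derive1E (near_eq_derive _ (near_chart_change j wc it)).
  have tij : trans_dom i j ((chart i \o w) t) by exists (w t).
  have [_ ->] := @is_derive_comp_Ck1 _ _ _ _ _ _ (chart i \o w) t _ (@trans_dom_open i j) (@trans_Ck1 i j) tij (derivableP id).
  by rewrite derive1E.
by rewrite E.
Qed.

Lemma C1_curve_chart i c :
  (forall t, 0 <= t <= 1 -> img i (c t) /\ C1_at c t) ->
  C1_curve A (chart_inv i \o c) /\
  forall t, 0 <= t <= 1 -> speed g (chart_inv i \o c) t =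
    Num.sqrt (bilin (metric g i (c t)) (derive1 c t) (derive1 c t)).
Proof.
move=> cP.
have wc t : 0 <= t <= 1 -> {for t, continuous (chart_inv i \o c)}.
  move=> /cP[it ct].
  exact: (continuous_comp (C1_at_continuous ct) (chart_inv_continuous_at it)).
have near_img (t : R) : 0 <= t <= 1 -> \forall s \near t, img i (c s).
  move=> /cP[it ct]; apply: (C1_at_continuous ct).
  by apply: open_nbhs_nbhs; split => //; exact: chart_image_open.
have chartE (t : R) : 0 <= t <= 1 ->
    \forall s \near t, c s = (chart i \o (chart_inv i \o c)) s.
  by move=> /near_img H; near=> s; have /chart_imgP[_ /= ->] : img i (c s) by near: s.
split.
  move=> t t01; have [it ct] := cP t t01; split; first exact: wc.
  move=> j jt; apply: (@C1_at_comp_Ck1 _ _ _ _ (trans_dom i j) (chart j \o chart_inv i) c) => //.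
  - exact: trans_dom_open.
  - exact: trans_Ck1.
  - exact/trans_domE.
move=> t t01; have [it ct] := cP t t01; have [di ci] := chart_imgP it.
have [/nbhs_singleton cd _] := C1_at_eq (chartE _ t01) ct.
rewrite (speedE (wc _ t01) di cd).
rewrite /chart_speed /= ci.
suff -> : derive1 (chart i \o (chart_inv i \o c)) t = derive1 c t by [].
by rewrite !derive1E; apply/esym; apply: near_eq_derive; exact: chartE.
Unshelve. all: by end_near. Qed.

Lemma C1_curve_comp w (th : R -> R) : C1_curve A w ->
  (forall t, 0 <= t <= 1 -> 0 <= th t <= 1 /\ C1_at th t) ->
  C1_curve A (w \o th) /\
  forall t, 0 <= t <= 1 -> speed g (w \o th) t = `|derive1 th t| * speed g w (th t).
Proof.
move=> wP thP.
have wc t : 0 <= t <= 1 -> {for t, continuous (w \o th)}.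
  move=> /thP[th01 ct]; have [wc _] := wP _ th01.
  exact: (continuous_comp (C1_at_continuous ct) wc).
split.
  move=> t t01; have [th01 ct] := thP _ t01; split; first exact: wc.
  by move=> i it; apply: (@C1_at_comp _ _ (chart i \o w)) => //; have [_] := wP _ th01; apply.
move=> t t01; have [th01 ct] := thP _ t01; have [wct /(_ _ (chart_at_dom A (w (th t))))] := wP _ th01.
set i := chart_at A (w (th t)) => wC.
have wd := nbhs_singleton (C1_at_is_derive wC).
have thd := nbhs_singleton (C1_at_is_derive ct).
have [cd cE] := is_derive_comp1 wd thd.
have it : chart_dom i ((w \o th) t) by exact: chart_at_dom.
rewrite (speedE (wc _ t01) it cd) /chart_speed /speed -/i.
have -> : derive1 (chart i \o (w \o th)) t = derive1 th t *: derive1 (chart i \o w) (th t).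
  by rewrite derive1E.
rewrite -sqrtr_sqr -sqrtrM ?sqr_ge0//; congr Num.sqrt.
by rewrite /bilin /= linearZ/= -!scalemxAl -scalemxAr !mxE mulrA expr2.
Qed.

Lemma speed_ge0 w t : 0 <= speed g w t. Proof. exact: sqrtr_ge0. Qed.

(** [C1_curve] asserts continuity of [w] at points of the unit interval only, while continuity of
    the speed at an endpoint also involves neighbours outside. There it follows from
    differentiability in the chart. *)
Lemma near_curve_continuous w (t : R) i : {for t, continuous w} ->
  chart_dom i (w t) -> C1_at (chart i \o w) t ->
  \forall s \near t, {for s, continuous w}.
Proof.
move=> wc it wC.
have H := near_join (near_chart_dom wc it).
have cd := C1_at_is_derive wC.
near=> s.
have ns : \forall u \near s, chart_dom i (w u) by near: s.
have is_ : chart_dom i (w s) by exact: nbhs_singleton ns.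
have [cs _] : is_derive (s : R) (1 : R) (chart i \o w) (derive1 (chart i \o w) s) by near: s.
apply: (@near_eq_continuous_at _ _ (chart_inv i \o (chart i \o w))).
  by near=> u; rewrite /= chartK//; near: u.
apply: continuous_comp.
  by apply: differentiable_continuous; exact/derivable1_diffP.
by apply: chart_inv_continuous_at; exists (w s).
Unshelve. all: by end_near. Qed.

Lemma speed_continuous w : C1_curve A w -> unit_continuous (speed g w).
Proof.
move=> wP t t01; have [wc /(_ _ (chart_at_dom A (w t)))] := wP _ t01.
set i := chart_at A (w t) => wC.
have it : chart_dom i (w t) by exact: chart_at_dom.
have nc := near_curve_continuous wc it wC.
have nd := near_chart_dom wc it.
have cd := C1_at_is_derive wC.
apply: (@near_eq_continuous_at _ _ (chart_speed i w)).
  near=> s.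
  have [cs _] : is_derive (s : R) (1 : R) (chart i \o w) (derive1 (chart i \o w) s) by near: s.
  by apply/esym; apply: speedE cs; near: s.
apply: (@continuous_comp _ _ _ (fun s => bilin (metric g i (chart i (w s))) (derive1 (chart i \o w) s) (derive1 (chart i \o w) s)) Num.sqrt); last exact: sqrt_continuous.
apply: bilin_continuous; [|by case: wC..].
apply: (@continuous_comp _ _ _ (chart i \o w) (metric g i)); first exact: C1_at_continuous.
have [+ _] := metric_smooth g i 0.
by apply; apply: mem_set; exists (w t).
Unshelve. all: by end_near. Qed.

End Curves.

Section Smoothstep.
Context {R : realType}.

Lemma is_derive_affine (a b t : R) : is_derive t 1 (fun s : R => a * s + b) a.
Proof.
have H : is_derive t 1 (fun s : R => a *: s + b) (a *: 1 + 0).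
  by apply: is_deriveD; apply: is_deriveZ.
by apply: is_derive_eq H _; rewrite addr0 /GRing.scale/= mulr1.
Qed.

Lemma C1_at_affine (a b t : R) : C1_at (fun s : R => a * s + b) t.
Proof.
apply: (@C1_at_derive _ _ _ (cst a)); last exact: cvg_cst.
by near=> s; exact: is_derive_affine.
Unshelve. all: by end_near. Qed.

Lemma derive1_affine (a b t : R) : derive1 (fun s : R => a * s + b) t = a.
Proof. by have [_] := is_derive_affine a b t; rewrite derive1E. Qed.

(** A C^1 step at rest at both ends, the normalized primitive of [max(0, t - t^2)]; curves slowed
    down by it can be joined in a C^1 way. The primitive is based at -2, whence the restrictions to
    [-2 < t]. *)
Lemma smoothstep_exists : exists th b : R -> R, [/\ forall t, -2 < t -> t <= 0 -> th t = 0,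
  forall t, 1 <= t -> th t = 1, forall t, 0 <= th t <= 1 \/ t <= -2,
  continuous b /\ [/\ forall t, t <= 0 \/ 1 <= t -> b t = 0 & forall t, 0 <= b t] &
  forall t : R, -2 < t -> is_derive (t : R) (1 : R) th (b t)].
Proof.
pose b0 (t : R) : R := Order.max 0 (t - t * t).
have b0c : continuous b0.
  move=> t; apply: (@continuous_max R R (cst 0) (fun t : R => (t - t * t : R^o))); first exact: cvg_cst.
  by apply: cvgB; [exact: cvg_id|apply: cvgM; exact: cvg_id].
have b00 t : t <= 0 \/ 1 <= t -> b0 t = 0.
  by move=> H; rewrite /b0 max_l//; case: H => ?; nra.
have b0ge t : 0 <= b0 t by rewrite /b0 le_max lexx.
have [F F0 Fd] := continuous_antiderivative (-2) b0c.
have mvt (x y : R) : -2 < x -> x <= y -> exists2 c, x <= c <= y & F y - F x = b0 c * (y - x).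
  move=> x2 xy.
  have [z|| c] := @MVT_segment _ F b0 x y xy.
  - by rewrite in_itv/= => /andP[xz _]; apply: Fd; exact: lt_trans xz.
  - apply: derivable_within_continuous => z; rewrite in_itv/= => /andP[xz _].
    by have [] := Fd z (lt_le_trans x2 xz).
  - by rewrite in_itv/= => cxy E; exists c.
(* The integrand is nonnegative, and its positivity between 1/3 and 1/2 already gives a positive
   increment. *)
have F1 : 0 < F 1.
  have h32 : (3^-1 : R) < 2^-1 by lra.
  have [z|| c] := @MVT _ F b0 _ _ h32.
  - by rewrite in_itv/= => /andP[xz _]; apply: Fd; lra.
  - apply: derivable_within_continuous => z; rewrite in_itv/= => /andP[xz _].
    by have [] := Fd z ltac:(lra).
  - rewrite in_itv/= => /andP[c1 c2] E.
    have [c' _ E'] := mvt 0 3^-1 ltac:(lra) ltac:(lra).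
    have [c'' _ E''] := mvt 2^-1 1 ltac:(lra) ltac:(lra).
    have bc : 0 < b0 c by rewrite /b0 lt_max; apply/orP; right; nra.
    have := b0ge c'; have := b0ge c''.
    nra.
exists (fun t => F t / F 1), (fun t => b0 t / F 1); split.
- move=> t t2 t0; have [c /andP[_ c0] E] := mvt t 0 t2 t0.
  by move: E; rewrite (b00 c) ?mul0r ?F0; [move/subr0_eq <-; rewrite ?mul0r|left].
- move=> t t1; have [c /andP[c1 _] E] := mvt 1 t ltac:(lra) t1.
  move: E; rewrite (b00 c) ?mul0r; last by right.
  by move/subr0_eq ->; rewrite divff// gt_eqF.
- move=> t; have [t2|t2] := leP t (-2); [by right|left].
  have [t0|t0] := leP t 0.
    have [c /andP[_ c0] E] := mvt t 0 t2 t0.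
    by move: E; rewrite (b00 c) ?mul0r ?F0; [move/subr0_eq <-; rewrite ?mul0r lexx ler01|left].
  have [t1|t1] := leP 1 t.
    have [c /andP[c1 _] E] := mvt 1 t ltac:(lra) t1.
    move: E; rewrite (b00 c) ?mul0r; last by right.
    by move/subr0_eq ->; rewrite divff ?gt_eqF// lexx ler01.
  have [c _ E] := mvt 0 t ltac:(lra) (ltW t0).
  have [c' _ E'] := mvt t 1 t2 (ltW t1).
  have := b0ge c; have := b0ge c' => h h'.
  have H : 0 <= F t <= F 1 by move: E E'; rewrite F0 => E E'; apply/andP; split; nra.
  by move/andP: H => [h1 h2]; rewrite divr_ge0 ?(ltW F1)//= ler_pdivrMr// mul1r.
- split; first by move=> t; apply: cvgM; [exact: b0c|exact: cvg_cst].
  split; first by move=> t /b00 ->; rewrite mul0r.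
  by move=> t; rewrite divr_ge0// ltW.
- move=> t t2; have Ft := Fd t t2.
  have -> : (fun t => F t / F 1) = (fun t => (F 1)^-1 *: F t) by apply/funext => s; rewrite mulrC.
  by rewrite mulrC; apply: is_deriveZ.
Qed.

End Smoothstep.

(** * Concatenation of curves and the infimum of lengths *)

Section Distance.
Context {R : realType} {n : nat} {M : topologicalType}.
Context {A : smooth_atlas R n M} (g : riemannian_metric A).
Implicit Types (i j : chart_index A) (w : R -> M) (c : R -> 'rV[R]_n) (x y z : M).

Lemma speed_near_eq (w1 w2 : R -> M) (t : R) :
  (\forall s \near t, w1 s = w2 s) -> speed g w1 t = speed g w2 t.
Proof.
move=> H; rewrite /speed (nbhs_singleton H) !derive1E.
have -> // : 'D_1 (chart (chart_at A (w2 t)) \o w1) t = 'D_1 (chart (chart_at A (w2 t)) \o w2) t.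
by apply: near_eq_derive; apply: filterS H => s /= ->.
Qed.

Lemma curve_lengthE w : curve_length g w = unit_int (speed g w).
Proof. exact: unit_intE. Qed.

Opaque curve_length.

Lemma unit_speed_comp w (th : R -> R) : C1_curve A w -> th 0 = 0 -> th 1 = 1 ->
  (forall t, 0 <= t <= 1 -> 0 <= th t <= 1 /\ C1_at th t) ->
  (forall t, 0 <= t <= 1 -> 0 <= derive1 th t) ->
  unit_int (speed g (w \o th)) = unit_int (speed g w).
Proof.
move=> wC th0 th1 thP thd; have [uC uS] := C1_curve_comp g wC thP.
transitivity (unit_int (fun t => derive1 th t * speed g w (th t))); last first.
  exact: (unit_int_subst (speed_continuous wC) th0 th1 thP).
by apply: unit_int_eq => t t01; rewrite uS// ger0_norm ?thd.
Qed.

(** Both curves are slowed down to rest at the junction, so their velocities agree there; the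
    reparametrization does not change the lengths. *)
Lemma C1_curve_concat (w1 w2 : R -> M) : C1_curve A w1 -> C1_curve A w2 ->
  w1 1 = w2 0 -> exists w : R -> M, [/\ C1_curve A w, w 0 = w1 0, w 1 = w2 1 &
   curve_length g w = curve_length g w1 + curve_length g w2].
Proof.
move=> w1C w2C E.
have z2 (a b : R) : 0 = `|0 : R| * a + `|0 : R| * b by rewrite normr0; lra.
have [th [b [th0 th1 th01 [bc [b0 bge]] thd]]] := @smoothstep_exists R.
pose al (t : R) := th (2 * t + 0); pose be (t : R) := th (2 * t + (-1)).
have alE t : al t = th (2 * t) by rewrite /al addr0.
have beE t : be t = th (2 * t - 1) by [].
have H (d t : R) : -1 <= d -> 0 <= t <= 1 -> [/\ 0 <= th (2 * t + d) <= 1,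
   C1_at (fun t => th (2 * t + d)) t & derive1 (fun t => th (2 * t + d)) t = 2 * b (2 * t + d)].
  move=> d1 /andP[t0 t1]; have tt : -2 < 2 * t + d by lra.
  have thC : C1_at th (2 * t + d).
    apply: (@C1_at_derive _ _ _ b); last exact: bc.
    near=> s; apply: thd; near: s.
    exact: lt_nbhsr.
  split.
  - by case: (th01 (2 * t + d)) => // H; lra.
  - exact: (@C1_at_comp R R th (fun s : R => 2 * s + d) t thC (C1_at_affine 2 d t)).
  - have := @is_derive_comp1 _ _ th (fun s : R => 2 * s + d) t _ _ (thd _ tt) (is_derive_affine 2 d t).
    by case=> _ E1; rewrite derive1E; exact: E1.
have alP t : 0 <= t <= 1 -> 0 <= al t <= 1 /\ C1_at al t.
  by move=> /(H 0)[] //; lra.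
have beP t : 0 <= t <= 1 -> 0 <= be t <= 1 /\ C1_at be t.
  by move=> /(H (-1))[] //; lra.
have [u1C u1S] := C1_curve_comp g w1C alP.
have [u2C u2S] := C1_curve_comp g w2C beP.
have al1 t : 2^-1 <= t -> al t = 1 by move=> ht; rewrite alE th1//; lra.
have be0 t : -2^-1 < t -> t <= 2^-1 -> be t = 0 by move=> ht ht'; rewrite beE th0//; lra.
pose w t := if t <= 2^-1 then w1 (al t) else w2 (be t).
have nlt (t : R) : t < 2^-1 -> \forall s \near t, w1 (al s) = w s.
  move=> ht; near=> s; rewrite /w ifT//; apply: ltW; near: s; exact: lt_nbhsl.
have ngt (t : R) : 2^-1 < t -> \forall s \near t, w2 (be s) = w s.
  move=> ht; near=> s; rewrite /w ifF//; apply/negbTE; rewrite -ltNge; near: s; exact: lt_nbhsr.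
have wh : w 2^-1 = w1 1 by rewrite /w lexx al1.
have h01 : 0 <= (2^-1 : R) <= 1 by lra.
have u1h : w1 (al 2^-1) = w1 1 by rewrite al1.
have u2h : w2 (be 2^-1) = w1 1 by rewrite be0//; lra.
have near_half (P : M -> Prop) : (\forall s \near (2^-1 : R), P (w1 (al s))) ->
    (\forall s \near (2^-1 : R), P (w2 (be s))) -> \forall s \near (2^-1 : R), P (w s).
  by move=> h1 h2; near=> s; rewrite /w; case: ifP => _; near: s.
(* Near the junction one of the two reparametrized curves is constantly at the junction point. So in
   a chart [w] is the sum of both minus that point, and smoothness follows without one-sided
   derivatives. *)
have chartw i : chart_dom i (w1 1) -> \forall s \near (2^-1 : R),
     ((chart i \o (w1 \o al)) s + (chart i \o (w2 \o be)) s) + (- chart i (w1 1)) = (chart i \o w) s.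
  move=> i1; near=> s; rewrite /= /w; case: leP => hs.
    rewrite be0//; last by near: s; apply: lt_nbhsr; lra.
    by rewrite -E addrK.
  by rewrite al1 ?ltW// addrAC subrr add0r.
have wC : C1_curve A w.
  move=> t t01; have [ht|ht|ht] := ltgtP t 2^-1.
  - have [c1 c2] := u1C t t01; split; first by apply: near_eq_continuous_at c1; exact: nlt.
    have et := nbhs_singleton (nlt _ ht) => i; rewrite -et => /c2.
    by apply: C1_at_eq; have := nlt _ ht; apply: filterS => s /= ->.
  - have [c1 c2] := u2C t t01; split; first by apply: near_eq_continuous_at c1; exact: ngt.
    have et := nbhs_singleton (ngt _ ht) => i; rewrite -et => /c2.
    by apply: C1_at_eq; have := ngt _ ht; apply: filterS => s /= ->.
  - rewrite ht; have [c1 d1] := u1C _ h01; have [c2 d2] := u2C _ h01.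
    split.
      move=> P; rewrite wh => nP; apply: near_half.
        by apply: c1; rewrite /= u1h.
      by apply: c2; rewrite /= u2h.
    rewrite wh => i i1; apply: C1_at_eq (chartw _ i1) _.
    apply: C1_atD; last first.
      apply: (@C1_at_derive _ _ _ (cst 0)); last exact: cvg_cst.
      by near=> s; exact: is_derive_cst.
    by apply: C1_atD; [apply: d1; rewrite /= u1h|apply: d2; rewrite /= u2h].
have b0' t : t <= 0 \/ 1 <= t -> 2 * b t = 0 by move=> /b0 ->; rewrite mulr0.
have dal t : 0 <= t <= 1 -> derive1 al t = 2 * b (2 * t + 0) by move=> /(H 0)[] //; lra.
have dbe t : 0 <= t <= 1 -> derive1 be t = 2 * b (2 * t + (-1)) by move=> /(H (-1))[] //; lra.
(* At each time at most one of the two reparametrized curves moves. *)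
have speedw t : 0 <= t <= 1 -> speed g w t = speed g (w1 \o al) t + speed g (w2 \o be) t.
  move=> t01; rewrite u1S// u2S// dal// dbe//.
  have [ht|ht|ht] := ltgtP t 2^-1.
  - rewrite -(speed_near_eq (nlt _ ht)) u1S// dal//.
    by rewrite [2 * b (2 * t + -1)]b0' ?normr0 ?mul0r ?addr0//; left; lra.
  - rewrite -(speed_near_eq (ngt _ ht)) u2S// dbe//.
    by rewrite [2 * b (2 * t + 0)]b0' ?normr0 ?mul0r ?add0r//; right; lra.
  rewrite [2 * b (2 * t + -1)]b0'; last by left; lra.
  rewrite [2 * b (2 * t + 0)]b0'; last by right; lra.
  transitivity (0 : R); last exact: z2.
  rewrite ht /speed; set i := chart_at A (w 2^-1).
  have i1 : chart_dom i (w1 1) by rewrite -wh; exact: chart_at_dom.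
  suff -> : derive1 (chart i \o w) 2^-1 = 0 by rewrite bilin0l sqrtr0.
  have [_ e1] := u1C _ h01; have [_ e2] := u2C _ h01.
  have [_ f1] := w1C 1 ltac:(rewrite ler01 lexx; exact: isT).
  have [_ f2] := w2C 0 ltac:(rewrite ler01 lexx; exact: isT).
  have D1 : is_derive (2^-1 : R) (1 : R) (chart i \o (w1 \o al)) 0.
    have [_ /C1_at_is_derive/nbhs_singleton ald] := alP _ h01.
    have := nbhs_singleton (C1_at_is_derive (f1 i i1)); rewrite -{1}(al1 2^-1)// => w1d.
    have := is_derive_comp1 w1d ald.
    by rewrite dal// b0' ?scale0r//; right; lra.
  have D2 : is_derive (2^-1 : R) (1 : R) (chart i \o (w2 \o be)) 0.
    have [_ /C1_at_is_derive/nbhs_singleton bed] := beP _ h01.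
    have i2 : chart_dom i (w2 0) by rewrite -E.
    have bh : be 2^-1 = 0 by rewrite be0//; lra.
    have := nbhs_singleton (C1_at_is_derive (f2 i i2)); rewrite -{1}bh => w2d.
    have := is_derive_comp1 w2d bed.
    by rewrite dbe// b0' ?scale0r//; left; lra.
  rewrite derive1E -(near_eq_derive _ (chartw i i1)).
  have D3 := is_deriveD (is_deriveD D1 D2) (is_derive_cst (- chart i (w1 1)) (2^-1 : R) (1 : R)).
  by have [_ ->] := D3; rewrite !addr0.
exists w; split => //.
- by rewrite /w ifT ?invr_ge0// alE mulr0 th0//; lra.
- have h : ~~ ((1 : R) <= 2^-1) by rewrite -ltNge; lra.
  by rewrite /w (negbTE h) [be 1]th1; [|lra].
have al_0 : al 0 = 0 by rewrite alE mulr0 th0//; lra.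
have al_1 : al 1 = 1 by rewrite alE th1//; lra.
have be_0 : be 0 = 0 by apply: be0; lra.
have be_1 : be 1 = 1 by apply: th1; lra.
have al_d t : 0 <= t <= 1 -> 0 <= derive1 al t by move=> t01; rewrite (dal t t01) mulr_ge0.
have be_d t : 0 <= t <= 1 -> 0 <= derive1 be t by move=> t01; rewrite (dbe t t01) mulr_ge0.
have E1 := unit_speed_comp w1C al_0 al_1 alP al_d.
have E2 := unit_speed_comp w2C be_0 be_1 beP be_d.
have E3 : unit_int (speed g w) = unit_int (speed g (w1 \o al)) + unit_int (speed g (w2 \o be)).
  transitivity (unit_int (fun t => speed g (w1 \o al) t + speed g (w2 \o be) t)).
    exact: unit_int_eq.
  exact: (unit_intD (speed_continuous u1C) (speed_continuous u2C)).
have E4 := etrans E3 (f_equal2 (fun x y : R => x + y) E1 E2).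
exact: (etrans (curve_lengthE w) (etrans E4 (esym (f_equal2 (fun x y : R => x + y) (curve_lengthE w1) (curve_lengthE w2))))).
Unshelve. all: by end_near. Qed.

(** The speed is bounded, not just the length: a piece of the curve then has length at most
    proportional to its share of time. *)
Definition joins x y (l : R) := exists w : R -> M, [/\ C1_curve A w, w 0 = x, w 1 = y &
  forall t, 0 <= t <= 1 -> speed g w t <= l].

(** The set whose infimum is [rdist]. It is named because its nonemptiness has to be carried along:
    the infimum of the empty set is 0. *)
Definition curve_lengths x y := [set curve_length g w | w in
  [set w : R -> M | [/\ C1_curve A w, w 0 = x & w 1 = y]]].

Lemma curve_length_ge0 w : 0 <= curve_length g w.
Proof. by apply: Rintegral_ge0 => t _; exact: speed_ge0. Qed.

Lemma curve_lengths_lb x y : lbound (curve_lengths x y) 0.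
Proof. by move=> _ [w _ <-]; exact: curve_length_ge0. Qed.

Lemma rdist_ge0 x y : 0 <= rdist g x y.
Proof.
rewrite /rdist -/(curve_lengths x y).
have [->|/set0P E] := eqVneq (curve_lengths x y) set0; first by rewrite inf0.
by apply: lb_le_inf => //; exact: curve_lengths_lb.
Qed.

Lemma rdist_le w : C1_curve A w -> rdist g (w 0) (w 1) <= curve_length g w.
Proof.
move=> wC; apply: ge_inf; first by exists 0; exact: curve_lengths_lb.
by exists w.
Qed.

Lemma curve_length_le w l : C1_curve A w ->
  (forall t, 0 <= t <= 1 -> speed g w t <= l) -> curve_length g w <= l.
Proof.
move=> wC wl; rewrite curve_lengthE -(unit_int_cst l); apply: unit_int_le => //.
  exact: speed_continuous.
by move=> t _; exact: cvg_cst.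
Qed.

Lemma joins_rdist x y l : joins x y l -> rdist g x y <= l.
Proof.
move=> [w [wC <- <- wl]]; apply: (le_trans (rdist_le wC)).
exact: curve_length_le.
Qed.

Lemma joins_curve w (e : R) : C1_curve A w -> 0 < e ->
  joins (w 0) (w 1) (curve_length g w + e).
Proof.
move=> wC e0.
rewrite curve_lengthE.
have [th [th0 th1 thP]] := arclength_reparam e0 (speed_continuous wC) (fun t _ => speed_ge0 g w t).
have [|uC uS] := @C1_curve_comp _ _ _ _ g w th wC.
  by move=> t /thP[].
exists (w \o th); split => //; rewrite /= ?th0 ?th1//.
by move=> t t01; rewrite uS//; have [_ _ d0 ?] := thP t t01; rewrite ger0_norm.
Qed.

Lemma rdist_joins x y e : curve_lengths x y !=set0 -> 0 < e ->
  joins x y (rdist g x y + e).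
Proof.
move=> ne e0; have e20 : 0 < e / 2 by rewrite divr_gt0.
have [_ [w [wC <- <-] <-] wl] := @inf_adherent _ (curve_lengths x y) (e / 2) e20
   (conj ne (ex_intro _ _ (@curve_lengths_lb x y))).
have [u [uC u0 u1 ul]] := joins_curve wC e20.
exists u; split => // t t01; apply: (le_trans (ul t t01)).
move: wl; rewrite -/(rdist g (w 0) (w 1)) => wl; lra.
Qed.

End Distance.

(** * Connectedness by curves and the axioms of a distance *)

Section MetricAxioms.
Context {R : realType} {n : nat} {M : topologicalType}.
Context {A : smooth_atlas R n M} (g : riemannian_metric A).
Implicit Types (i j : chart_index A) (w : R -> M) (c : R -> 'rV[R]_n) (x y z : M).

Lemma joins_sub w (l a b : R) : C1_curve A w ->
  (forall t, 0 <= t <= 1 -> speed g w t <= l) ->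
  (forall t, 0 <= t <= 1 -> 0 <= a * t + b <= 1) ->
  joins g (w b) (w (a + b)) (`|a| * l).
Proof.
move=> wC wl ab.
have [|uC uS] := @C1_curve_comp _ _ _ _ g w (fun t => a * t + b) wC.
  by move=> t t01; split; [exact: ab|exact: C1_at_affine].
exists (w \o (fun t => a * t + b)); split => //=.
- by rewrite mulr0 add0r.
- by rewrite mulr1.
- by move=> t t01; rewrite uS// derive1_affine ler_wpM2l// wl// ab.
Qed.

Lemma joins_sym x y l : joins g x y l -> joins g y x l.
Proof.
move=> [w [wC <- <- wl]].
have := @joins_sub w l (-1) 1 wC wl; rewrite normrN1 mul1r addNr; apply.
by move=> t /andP[? ?]; apply/andP; split; lra.
Qed.

Lemma joins_refl x : joins g x x 0.
Proof.
have cst_deriv i (t : R) : is_derive t (1 : R) (chart i \o (cst x : R -> M)) 0.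
  exact: (is_derive_cst (chart i x) t (1 : R)).
exists (cst x); split => //.
  move=> t _; split; first exact: cvg_cst.
  move=> i _; apply: (@C1_at_derive _ _ _ (cst 0)); last exact: cvg_cst.
  by near=> s; exact: cst_deriv.
move=> t _; rewrite /speed /=; set i := chart_at A x.
have -> : derive1 (chart i \o (fun=> x)) t = 0.
  by rewrite derive1E; have [] := cst_deriv i t.
by rewrite bilin0l sqrtr0.
Unshelve. all: by end_near. Qed.

Lemma joins_reach x y l : joins g x y l -> curve_lengths g x y !=set0.
Proof. by move=> [w [wC w0 w1 _]]; exists (curve_length g w); exists w. Qed.

Lemma reach_trans x y z : curve_lengths g x y !=set0 -> curve_lengths g y z !=set0 ->
  curve_lengths g x z !=set0.
Proof.
move=> [_ [w1 [C1 <- <-] _]] [_ [w2 [C2 E <-] _]].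
have [w [wC w0 w1' _]] := C1_curve_concat g C1 C2 (esym E).
by exists (curve_length g w); exists w.
Qed.

Lemma reach_sym x y : curve_lengths g x y !=set0 -> curve_lengths g y x !=set0.
Proof.
by move=> /(rdist_joins)/(_ ltr01)/joins_sym/joins_reach.
Qed.

Lemma rdistxx x : rdist g x x = 0.
Proof.
apply/eqP; rewrite eq_le rdist_ge0 andbT.
exact/joins_rdist/joins_refl.
Qed.

(** The squared length is at most the energy. The energy is preferred as an upper bound because it
    expands under displacements of the curve without a square root. *)
Lemma rdist_energy i c :
  (forall t, 0 <= t <= 1 -> (chart i @` chart_dom i) (c t) /\ C1_at c t) ->
  rdist g (chart_inv i (c 0)) (chart_inv i (c 1)) ^+ 2 <=
  unit_int (fun t => bilin (metric g i (c t)) (derive1 c t) (derive1 c t)).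
Proof.
move=> cP; have [wC wS] := C1_curve_chart g cP.
set w := chart_inv i \o c; set L := curve_length g w.
have dL : rdist g (chart_inv i (c 0)) (chart_inv i (c 1)) <= L by exact: (rdist_le g wC).
have sc := speed_continuous (g := g) wC.
have s2c : unit_continuous (fun t => speed g w t * speed g w t).
  by move=> t t01; apply: cvgM; exact: sc.
have Ls2 : L ^+ 2 <= unit_int (fun t => speed g w t * speed g w t).
  (* The Cauchy-Schwarz inequality, obtained by integrating [(speed - L)^2 >= 0]. *)
  have H : 0 <= unit_int (fun t => speed g w t * speed g w t + ((-2 * L) * speed g w t + L * L)).
    rewrite -[leLHS](unit_int_cst 0); apply: unit_int_le.
    - by move=> t _; exact: cvg_cst.
    - move=> t t01; apply: cvgD; first exact: s2c.
      apply: cvgD; last exact: cvg_cst.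
      by apply: cvgM; [exact: cvg_cst|exact: sc].
    - by move=> t _; have := sqr_ge0 (speed g w t - L); rewrite expr2; nra.
  move: H; rewrite unit_intD//; last first.
    move=> t t01; apply: cvgD; last exact: cvg_cst.
    by apply: cvgM; [exact: cvg_cst|exact: sc].
  rewrite unit_intD//; last 2 first.
  - by move=> t t01; apply: cvgM; [exact: cvg_cst|exact: sc].
  - by move=> t _; exact: cvg_cst.
  rewrite (unit_int_cst (L * L)) (unit_intZ (-2 * L) sc) -(curve_lengthE g w) -/L expr2.
  by move: (unit_int _) => I; nra.
apply: (@le_trans _ _ (L ^+ 2)).
  by rewrite lerXn2r// nnegrE ?rdist_ge0// (le_trans (rdist_ge0 _ _ _) dL).
apply: (le_trans Ls2); rewrite le_eqVlt; apply/orP; left; apply/eqP.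
apply: unit_int_eq => t t01; rewrite wS// -expr2 sqr_sqrtr//.
have [it _] := cP t t01; have [di ci] := chart_imgP it.
have [->|v0] := eqVneq (derive1 c t) 0; first by rewrite bilin0l.
by have := @metric_pos _ _ _ _ g i _ di _ v0; rewrite ci => /ltW.
Qed.

Lemma is_derive_segment (a v : 'rV[R]_n) (s : R) :
  is_derive s (1 : R) (fun s : R => a + s *: v) v.
Proof.
have H : derivable (id : 'rV[R]_n -> 'rV[R]_n) (a + s *: v) v by exact: derivable_id.
have := is_derive_line H.
by rewrite derive_id.
Qed.

Lemma C1_at_segment (a v : 'rV[R]_n) (t : R) : C1_at (fun s : R => a + s *: v) t.
Proof.
apply: (@C1_at_derive _ _ _ (cst v)); last exact: cvg_cst.
by near=> s; exact: is_derive_segment.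
Unshelve. all: by end_near. Qed.

Lemma derive1_segment (a v : 'rV[R]_n) (t : R) :
  derive1 (fun s : R => a + s *: v) t = v.
Proof. by rewrite derive1E; have [] := is_derive_segment a v t. Qed.

Lemma segment_ball (x0 a b : 'rV[R]_n) (r t : R) : 0 <= t <= 1 ->
  `|a - x0| < r -> `|b - x0| < r -> `|a + t *: (b - a) - x0| < r.
Proof.
move=> /andP[t0 t1] ar br.
have -> : a + t *: (b - a) - x0 = (1 - t) *: (a - x0) + t *: (b - x0).
  by apply/rowP => k; rewrite !mxE; ring.
apply: (le_lt_trans (ler_normD _ _)); rewrite !normrZ (ger0_norm t0) ger0_norm ?subr_ge0//.
have [->|tn0] := eqVneq t 0; first by rewrite subr0 mul1r mul0r addr0.
have t0' : 0 < t by rewrite lt0r tn0.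
nra.
Qed.

Lemma reach_near y : \forall z \near y, curve_lengths g y z !=set0.
Proof.
set i := chart_at A y; have iy : chart_dom i y by exact: chart_at_dom.
have /nbhs_ballP[r r0 Hr] : nbhs (chart i y) (chart i @` chart_dom i).
  by apply: open_nbhs_nbhs; split; [exact: chart_image_open|exists y].
have nd : \forall z \near y, chart_dom i z.
  by apply: open_nbhs_nbhs; split => //; exact: chart_dom_open.
have nb : \forall z \near y, ball (chart i y) r (chart i z).
  by apply: (chart_continuous_at iy); exact: nbhsx_ballx.
near=> z.
have zd : chart_dom i z by near: z.
have zb : ball (chart i y) r (chart i z) by near: z.
have [|wC _] := @C1_curve_chart _ _ _ _ g i (fun t => chart i y + t *: (chart i z - chart i y)).
  move=> t t01; split; last exact: C1_at_segment.
  apply: Hr; rewrite -ball_normE/= distrC; apply: segment_ball => //.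
    by rewrite subrr normr0.
  by move: zb; rewrite -ball_normE/= distrC.
eexists; eexists; last reflexivity; split; first exact: wC.
  by rewrite /= scale0r addr0 chartK.
by rewrite /= scale1r addrCA subrr addr0 chartK.
Unshelve. all: by end_near. Qed.

(** The set of points that curves reach from [x] is open, and so is its complement, since nearby
    points are joined by segments in a chart. *)
Lemma reach_all : connected [set: M] -> forall x y, curve_lengths g x y !=set0.
Proof.
move=> hconn x y; pose U := [set z | curve_lengths g x z !=set0].
have oU : open U.
  rewrite openE => z xz; rewrite /interior; have := reach_near z.
  by apply: filterS => u; exact: reach_trans.
have oCU : open (~` U).
  rewrite openE => z xz; rewrite /interior; have := reach_near z.
  by apply: filterS => u zu xu; apply: xz; apply: reach_trans xu (reach_sym zu).
suff : U = setT by move=> UT; have : U y by rewrite UT.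
apply: hconn.
- by exists x; exact: (joins_reach (joins_refl x)).
- by exists U => //; rewrite setTI.
- exists U; last by rewrite setTI.
  by rewrite -[U]setCK; exact: open_closedC.
Qed.

Hypothesis reach : forall x y, curve_lengths g x y !=set0.

Lemma rdist_sym x y : rdist g x y = rdist g y x.
Proof.
suff H u v : rdist g u v <= rdist g v u by apply/eqP; rewrite eq_le !H.
apply/ler_addgt0Pr => e e0.
exact/joins_rdist/joins_sym/rdist_joins.
Qed.

Lemma rdist_triangle x y z : rdist g x z <= rdist g x y + rdist g y z.
Proof.
apply/ler_addgt0Pr => e e0; have e2 : 0 < e / 2 by rewrite divr_gt0.
have [w1 [C1 <- <- l1]] := rdist_joins (reach x y) e2.
have [w2 [C2 E <- l2]] := rdist_joins (reach (w1 1) z) e2.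
have [w [wC w0 w1' wl]] := C1_curve_concat g C1 C2 (esym E).
have := rdist_le g wC; rewrite w0 w1' wl => H.
have := curve_length_le C1 l1; have := curve_length_le C2 l2.
move: H; clear wl; move: (curve_length g w1) (curve_length g w2) (rdist g _ _) (rdist g _ _) (rdist g _ _).
by move=> a b d1 d2 d3; lra.
Qed.

End MetricAxioms.

(** * Expansion of the squared distance in a chart *)

Section MetricBox.
Context {R : realType} {n : nat}.
Implicit Types (G : 'rV[R]_n -> 'M[R]_n) (D : 'rV[R]_n -> 'rV[R]_n -> 'M[R]_n).
Implicit Types (a b u v h x : 'rV[R]_n).

(* [D a h] is the derivative of [G] at [a] in the direction [h]. *)
Record metric_box G D (x0 : 'rV[R]_n) (r lam K : R) : Prop := MetricBox {
  mb_r : 0 < r;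
  mb_lam : 0 < lam;
  mb_K : 0 < K;
  mb_low : forall a v, `|a - x0| < r -> lam * `|v| ^+ 2 <= bilin (G a) v v;
  mb_sym : forall a u v, `|a - x0| < r -> bilin (G a) u v = bilin (G a) v u;
  mb_up : forall a u v, `|a - x0| < r -> `|bilin (G a) u v| <= K * `|u| * `|v|;
  mb_lip : forall a b u v, `|a - x0| < r -> `|b - x0| < r ->
    `|bilin (G a - G b) u v| <= K * `|a - b| * `|u| * `|v|;
  mb_dlin : forall a (c : R) h k, `|a - x0| < r -> D a (c *: h + k) = c *: D a h + D a k;
  mb_dup : forall a h u v, `|a - x0| < r ->
    `|bilin (D a h) u v| <= K * `|h| * `|u| * `|v|;
  mb_dlip : forall a b h u v, `|a - x0| < r -> `|b - x0| < r ->
    `|bilin (D a h - D b h) u v| <= K * `|a - b| * `|h| * `|u| * `|v|;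
  mb_taylor : forall a b u v, `|a - x0| < r -> `|b - x0| < r ->
    `|bilin (G a - G b - D b (a - b)) u v| <= K * `|a - b| ^+ 2 * `|u| * `|v|
}.

(** The minimum over the compact unit sphere, extended by homogeneity. *)
Lemma posdef_coercive (G : 'M[R]_n) : (forall v, v != 0 -> 0 < bilin G v v) ->
  exists2 lam, 0 < lam & forall v, lam * `|v| ^+ 2 <= bilin G v v.
Proof.
move=> Gpos; pose S := [set v : 'rV[R]_n | `|v| = 1].
have hom lam : (forall v, S v -> lam <= bilin G v v) ->
    forall v, lam * `|v| ^+ 2 <= bilin G v v.
  move=> H v; have [->|v0] := eqVneq v 0.
    by rewrite normr0 expr0n mulr0 bilin0l.
  have nv0 : 0 < `|v| by rewrite normr_gt0.
  have := H (`|v|^-1 *: v); rewrite bilinZl bilinZr => /(_ _)/wrap[].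
    by rewrite /S/= normrZ ger0_norm ?invr_ge0// mulVf// gt_eqF.
  move=> H'; rewrite -ler_pdivlMr ?exprn_gt0// expr2 invfM; apply: (le_trans H').
  by rewrite mulrA mulrC.
(* In dimension 0 the sphere is empty and any constant works. *)
have [S0|/set0P Sne] := eqVneq S set0.
  exists 1 => //; apply: hom => v; by rewrite S0.
have Sc : compact S.
  apply: bounded_closed_compact.
    by exists 1; split; [rewrite num_real|move=> e e1 v; rewrite /S/= => ->; exact: ltW].
  have -> : S = (fun v : 'rV[R]_n => `|v|) @^-1` [set 1] by [].
  apply: preimage_closed; last exact: closed_eq.
  by move=> v _; exact: norm_continuous.
have [|v Sv vmin] := @EVT_min_rV R n (fun v => bilin G v v) S Sne Sc.
  apply: continuous_subspaceT => v.
  by apply: (@bilin_continuous _ _ _ (cst G) id id); [exact: cst_continuous|exact: cvg_id|exact: cvg_id].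
exists (bilin G v v).
  apply: Gpos; apply/eqP => v0; move: Sv; rewrite inE /S/= v0 normr0 => /esym/eqP.
  by rewrite oner_eq0.
by apply: hom => u Su; apply: vmin; rewrite inE.
Qed.

Lemma mx_entry_le (p q : nat) (B : 'M[R]_(p, q)) k l : `|B k l| <= `|B|.
Proof.
by rewrite [leRHS]/Num.Def.normr/= mx_normrE; apply: (le_bigmax _ _ (k, l)).
Qed.

Lemma ler_term (F : 'I_n -> R) j : (forall i, 0 <= F i) -> F j <= \sum_i F i.
Proof. by move=> F0; rewrite (bigD1 j)//= lerDl; apply: sumr_ge0. Qed.

Lemma near_norm_lt (V : normedModType R) (F : 'rV[R]_n -> V) (x0 : 'rV[R]_n) (C : R) :
  {for x0, continuous F} -> `|F x0| < C -> \forall a \near x0, `|F a| < C.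
Proof.
move=> /cvgrPdist_lt/(_ (C - `|F x0|)) + FC; rewrite subr_gt0 => /(_ FC).
apply: filterS => a H; have := ler_normD (F x0) (F a - F x0).
by rewrite addrCA subrr addr0 [X in _ <= _ + X -> _]distrC; lra.
Qed.

Lemma metric_box_exists G (U : set 'rV[R]_n) (x0 : 'rV[R]_n) : open U -> smooth_on U G -> U x0 ->
  (forall a, U a -> (G a)^T = G a) ->
  (forall v, v != 0 -> 0 < bilin (G x0) v v) ->
  exists r lam K, metric_box G (fun a h => 'D_h G a) x0 r lam K /\
    forall a, `|a - x0| < r -> U a.
Proof.
move=> oU GS Ux Gsym Gpos.
have [lam lam0 lamP] := posdef_coercive Gpos.
pose e (j : 'I_n) : 'rV[R]_n := delta_mx 0 j.
have G1 : Ck_on 1 U G by exact: GS.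
have DG1 j : Ck_on 1 U ('D_(e j) G) by have [_ /(_ (e j))[_ H]] := GS 2; exact: H.
have Gc : {for x0, continuous G} by have [+ _] := GS 0; apply; exact: mem_set.
have DGc j : {for x0, continuous ('D_(e j) G)} by have [+ _] := DG1 j; apply; exact: mem_set.
have DDGc j l : {for x0, continuous ('D_(e l) ('D_(e j) G))}.
  by have [_ /(_ (e l))[_ [+ _]]] := DG1 j; apply; exact: mem_set.
pose S1 := \sum_j `|'D_(e j) G x0|; pose S2 := \sum_j \sum_l `|'D_(e l) ('D_(e j) G) x0|.
have S10 : 0 <= S1 by apply: sumr_ge0.
have S20 : 0 <= S2 by apply: sumr_ge0 => j _; apply: sumr_ge0.
(* Strictly above the norms of [G] and of its partial derivatives up to order two at [x0], hence
   above them on a neighbourhood. *)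
pose K' := 1 + `|G x0| + S1 + S2.
have K'0 : 0 < K' by rewrite /K'; have := normr_ge0 (G x0); lra.
have le1 j : `|'D_(e j) G x0| <= S1.
  exact: (@ler_term (fun j => `|'D_(e j) G x0|) j (fun j => normr_ge0 _)).
have le2 j l : `|'D_(e l) ('D_(e j) G) x0| <= S2.
  apply: (le_trans (@ler_term (fun l => `|'D_(e l) ('D_(e j) G) x0|) l (fun l => normr_ge0 _))).
  apply: (@ler_term (fun j => \sum_l `|'D_(e l) ('D_(e j) G) x0|) j) => i.
  by apply: sumr_ge0.
have : \forall a \near x0, [/\ U a, `|G a| < K', forall j, `|'D_(e j) G a| < K' &
    forall j l, `|'D_(e l) ('D_(e j) G) a| < K'].
  have n1 : \forall a \near x0, U a by exact: open_nbhs_nbhs.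
  have n2 : \forall a \near x0, `|G a| < K' by apply: near_norm_lt => //; rewrite /K'; lra.
  have n3 : \forall a \near x0, forall j, `|'D_(e j) G a| < K'.
    apply: (@filter_forall _ _ _ (nbhs x0)) => j; apply: near_norm_lt => //.
    by rewrite /K'; have := normr_ge0 (G x0); have := le1 j; lra.
  have n4 : \forall a \near x0, forall j l, `|'D_(e l) ('D_(e j) G) a| < K'.
    apply: (@filter_forall _ _ _ (nbhs x0)) => j.
    apply: (@filter_forall _ _ _ (nbhs x0)) => l; apply: near_norm_lt => //.
    by rewrite /K'; have := normr_ge0 (G x0); have := le2 j l; lra.
  by near=> a; split; near: a.
move=> /nbhs_ballP[r0 r00 Hr0].
have {Hr0}Hr a : `|a - x0| < r0 -> [/\ U a, `|G a| < K', forall j, `|'D_(e j) G a| < K' &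
    forall j l, `|'D_(e l) ('D_(e j) G) a| < K'].
  by move=> ar; apply: Hr0; rewrite -ball_normE/= distrC.
have K'le := ltW K'0.
have lipG k l a b : `|a - x0| < r0 -> `|b - x0| < r0 -> `|(G a - G b) k l| <= n%:R * K' * `|a - b|.
  move=> ar br; rewrite !mxE; apply: (@lipschitz_box _ _ (fun a => G a k l) x0 r0 K') => //.
    move=> z j /Hr[Uz _ _ _]; have [zd _] := Ck1_entry k l oU G1 Uz.
    exact: diff_derivable.
  move=> z j /Hr[Uz _ zK _]; have [_ <-] := Ck1_entry k l oU G1 Uz.
  by apply: (le_trans (mx_entry_le _ _ _)); exact/ltW/zK.
have lipDG j k l a b : `|a - x0| < r0 -> `|b - x0| < r0 ->
    `|('D_(e j) G a - 'D_(e j) G b) k l| <= n%:R * K' * `|a - b|.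
  move=> ar br; rewrite !mxE; apply: (@lipschitz_box _ _ (fun a => 'D_(e j) G a k l) x0 r0 K') => //.
    move=> z j' /Hr[Uz _ _ _]; have [zd _] := Ck1_entry k l oU (DG1 j) Uz.
    exact: diff_derivable.
  move=> z j' /Hr[Uz _ _ zK]; have [_ <-] := Ck1_entry k l oU (DG1 j) Uz.
  by apply: (le_trans (mx_entry_le _ _ _)); exact/ltW/zK.
have DE a h : `|a - x0| < r0 -> 'D_h G a = \sum_j h 0 j *: 'D_(e j) G a.
  by move=> /Hr[Ua _ _ _]; exact: Ck1_derive_sum oU G1 Ua.
have DK k l a h : `|a - x0| < r0 -> `|('D_h G a) k l| <= n%:R * K' * `|h|.
  move=> ar; rewrite DE// summxE; apply: (le_trans (ler_norm_sum _ _ _)).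
  apply: (@le_trans _ _ (\sum_(j < n) K' * `|h|)).
    apply: ler_sum => j _; rewrite mxE normrM mulrC ler_pM// ?rV_coord_le//.
    by apply: (le_trans (mx_entry_le _ _ _)); have [_ _ /(_ j)/ltW] := Hr a ar.
  by rewrite sumr_const card_ord -[leLHS]mulr_natl mulrA.
have DL k l a b h : `|a - x0| < r0 -> `|b - x0| < r0 ->
    `|('D_h G a - 'D_h G b) k l| <= n%:R * (n%:R * K' * `|a - b|) * `|h|.
  move=> ar br; rewrite !DE// -sumrB summxE; apply: (le_trans (ler_norm_sum _ _ _)).
  apply: (@le_trans _ _ (\sum_(j < n) (n%:R * K' * `|a - b|) * `|h|)).
    apply: ler_sum => j _; rewrite -scalerBr mxE normrM mulrC ler_pM// ?rV_coord_le//.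
    exact: lipDG.
  by rewrite sumr_const card_ord -[leLHS]mulr_natl mulrA.
have tayG k l a b : `|a - x0| < r0 -> `|b - x0| < r0 ->
    `|(G a - G b - 'D_(a - b) G b) k l| <= n%:R * (n%:R * K' * `|a - b|) * `|a - b|.
  move=> ar br; rewrite DE// !mxE summxE.
  have -> : \sum_j ((a - b) 0 j *: 'D_(e j) G b) k l =
     \sum_j (a - b) 0 j * 'D_(e j) (fun a => G a k l) b.
    apply: eq_bigr => j _; rewrite mxE; have [Ub _ _ _] := Hr b br.
    by have [_ ->] := Ck1_entry k l oU G1 Ub.
  apply: (@taylor_box _ _ (fun a => G a k l) x0 r0 (n%:R * K' * `|a - b|)) => //.
  - by rewrite !mulr_ge0.
  - move=> z j /Hr[Uz _ _ _]; have [zd _] := Ck1_entry k l oU G1 Uz.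
    exact: diff_derivable.
  - move=> z j zr zb; have [Uz _ _ _] := Hr z zr; have [Ub _ _ _] := Hr b br.
    have [_ <-] := Ck1_entry k l oU G1 Uz; have [_ <-] := Ck1_entry k l oU G1 Ub.
    have := lipDG j k l z b zr br; rewrite !mxE => H; apply: (le_trans H).
    by rewrite ler_wpM2l// mulr_ge0.
pose N := (n%:R : R); have N0 : 0 <= N by rewrite /N.
pose K := 1 + N ^+ 2 * (K' + N * K' + N * (N * K')).
have NK : 0 <= N * K' by rewrite mulr_ge0.
have NNK : 0 <= N * (N * K') by rewrite mulr_ge0.
have N20 : 0 <= N ^+ 2 by rewrite exprn_ge0.
have KP (C : R) : 0 <= C -> C <= K' + N * K' + N * (N * K') -> N ^+ 2 * C <= K.
  by move=> C0 CK; rewrite /K; nra.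
have K0 : 0 < K by rewrite /K; nra.
have bb (B : 'M[R]_n) (C q : R) u v : 0 <= C -> C <= K' + N * K' + N * (N * K') -> 0 <= q ->
   (forall k l, `|B k l| <= C * q) -> `|bilin B u v| <= K * q * `|u| * `|v|.
  move=> C0 CK q0 BC; apply: (le_trans (@bilin_bound _ _ _ (C * q) u v _ BC)); first by rewrite mulr_ge0.
  by rewrite !ler_wpM2r// mulrA ler_wpM2r// KP.
have r1 : 0 < Order.min r0 (lam / (2 * K)).
  by rewrite lt_min r00 divr_gt0// mulr_gt0.
(* Within [lam / (2 * K)] of [x0] the Lipschitz bound changes the quadratic form by at most
   [lam / 2], so half of the coercivity survives. *)
pose r := Order.min r0 (lam / (2 * K)).
have rr0 a : `|a - x0| < r -> `|a - x0| < r0 by rewrite lt_min => /andP[].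
exists r, (lam / 2), K; split; last by move=> a /rr0/Hr[].
have lipB a b u v : `|a - x0| < r0 -> `|b - x0| < r0 ->
    `|bilin (G a - G b) u v| <= K * `|a - b| * `|u| * `|v|.
  move=> ar br; apply: (@bb _ (N * K')) => //; first lra.
  by move=> k l; exact: lipG.
split => //.
- by rewrite divr_gt0.
- move=> a v ar; have := lamP v.
  have x0r : `|x0 - x0| < r0 by rewrite subrr normr0.
  have := lipB a x0 v v (rr0 a ar) x0r.
  rewrite bilinDm bilinNm ler_norml => /andP[H _] L.
  have : K * `|a - x0| <= lam / 2.
    move: ar; rewrite lt_min => /andP[_ ar].
    have -> : lam / 2 = K * (lam / (2 * K)) by field; rewrite gt_eqF.
    by rewrite ler_wpM2l// ltW.
  have v20 : 0 <= `|v| ^+ 2 by rewrite exprn_ge0.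
  move: H; rewrite -mulrA -expr2 => H; nra.
- by move=> a u v /rr0/Hr[Ua _ _ _]; apply: bilin_sym; exact: Gsym.
- move=> a u v /rr0/Hr[_ GK _ _].
  rewrite -[K]mulr1; apply: (@bb _ K') => //; first lra.
  by move=> k l; rewrite mulr1; apply: (le_trans (mx_entry_le _ _ _)); exact: ltW.
- by move=> a b u v /rr0 ar /rr0 br; exact: lipB.
- move=> a c h k /rr0 ar; rewrite !DE// scaler_sumr -big_split/=; apply: eq_bigr => j _.
  by rewrite !mxE scalerDl scalerA.
- move=> a h u v /rr0 ar; apply: (@bb _ (N * K')) => //; first lra.
  by move=> k l; exact: DK.
- move=> a b h u v /rr0 ar /rr0 br; rewrite -[K * _ * _]mulrA.
  apply: (@bb _ (N * (N * K'))) => //; first lra.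
  by move=> k l; apply: (le_trans (DL _ _ _ _ _ ar br)); rewrite !mulrA.
- move=> a b u v /rr0 ar /rr0 br; apply: (@bb _ (N * (N * K'))) => //; first lra.
  by move=> k l; apply: (le_trans (tayG _ _ _ _ ar br)); rewrite !mulrA -mulrA -expr2 !mulrA.
Unshelve. all: by end_near. Qed.

End MetricBox.

Section RowCurves.
Context {R : realType} {n : nat}.
Implicit Types (c : R -> 'rV[R]_n) (u v h : 'rV[R]_n).

Lemma is_derive_coord c (t : R) dc k : is_derive t (1 : R) c dc ->
  is_derive t (1 : R) (fun s => c s 0 k) (dc 0 k).
Proof.
move=> [cd <-]; have := cd; rewrite derivable_mxP => /(_ 0 k) H.
by split; [exact: H|rewrite derive_mx ?mxE].
Qed.

Lemma curve_lipschitz c (s tau : R) : 0 <= tau -> (forall t, 0 <= t <= tau -> C1_at c t /\ `|derive1 c t| <= s) ->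
  `|c tau - c 0| <= s * tau.
Proof.
move=> t0 cP.
have s0 : 0 <= s by have [_] := cP 0 ltac:(by rewrite lexx); exact: le_trans.
apply: rV_norm_le => [|k]; first by rewrite mulr_ge0.
have cd t : 0 <= t <= tau -> is_derive t (1 : R) (fun u : R => c u 0 k) ((derive1 c t) 0 k).
  by move=> /cP[/C1_at_is_derive/nbhs_singleton + _]; exact: is_derive_coord.
have [z|| z] := @MVT_segment R (fun u : R => c u 0 k) (fun t : R => (derive1 c t) 0 k) 0 tau t0.
- by rewrite in_itv/= => /andP[? ?]; apply: cd; rewrite !ltW.
- apply: derivable_within_continuous => z; rewrite in_itv/= => zt.
  by have [] := cd z zt.
rewrite in_itv/= => zt; rewrite subr0 !mxE => ->.
rewrite normrM (ger0_norm t0) ler_wpM2r//.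
by apply: (le_trans (rV_coord_le _ _)); have [] := cP z zt.
Qed.

Lemma unit_int_dotr (P : R -> 'rV[R]_n) h :
  (forall j, unit_continuous (fun t => P t 0 j)) ->
  unit_continuous (fun t => dotr (P t) h) /\
  unit_int (fun t => dotr (P t) h) = dotr (\row_j unit_int (fun t => P t 0 j)) h.
Proof.
move=> Pjc.
have sc (s : seq 'I_n) : unit_continuous (fun t => \sum_(j <- s) P t 0 j * h 0 j).
  move=> t t01; apply: cvg_big => [|k _]; first exact: add_continuous.
  by apply: cvgM; [exact: Pjc|exact: cvg_cst].
split; first exact: sc.
rewrite /dotr; under [RHS]eq_bigr do rewrite mxE mulrC.
elim: (index_enum _) => [|j s IH].
  rewrite big_nil -[RHS](unit_int_cst 0); apply: unit_int_eq => t _.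
  by rewrite big_nil.
rewrite big_cons -IH -(unit_intZ (h 0 j) (Pjc j)) -unit_intD; last 2 first.
- by move=> t t01; apply: cvgM; [exact: cvg_cst|exact: Pjc].
- exact: sc.
by apply: unit_int_eq => t _; rewrite big_cons mulrC.
Qed.

Lemma dotrC u v : dotr u v = dotr v u.
Proof. by apply: eq_bigr => j _; rewrite mulrC. Qed.

Lemma dotrDr u v h : dotr h (u + v) = dotr h u + dotr h v.
Proof. exact: linearD. Qed.

Lemma dotrDl u v h : dotr (u + v) h = dotr u h + dotr v h.
Proof. by rewrite !(dotrC _ h) dotrDr. Qed.

Lemma dotrZr (x : R) u h : dotr h (x *: u) = x * dotr h u.
Proof. exact: linearZ. Qed.

Lemma dotrZl (x : R) u h : dotr (x *: u) h = x * dotr u h.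
Proof. by rewrite !(dotrC _ h) dotrZr. Qed.

Lemma dotrNr u h : dotr h (- u) = - dotr h u.
Proof. exact: linearN. Qed.

Lemma dotrNl u h : dotr (- u) h = - dotr u h.
Proof. by rewrite !(dotrC _ h) dotrNr. Qed.

Lemma dotr_delta u j : dotr u (delta_mx 0 j) = u 0 j.
Proof.
rewrite /dotr (bigD1 j)//= !mxE !eqxx mulr1 big1 ?addr0// => k /negbTE kj.
by rewrite !mxE kj mulr0.
Qed.

Lemma bilin_tr (G : 'M[R]_n) u v : bilin G^T u v = bilin G v u.
Proof.
rewrite !bilinE exchange_big/=; apply: eq_bigr => k _; apply: eq_bigr => l _.
by rewrite mxE; ring.
Qed.

Lemma unit_int_norm (f : R -> R) (C : R) : unit_continuous f ->
  (forall t, 0 <= t <= 1 -> `|f t| <= C) -> `|unit_int f| <= C.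
Proof.
move=> fc fC; have cC (x : R) : unit_continuous (fun=> x : R) by move=> t _; exact: cvg_cst.
rewrite ler_norml; apply/andP; split.
  rewrite -(unit_int_cst (- C)); apply: unit_int_le => // t /fC.
  by rewrite ler_norml => /andP[].
rewrite -[leRHS](unit_int_cst C); apply: unit_int_le => // t /fC.
by rewrite ler_norml => /andP[].
Qed.

Lemma bilin_row (G : 'M[R]_n) u h : bilin G u h = dotr (\row_j bilin G u (delta_mx 0 j)) h.
Proof.
rewrite {1}(row_sum_delta h) /dotr /bilin linear_sum mulmx_sumr summxE.
by apply: eq_bigr => j _; rewrite linearZ/= -scalemxAr !mxE mulrC.
Qed.

Lemma unit_int_bilin (G : 'M[R]_n) c v : (forall t, 0 <= t <= 1 -> C1_at c t) ->
  unit_int (fun t => bilin G (derive1 c t) v) = bilin G (c 1 - c 0) v.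
Proof.
move=> cP.
have -> : bilin G (c 1 - c 0) v = bilin G (c 1) v - bilin G (c 0) v.
  by rewrite bilinDl bilinNl.
apply: (@unit_int_derive _ (fun t => bilin G (c t) v)); last first.
  move=> t t01; apply: bilin_continuous; [exact: cst_continuous|by case: (cP t t01)|exact: cst_continuous].
move=> t t01; have cd := nbhs_singleton (C1_at_is_derive (cP t t01)).
pose w : 'rV[R]_n := (G *m v^T)^T.
have E u : bilin G u v = dotr w u.
  rewrite /bilin -mulmxA mxE /dotr; apply: eq_bigr => j _.
  by rewrite [in RHS]mxE mulrC.
rewrite E; have -> : (fun t => bilin G (c t) v) = (dotr w \o c) by apply/funext => s; exact: E.
have wd : differentiable (dotr w) (c t).
  by apply: linear_differentiable; exact: dotr_continuous.
by have := is_derive_comp wd cd; rewrite deriveE// (diff_lin _ (@dotr_continuous _ _ w)).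
Qed.

End RowCurves.

(** * First variation of the energy in a coordinate ball *)

Section LocalEstimate.
Context {R : realType} {n : nat}.
Variables (G : 'rV[R]_n -> 'M[R]_n) (D : 'rV[R]_n -> 'rV[R]_n -> 'M[R]_n).
Variables (x0 : 'rV[R]_n) (r lam K : R).
Hypothesis box : metric_box G D x0 r lam K.
Hypothesis Gcont : forall a, `|a - x0| < r -> {for a, continuous G}.
Hypothesis Dcont : forall (a h : 'rV[R]_n), `|a - x0| < r ->
  {for a, continuous (fun b : 'rV[R]_n => D b h)}.
Implicit Types (a b u v h k : 'rV[R]_n) (c : R -> 'rV[R]_n).

Let K0 : 0 < K := mb_K box.
Let lam0 : 0 < lam := mb_lam box.

(** The remainder consists of the Taylor term of [G], the change of [G] in the cross term, and the
    square of [v]; with the common constant [K] their bounds form a perfect square. *)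
Lemma bilin_expand a u h v : `|a - x0| < r -> `|a + h - x0| < r ->
  `|bilin (G (a + h)) (u + v) (u + v) - bilin (G a) u u - 2 * bilin (G a) u v - bilin (D a h) u u| <=
  K * (`|h| * `|u| + `|v|) ^+ 2.
Proof.
move=> ar ahr.
have -> : bilin (G (a + h)) (u + v) (u + v) - bilin (G a) u u - 2 * bilin (G a) u v - bilin (D a h) u u =
  bilin (G (a + h) - G a - D a (a + h - a)) u u + 2 * bilin (G (a + h) - G a) u v + bilin (G (a + h)) v v.
  rewrite !bilinDm !bilinNm !bilinDl !bilinDr [a + h - a]addrAC subrr add0r.
  by rewrite (mb_sym box v u ahr); ring.
apply: (le_trans (ler_normD _ _)).
have -> : K * (`|h| * `|u| + `|v|) ^+ 2 =
  (K * `|h| ^+ 2 * `|u| * `|u| + 2 * (K * `|h| * `|u| * `|v|)) + K * `|v| * `|v| by ring.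
apply: lerD; last exact: (mb_up box).
apply: (le_trans (ler_normD _ _)); apply: lerD.
  by have := mb_taylor box u u ahr ar; rewrite [a + h - a]addrAC subrr add0r.
rewrite normrM ger0_norm// ler_wpM2l//.
by have := mb_lip box u v ahr ar; rewrite [a + h - a]addrAC subrr add0r.
Qed.

Lemma box_deriv0 a : `|a - x0| < r -> D a 0 = 0.
Proof.
move=> ar; have := mb_dlin box (-1) 0 0 ar.
by rewrite scaler0 addr0 scaleN1r addNr.
Qed.

Lemma box_deriv_row a h u v : `|a - x0| < r ->
  bilin (D a h) u v = dotr (\row_j bilin (D a (delta_mx 0 j)) u v) h.
Proof.
move=> ar; rewrite {1}(row_sum_delta h) /dotr.
elim: (index_enum _) => [|j s IH].
  by rewrite !big_nil box_deriv0// /bilin mulmx0 mul0mx mxE.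
by rewrite !big_cons (mb_dlin box)// bilinDm bilinZm IH mxE mulrC.
Qed.

(* [dlt] bounds the Riemannian speed of [c], which need not be minimal; [sg] its coordinate speed. *)
Lemma first_variation a b c (dlt sg : R) : 0 <= sg ->
  c 0 = a -> c 1 = b -> `|a - x0| < r ->
  (forall t, 0 <= t <= 1 -> [/\ `|c t - x0| < r, C1_at c t, `|derive1 c t| <= sg &
     bilin (G (c t)) (derive1 c t) (derive1 c t) <= dlt ^+ 2]) ->
  exists p q : 'rV[R]_n, [/\
    forall h k, (forall t, 0 <= t <= 1 -> `|c t + (h + t *: (k - h)) - x0| < r) ->
      unit_int (fun t => bilin (G (c t + (h + t *: (k - h)))) (derive1 c t + (k - h)) (derive1 c t + (k - h)))
      <= dlt ^+ 2 + 2 * (dotr p h + dotr q k) + K * (sg + 1) ^+ 2 * (`|h| + `|k|) ^+ 2,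
    forall h, `|dotr p h + bilin (G a) (b - a) h| <= 2 * K * sg ^+ 2 * `|h|,
    forall h, `|dotr q h| <= 2 * K * (sg + 1) ^+ 2 * `|h| &
    forall h, `|dotr (p + q) h - 2^-1 * bilin (D a h) (b - a) (b - a)| <=
      2^-1 * (K * sg ^+ 3 * `|h| + K / lam * `|h| *
      (dlt ^+ 2 + K * sg ^+ 3 - bilin (G a) (b - a) (b - a)))].
Proof.
move=> sg0 c0 c1 ar cP.
pose e (j : 'I_n) : 'rV[R]_n := delta_mx 0 j.
have cr t : 0 <= t <= 1 -> `|c t - x0| < r by move=> /cP[].
have cC t : 0 <= t <= 1 -> C1_at c t by move=> /cP[].
have cs t : 0 <= t <= 1 -> `|derive1 c t| <= sg by move=> /cP[].
have cc t : 0 <= t <= 1 -> {for t, continuous c} by move=> /cC/C1_at_continuous.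
have dcc t : 0 <= t <= 1 -> {for t, continuous (derive1 c)} by move=> /cC[].
have Gc t : 0 <= t <= 1 -> {for t, continuous (fun t => G (c t))}.
  by move=> t01; exact: (continuous_comp (cc t t01) (Gcont (cr t t01))).
have Dc h t : 0 <= t <= 1 -> {for t, continuous (fun t => D (c t) h)}.
  by move=> t01; apply: (@continuous_comp R _ _ c (fun b => D b h)); [exact: cc|exact: Dcont (cr t t01)].
have ca t : 0 <= t <= 1 -> `|c t - a| <= sg.
  move=> /andP[t0 t1]; rewrite -c0; apply: (@le_trans _ _ (sg * t)).
    apply: curve_lipschitz => // u /andP[u0 ut]; have u01 : 0 <= u <= 1 by rewrite u0 (le_trans ut).
    by split; [exact: cC|exact: cs].
  by rewrite ler_piMr.
pose P1 t := \row_j bilin (G (c t)) (derive1 c t) (e j).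
pose P2 t := \row_j bilin (D (c t) (e j)) (derive1 c t) (derive1 c t).
have P1E t h : dotr (P1 t) h = bilin (G (c t)) (derive1 c t) h by rewrite -bilin_row.
have P2E t h : 0 <= t <= 1 -> dotr (P2 t) h = bilin (D (c t) h) (derive1 c t) (derive1 c t).
  by move=> t01; rewrite box_deriv_row//; exact: cr.
have P1c j : unit_continuous (fun t => P1 t 0 j).
  move=> t t01; apply: (@eq_continuous_at R R (fun t => bilin (G (c t)) (derive1 c t) (e j))).
    by move=> s; rewrite mxE.
  by apply: bilin_continuous; [exact: Gc|exact: dcc|exact: cst_continuous].
have P2c j : unit_continuous (fun t => P2 t 0 j).
  move=> t t01; apply: (@eq_continuous_at R R (fun t => bilin (D (c t) (e j)) (derive1 c t) (derive1 c t))).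
    by move=> s; rewrite mxE.
  by apply: bilin_continuous; [exact: Dc|exact: dcc|exact: dcc].
(* The curve is displaced by [eta = h + t (k - h)]. Half the first variation of its energy density
   is [G(c', k - h) + D(eta)(c', c') / 2]; [Pp] and [Pq] are its coefficients of [h] and [k]. *)
pose Pp (t : R) : 'rV[R]_n := - P1 t + ((1 - t) / 2) *: P2 t.
pose Pq (t : R) : 'rV[R]_n := P1 t + (t / 2) *: P2 t.
have Ppc j : unit_continuous (fun t => Pp t 0 j).
  move=> t t01; apply: (@eq_continuous_at R R (fun t => - (P1 t 0 j) + ((1 - t) / 2) * P2 t 0 j)).
    by move=> s; rewrite !mxE.
  apply: cvgD; first by apply: cvgN; exact: P1c.
  apply: cvgM; last exact: P2c.
  apply: cvgM; last exact: cvg_cst.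
  by apply: cvgB; [exact: cvg_cst|exact: cvg_id].
have Pqc j : unit_continuous (fun t => Pq t 0 j).
  move=> t t01; apply: (@eq_continuous_at R R (fun t => P1 t 0 j + (t / 2) * P2 t 0 j)).
    by move=> s; rewrite !mxE.
  apply: cvgD; first exact: P1c.
  apply: cvgM; last exact: P2c.
  by apply: cvgM; [exact: cvg_id|exact: cvg_cst].
pose p := \row_j unit_int (fun t => Pp t 0 j).
pose q := \row_j unit_int (fun t => Pq t 0 j).
have pE h := unit_int_dotr h Ppc; have qE h := unit_int_dotr h Pqc.
have PpE t h : 0 <= t <= 1 -> dotr (Pp t) h = - bilin (G (c t)) (derive1 c t) h +
    ((1 - t) / 2) * bilin (D (c t) h) (derive1 c t) (derive1 c t).
  by move=> t01; rewrite /Pp dotrDl dotrNl dotrZl P1E P2E.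
have PqE t h : 0 <= t <= 1 -> dotr (Pq t) h = bilin (G (c t)) (derive1 c t) h +
    (t / 2) * bilin (D (c t) h) (derive1 c t) (derive1 c t).
  by move=> t01; rewrite /Pq dotrDl dotrZl P1E P2E.
have cst_c (x : R) : unit_continuous (fun=> x : R) by move=> t _; exact: cvg_cst.
have sg20 : 0 <= sg ^+ 2 by rewrite exprn_ge0.
have Dsg t h : 0 <= t <= 1 -> `|bilin (D (c t) h) (derive1 c t) (derive1 c t)| <= K * `|h| * sg ^+ 2.
  move=> t01; apply: (le_trans (mb_dup box _ _ _ (cr t t01))).
  rewrite -mulrA ler_wpM2l ?mulr_ge0 ?(ltW K0)// -expr2 lerXn2r ?nnegrE//; exact: cs.
exists p, q; split.
- move=> h k hk; set rho := `|h| + `|k|.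
  have rho0 : 0 <= rho by rewrite addr_ge0.
  set X := dlt ^+ 2 + _ + _.
  have [pc ph] := pE h; have [qc qk] := qE k.
  have pc2 := unit_continuousZ 2 pc; have qc2 := unit_continuousZ 2 qc.
  have -> : X = unit_int (fun t => (dlt ^+ 2 + K * (sg + 1) ^+ 2 * rho ^+ 2) +
      (2 * dotr (Pp t) h + 2 * dotr (Pq t) k)).
    rewrite (unit_intD (unit_continuous_cst _) (unit_continuousD pc2 qc2)).
    rewrite (unit_intD pc2 qc2) (unit_intZ 2 pc) (unit_intZ 2 qc) unit_int_cst ph qk /X /p /q.
    by move: (dotr _ _) (dotr _ _) => x y; ring.
  apply: unit_int_le.
  + move=> t t01; set eta := fun t : R => h + t *: (k - h).
    have ec : {for t, continuous (fun t => c t + eta t)}.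
      apply: cvgD; first exact: cc.
      by apply: cvgD; [exact: cvg_cst|apply: cvgZ; [exact: cvg_id|exact: cvg_cst]].
    have d2 : {for t, continuous (fun t => derive1 c t + (k - h))}.
      by apply: cvgD; [exact: dcc|exact: cvg_cst].
    apply: (bilin_continuous _ d2 d2).
    apply: (@continuous_comp R _ _ (fun t => c t + eta t) G); first exact: ec.
    exact: Gcont (hk t t01).
  + exact: (unit_continuousD (unit_continuous_cst _) (unit_continuousD pc2 qc2)).
  move=> t t01; set eta := h + t *: (k - h); set v := k - h; set u := derive1 c t.
  have := bilin_expand u v (cr t t01) (hk t t01); rewrite -/eta => H.
  have /(le_trans (ler_norm _)) H' := H.
  have etaE : eta = (1 - t) *: h + t *: k by apply/rowP => j; rewrite !mxE; ring.
  move/andP: (t01) => [t0 t1].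
  have eta_le : `|eta| <= rho.
    rewrite etaE; apply: (le_trans (ler_normD _ _)); rewrite !normrZ (ger0_norm t0) ger0_norm ?subr_ge0//.
    by rewrite /rho; have := normr_ge0 h; have := normr_ge0 k; nra.
  have v_le : `|v| <= rho by rewrite /v /rho [leRHS]addrC; exact: ler_normB.
  have q_le : K * (`|eta| * `|u| + `|v|) ^+ 2 <= K * (sg + 1) ^+ 2 * rho ^+ 2.
    rewrite -mulrA ler_wpM2l ?(ltW K0)// -exprMn lerXn2r ?nnegrE//.
    - by rewrite mulr_ge0// addr_ge0.
    - by rewrite mulrDl mul1r lerD// [leRHS]mulrC ler_pM//; exact: cs.
  have DlE : bilin (D (c t) eta) u u = (1 - t) * bilin (D (c t) h) u u + t * bilin (D (c t) k) u u.
    rewrite etaE (mb_dlin box _ _ _ (cr t t01)) -[t *: k]addr0 (mb_dlin box _ _ _ (cr t t01)).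
    by rewrite (box_deriv0 (cr t t01)) addr0 bilinDm !bilinZm.
  have [_ _ _ Gu] := cP t t01.
  have GvE : bilin (G (c t)) u v = bilin (G (c t)) u k - bilin (G (c t)) u h by rewrite bilinDr bilinNr.
  rewrite (PpE t h t01) (PqE t k t01) -/u; move: H'; rewrite DlE GvE; move: Gu; rewrite -/u.
  by lra.
- move=> h; have [pc ph] := pE h; rewrite -ph.
  have bc : unit_continuous (fun t => bilin (G a) (derive1 c t) h).
    by move=> t t01; apply: bilin_continuous; [exact: cst_continuous|exact: dcc|exact: cst_continuous].
  have bE : bilin (G a) (b - a) h = unit_int (fun t => bilin (G a) (derive1 c t) h).
    by rewrite (unit_int_bilin _ _ cC) c0 c1.
  rewrite bE -(unit_intD pc bc); apply: unit_int_norm.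
    exact: (unit_continuousD pc bc).
  move=> t t01; rewrite (PpE t h t01).
  have -> : - bilin (G (c t)) (derive1 c t) h + (1 - t) / 2 * bilin (D (c t) h) (derive1 c t) (derive1 c t) + bilin (G a) (derive1 c t) h =
    - bilin (G (c t) - G a) (derive1 c t) h + (1 - t) / 2 * bilin (D (c t) h) (derive1 c t) (derive1 c t).
    by rewrite bilinDm bilinNm; ring.
  apply: (le_trans (ler_normD _ _)); rewrite normrN normrM.
  have H1 : `|bilin (G (c t) - G a) (derive1 c t) h| <= K * sg ^+ 2 * `|h|.
    apply: (le_trans (mb_lip box _ _ (cr t t01) ar)); rewrite ler_wpM2r// -mulrA ler_wpM2l ?(ltW K0)//.
    by rewrite expr2 ler_pM//; [exact: ca|exact: cs].
  have H2 : `|(1 - t) / 2| <= 1 by move/andP: t01 => [? ?]; rewrite ler_norml; apply/andP; split; lra.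
  have H3 := Dsg t h t01.
  have -> : 2 * K * sg ^+ 2 * `|h| = K * sg ^+ 2 * `|h| + 1 * (K * `|h| * sg ^+ 2) by ring.
  by apply: lerD => //; apply: ler_pM.
- move=> h; have [qc qh] := qE h; rewrite -qh; apply: unit_int_norm => // t t01.
  rewrite (PqE t h t01); apply: (le_trans (ler_normD _ _)); rewrite normrM.
  have H1 : `|bilin (G (c t)) (derive1 c t) h| <= K * sg * `|h|.
    apply: (le_trans (mb_up box _ _ (cr t t01))); rewrite ler_wpM2r// ler_wpM2l ?(ltW K0)//; exact: cs.
  have H2 : `|t / 2| <= 1 by move/andP: t01 => [? ?]; rewrite ler_norml; apply/andP; split; lra.
  have H3 := Dsg t h t01.
  apply: (@le_trans _ _ (K * sg * `|h| + 1 * (K * `|h| * sg ^+ 2))).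
    by apply: lerD => //; apply: ler_pM.
  have Kh : 0 <= K * `|h| by rewrite mulr_ge0// ltW.
  have -> : K * sg * `|h| + 1 * (K * `|h| * sg ^+ 2) = (K * `|h|) * (sg + sg ^+ 2) by ring.
  have -> : 2 * K * (sg + 1) ^+ 2 * `|h| = (K * `|h|) * (2 * (sg + 1) ^+ 2) by ring.
  by rewrite ler_wpM2l//; nra.
move=> h; set v := b - a; set B := D a h.
have [pc ph] := pE h; have [qc qh] := qE h.
have Bc (B' : 'M[R]_n) : unit_continuous (fun t => bilin B' (derive1 c t) v).
  by move=> t t01; apply: bilin_continuous; [exact: cst_continuous|exact: dcc|exact: cst_continuous].
have BI (B' : 'M[R]_n) : unit_int (fun t => bilin B' (derive1 c t) v) = bilin B' v v.
  by rewrite unit_int_bilin// c0 c1.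
clearbody v.
(* The terms in [G] cancel in [p + q]. What remains is compared with [D a h] at the mean velocity
   [v]: one term for moving the base point from [a] to [c t], one for the variance of the
   velocity. *)
pose f t := 2^-1 * bilin (D (c t) h - B) (derive1 c t) (derive1 c t) +
  2^-1 * bilin B (derive1 c t - v) (derive1 c t - v).
have dvc t : 0 <= t <= 1 -> {for t, continuous (fun t => derive1 c t - v)}.
  by move=> t01; apply: cvgB; [exact: dcc|exact: cvg_cst].
have fc1 : unit_continuous (fun t => bilin (D (c t) h - B) (derive1 c t) (derive1 c t)).
  move=> t t01; apply: bilin_continuous; [|exact: dcc|exact: dcc].
  by apply: cvgB; [exact: Dc|exact: cvg_cst].
have qfc (B' : 'M[R]_n) : unit_continuous (fun t => bilin B' (derive1 c t - v) (derive1 c t - v)).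
  by move=> t t01; apply: bilin_continuous; [exact: cst_continuous|exact: dvc|exact: dvc].
have fc : unit_continuous f.
  exact: (unit_continuousD (unit_continuousZ _ fc1) (unit_continuousZ _ (qfc B))).
have key : dotr (p + q) h - 2^-1 * bilin B v v = unit_int f.
  (* [B] is not known to be symmetric, so the two cross terms of the expanded square are integrated
     separately, one of them through the transpose. *)
  have BBc := unit_continuousZ 2^-1 (unit_continuousD (Bc B) (Bc B^T)).
  have Fc := unit_continuousD BBc (unit_continuous_cst (- (2^-1 * bilin B v v))).
  have -> : 2^-1 * bilin B v v = unit_int (fun t => 2^-1 * (bilin B (derive1 c t) v + bilin B^T (derive1 c t) v) + - (2^-1 * bilin B v v)).
    rewrite (unit_intD BBc (unit_continuous_cst _)) unit_int_cst.
    rewrite (unit_intZ 2^-1 (unit_continuousD (Bc B) (Bc B^T))) (unit_intD (Bc B) (Bc B^T)) !BI bilin_tr.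
    by move: (bilin _ _ _) => x; lra.
  rewrite dotrDl -ph -qh -(unit_intD pc qc).
  set F1 := unit_int _; set F2 := unit_int _; have -> : F1 - F2 = F1 + (-1) * F2 by rewrite mulN1r.
  rewrite /F2 -(unit_intZ (-1) Fc) /F1 -(unit_intD (unit_continuousD pc qc) (unit_continuousZ (-1) Fc)).
  apply: unit_int_eq => t t01; rewrite (PpE t h t01) (PqE t h t01) /f bilin_tr.
  rewrite !bilinDm !bilinNm !bilinDl !bilinDr !bilinNl !bilinNr.
  by field.
rewrite key.
(* The variance of the velocity is the energy minus the energy of the mean velocity. For an almost
   minimal curve this difference is small, and coercivity turns it into a bound on the second term
   of [f]. *)
have v2 : unit_int (fun t => bilin (G a) (derive1 c t - v) (derive1 c t - v)) <=
    dlt ^+ 2 + K * sg ^+ 3 - bilin (G a) v v.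
  have -> : dlt ^+ 2 + K * sg ^+ 3 - bilin (G a) v v = unit_int (fun t => (dlt ^+ 2 + K * sg ^+ 3 + bilin (G a) v v) +
      (-2) * bilin (G a) (derive1 c t) v).
    rewrite (unit_intD (unit_continuous_cst _) (unit_continuousZ (-2) (Bc (G a)))).
    by rewrite (unit_intZ (-2) (Bc (G a))) unit_int_cst BI; ring.
  apply: unit_int_le; first exact: qfc.
    exact: (unit_continuousD (unit_continuous_cst _) (unit_continuousZ (-2) (Bc (G a)))).
  move=> t t01; set u := derive1 c t; have [_ _ _ Gu] := cP t t01.
  have := mb_lip box u u (cr t t01) ar; rewrite bilinDm bilinNm ler_norml => /andP[L _].
  have L2 : K * `|c t - a| * `|u| * `|u| <= K * sg ^+ 3.
    have -> : K * sg ^+ 3 = K * sg * sg * sg by ring.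
    apply: ler_pM => //; try exact: cs.
      by rewrite !mulr_ge0// ltW.
    apply: ler_pM => //; try exact: cs.
      by rewrite !mulr_ge0// ltW.
    by rewrite (ler_pM2l K0); exact: ca.
  rewrite bilinDl !bilinDr !bilinNl !bilinNr (mb_sym box v u ar).
  have L3 : - (K * sg ^+ 3) <= bilin (G (c t)) u u - bilin (G a) u u.
    by apply: le_trans L; rewrite lerN2.
  move: Gu L3; rewrite -/u.
  move: (bilin (G (c t)) u u) (bilin (G a) u u) (bilin (G a) u v) (bilin (G a) v v).
  move: (dlt ^+ 2) (K * sg ^+ 3) => X1 X2 X3 X4 X5 X6; lra.
apply: (@le_trans _ _ (unit_int (fun t => 2^-1 * (K * sg ^+ 3 * `|h|) + 2^-1 * (K / lam) * `|h| * bilin (G a) (derive1 c t - v) (derive1 c t - v)))).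
  have bnd t : 0 <= t <= 1 -> `|f t| <= 2^-1 * (K * sg ^+ 3 * `|h|) + 2^-1 * (K / lam) * `|h| * bilin (G a) (derive1 c t - v) (derive1 c t - v).
    move=> t01; rewrite /f; apply: (le_trans (ler_normD _ _)); rewrite !normrM ger0_norm ?invr_ge0//.
    apply: lerD.
      rewrite ler_wpM2l ?invr_ge0//; apply: (le_trans (mb_dlip box _ _ _ (cr t t01) ar)).
      have -> : K * sg ^+ 3 * `|h| = K * sg * `|h| * sg * sg by ring.
      apply: ler_pM => //; try exact: cs.
        by rewrite !mulr_ge0// ltW.
      apply: ler_pM => //; try exact: cs.
        by rewrite !mulr_ge0// ltW.
      by rewrite ler_wpM2r// (ler_pM2l K0); exact: ca.
    rewrite -!mulrA ler_wpM2l ?invr_ge0//; apply: (le_trans (mb_dup box _ _ _ ar)).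
    have := mb_low box (derive1 c t - v) ar; set X := bilin (G a) _ _ => HX.
    have -> : K * (lam^-1 * (`|h| * X)) = K * `|h| * (X / lam) by ring.
    rewrite -[leLHS]mulrA ler_wpM2l ?mulr_ge0 ?(ltW K0)//.
    by rewrite -expr2 ler_pdivlMr// mulrC.
  have gc : unit_continuous (fun t => 2^-1 * (K * sg ^+ 3 * `|h|) + 2^-1 * (K / lam) * `|h| * bilin (G a) (derive1 c t - v) (derive1 c t - v)).
    exact: (unit_continuousD (unit_continuous_cst _) (unit_continuousZ _ (qfc (G a)))).
  rewrite ler_norml; apply/andP; split.
    rewrite lerNl -mulN1r -(unit_intZ (-1) fc); apply: unit_int_le; [exact: unit_continuousZ|exact: gc|].
    by move=> t /bnd; rewrite ler_norml => /andP[+ _]; rewrite mulN1r lerNl.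
  by apply: unit_int_le; [exact: fc|exact: gc|move=> t /bnd; rewrite ler_norml => /andP[]].
rewrite (unit_intD (unit_continuous_cst _) (unit_continuousZ _ (qfc (G a)))).
rewrite (unit_intZ _ (qfc (G a))) unit_int_cst mulrDr lerD2l -!mulrA.
rewrite !ler_wpM2l ?invr_ge0//; [exact: ltW|exact: ltW].
Qed.

End LocalEstimate.

(** * Limit points of bounded covectors *)

Section ClusterPairs.
Context {R : realType} {n : nat}.

Lemma cluster_rV (m : nat) (u : nat -> 'rV[R]_m) (B : R) : (forall k, `|u k| <= B) ->
  exists z, forall e, 0 < e -> forall N : nat, exists2 k, (N <= k)%N & `|u k - z| < e.
Proof.
move=> uB; pose S := [set v : 'rV[R]_m | `|v| <= B].
have Sc : compact S.
  apply: bounded_closed_compact.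
    exists B; split; first by rewrite num_real.
    by move=> e Be v; rewrite /S/= => vB; exact/ltW/(le_lt_trans vB).
  have -> : S = (fun v : 'rV[R]_m => `|v|) @^-1` [set x | x <= B] by [].
  apply: preimage_closed; last exact: closed_le.
  by move=> v _; exact: norm_continuous.
have [|z [_ zc]] := Sc (u @ \oo) _; first by exists 0%N => // k _; exact: uB.
exists z => e e0 N.
have [||v [[/= k Nk <-] vz]] := zc [set v | exists2 k, (N <= k)%N & u k = v] (ball z e).
- by exists N => // k Nk; exists k.
- exact: nbhsx_ballx.
- by exists k => //; move: vz; rewrite -ball_normE/= distrC.
Qed.

(** In the application [e] is the excess length of an almost minimal curve, and [p], [q] are its
    covectors. They are put in one row vector, so that one compactness argument gives a common limit
    point for [e] tending to 0. *)
Lemma cluster_pair (FV : R -> 'rV[R]_n -> 'rV[R]_n -> Prop) (e0 B : R) : 0 < e0 ->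
  (forall e, 0 < e < e0 -> exists p q, [/\ FV e p q, `|p| <= B & `|q| <= B]) ->
  exists P Q, forall eta, 0 < eta -> exists e p q,
    [/\ FV e p q, 0 < e < e0 & [/\ e <= eta, `|p - P| <= eta & `|q - Q| <= eta]].
Proof.
(* The shift by 2 keeps every value strictly below [e0]. *)
move=> e00 H; pose ek (k : nat) : R := e0 / k.+2%:R.
have ekP k : 0 < ek k < e0.
  by rewrite divr_gt0//= ltr_pdivrMr// ltr_pMr// ltr1n.
have /choice[pq pqP] : forall k, exists pq : 'rV[R]_n * 'rV[R]_n,
    [/\ FV (ek k) pq.1 pq.2, `|pq.1| <= B & `|pq.2| <= B].
  by move=> k; have [p [q pqP]] := H (ek k) (ekP k); exists (p, q).
have nle (u v : 'rV[R]_n) (C : R) : 0 <= C -> `|u| <= C -> `|v| <= C -> `|row_mx u v| <= C.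
  move=> C0 uC vC; apply: rV_norm_le => // j; rewrite mxE; case: (fintype.split j) => i.
    exact: le_trans (rV_coord_le _ _) uC.
  exact: le_trans (rV_coord_le _ _) vC.
have B0 : 0 <= B by have [_ + _] := pqP 0%N; exact: le_trans.
have [z zP] := @cluster_rV _ (fun k => row_mx (pq k).1 (pq k).2) B
   (fun k => nle _ _ _ B0 (let: And3 _ a _ := pqP k in a) (let: And3 _ _ a := pqP k in a)).
exists (lsubmx z), (rsubmx z) => eta eta0.
pose N := Num.bound (e0 / eta).
have [k Nk kz] := zP eta eta0 N.
have [FVk _ _] := pqP k.
exists (ek k), (pq k).1, (pq k).2; split; [exact: FVk|exact: ekP|split].
- rewrite ler_pdivrMr// mulrC -ler_pdivrMr//; apply: ltW.
  have /archi_boundP : 0 <= e0 / eta by rewrite divr_ge0 ?ltW.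
  move=> /lt_le_trans; apply; rewrite ler_nat -/N; apply: (leq_trans Nk).
  by rewrite (leq_trans (leqnSn _))// leqnSn.
- apply: rV_norm_le; first exact: ltW.
  move=> j; have := le_lt_trans (rV_coord_le _ (lshift n j)) kz.
  by rewrite !mxE -[lshift n j]/(unsplit (inl _ j)) unsplitK => /ltW.
- apply: rV_norm_le; first exact: ltW.
  move=> j; have := le_lt_trans (rV_coord_le _ (rshift n j)) kz.
  by rewrite !mxE -[rshift n j]/(unsplit (inr _ j)) unsplitK => /ltW.
Qed.

Lemma le_eps (X Y T : R) : 0 <= T -> (forall eta, 0 < eta -> X <= Y + T * eta) -> X <= Y.
Proof.
move=> T0 H; apply/ler_addgt0Pr => e e0.
have T1 : 0 < T + 1 by rewrite ltr_wpDl.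
have := H (e / (T + 1)); rewrite divr_gt0// => /(_ isT)/le_trans; apply.
rewrite lerD2l mulrCA ler_piMr//; first exact: ltW.
by rewrite ler_pdivrMr// mul1r lerDl.
Qed.

End ClusterPairs.

Lemma unit_bound {R : realType} (x y : R) : 0 <= x -> 0 <= y -> y <= 1 ->
  (x + y) ^+ 2 <= x ^+ 2 + (2 * x + 1) * y /\
  (x + y) ^+ 3 <= x ^+ 3 + (3 * x ^+ 2 + 3 * x + 1) * y.
Proof.
move=> x_ge0 y_ge0 y1; have y2 : y ^+ 2 <= y by rewrite expr2 ler_piMr.
have y3 : y ^+ 3 <= y by rewrite exprS ler_piMr// exprn_ile1.
split.
  have -> : (x + y) ^+ 2 = x ^+ 2 + 2 * x * y + y ^+ 2 by ring.
  by rewrite (mulrDl (2 * x) 1 y) mul1r addrA lerD2l.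
have -> : (x + y) ^+ 3 = x ^+ 3 + 3 * x ^+ 2 * y + 3 * x * y ^+ 2 + y ^+ 3 by ring.
have : 3 * x * y ^+ 2 <= 3 * x * y by rewrite ler_wpM2l// mulr_ge0.
by move: y3; move: (y ^+ 3) (3 * x * y ^+ 2) => *; lra.
Qed.

(** * Second order expansion of the squared distance *)

Section LocalDistance.
Context {R : realType} {n : nat}.
Variables (G : 'rV[R]_n -> 'M[R]_n) (D : 'rV[R]_n -> 'rV[R]_n -> 'M[R]_n).
Variables (x0 : 'rV[R]_n) (r lam K : R).
Hypothesis box : metric_box G D x0 r lam K.
Hypothesis Gcont : forall a, `|a - x0| < r -> {for a, continuous G}.
Hypothesis Dcont : forall (a h : 'rV[R]_n), `|a - x0| < r ->
  {for a, continuous (fun b : 'rV[R]_n => D b h)}.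
Variables (d : 'rV[R]_n -> 'rV[R]_n -> R) (r1 r2 e0 : R).
Hypothesis d_ge0 : forall a b, 0 <= d a b.
Hypothesis (r10 : 0 < r1) (e00 : 0 < e0) (r2r : r2 + 2 * r1 <= r) (r20 : 0 < r2).
Hypothesis d_energy : forall c : R -> 'rV[R]_n,
  (forall t, 0 <= t <= 1 -> `|c t - x0| < r /\ C1_at c t) ->
  d (c 0) (c 1) ^+ 2 <= unit_int (fun t => bilin (G (c t)) (derive1 c t) (derive1 c t)).
Hypothesis d_curve : forall a b, `|a - x0| < r1 -> `|b - x0| < r1 ->
  forall e, 0 < e < e0 -> exists c : R -> 'rV[R]_n, [/\ c 0 = a, c 1 = b &
   forall t, 0 <= t <= 1 -> [/\ `|c t - x0| < r2, C1_at c t &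
     bilin (G (c t)) (derive1 c t) (derive1 c t) <= (d a b + e) ^+ 2]].
Implicit Types (a b u v h k : 'rV[R]_n) (c : R -> 'rV[R]_n).

Let K0 : 0 < K := mb_K box.
Let lam0 : 0 < lam := mb_lam box.
Let kap := (Num.sqrt lam)^-1.
Let kap0 : 0 < kap. Proof. by rewrite invr_gt0 sqrtr_gt0. Qed.

(** The competitor is the straight segment; freezing the metric at [a] changes its energy by a cubic
    term. *)
Lemma d_upper a b : `|a - x0| < r -> `|b - x0| < r ->
  d a b ^+ 2 <= bilin (G a) (b - a) (b - a) + K * `|b - a| ^+ 3.
Proof.
move=> ar br; set v := b - a.
have := @d_energy (fun t => a + t *: v).
rewrite scale0r addr0 scale1r addrCA subrr addr0 => /(_ _)/wrap[].
  by move=> t t01; split; [exact: segment_ball|exact: C1_at_segment].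
move=> H; apply: (le_trans H); rewrite -[leRHS]unit_int_cst; apply: unit_int_le.
- move=> t t01; apply: (@eq_continuous_at R R (fun t => bilin (G (a + t *: v)) v v)).
    by move=> s; rewrite derive1_segment.
  have sc := C1_at_continuous (C1_at_segment a v t).
  apply: bilin_continuous; [|exact: cst_continuous|exact: cst_continuous].
  apply: (@continuous_comp R _ _ (fun t => a + t *: v) G); first exact: sc.
  by apply: Gcont; exact: segment_ball.
- by move=> t _; exact: cvg_cst.
move=> t t01; rewrite derive1_segment.
have tr : `|a + t *: v - x0| < r by exact: segment_ball.
have := mb_lip box v v tr ar; rewrite bilinDm bilinNm ler_norml => /andP[_].
have -> : a + t *: v - a = t *: v by rewrite addrAC subrr add0r.
rewrite normrZ; move/andP: t01 => [t0 t1]; rewrite (ger0_norm t0) => L.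
have : K * (t * `|v|) * `|v| * `|v| <= K * `|v| ^+ 3.
  have -> : K * (t * `|v|) * `|v| * `|v| = t * (K * `|v| ^+ 3) by ring.
  by rewrite ler_piMl// mulr_ge0 ?exprn_ge0// ltW.
by move: L; move: (bilin _ _ _) (bilin _ _ _) (K * _) (K * _) => *; lra.
Qed.

Lemma d_upper2 a b : `|a - x0| < r -> `|b - x0| < r ->
  d a b <= Num.sqrt (K * (1 + 2 * r)) * `|b - a|.
Proof.
move=> ar br; have r0 := mb_r box.
rewrite -(ler_pXn2r (n := 2))// ?nnegrE ?mulr_ge0// exprMn sqr_sqrtr ?mulr_ge0 ?(ltW K0) ?addr_ge0 ?mulr_ge0 ?(ltW r0)//.
apply: (le_trans (d_upper ar br)).
have v2r : `|b - a| <= 2 * r.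
  have -> : b - a = (b - x0) - (a - x0) by rewrite opprB addrA subrK.
  by apply: (le_trans (ler_normB _ _)); lra.
have := mb_up box (b - a) (b - a) ar => /(le_trans (ler_norm _)) H.
have : K * `|b - a| ^+ 3 <= K * `|b - a| ^+ 2 * (2 * r).
  by rewrite [in leLHS]exprSr [leLHS]mulrA ler_wpM2l// mulr_ge0 ?exprn_ge0// ltW.
have -> : K * (1 + 2 * r) * `|b - a| ^+ 2 = K * `|b - a| * `|b - a| + K * `|b - a| ^+ 2 * (2 * r) by ring.
by move: H; move: (bilin _ _ _) (K * `|b - a| ^+ 3) => *; lra.
Qed.

Lemma coord_speed a v (dlt : R) : 0 <= dlt -> `|a - x0| < r ->
  bilin (G a) v v <= dlt ^+ 2 -> `|v| <= kap * dlt.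
Proof.
move=> d0 ar H; have /le_trans/(_ H) := mb_low box v ar.
rewrite -[lam]sqr_sqrtr ?(ltW lam0)// -exprMn ler_pXn2r// ?nnegrE ?mulr_ge0 ?sqrtr_ge0//.
by rewrite mulrC /kap [_^-1 * _]mulrC ler_pdivlMr ?sqrtr_gt0.
Qed.

Lemma d_lower a b : `|a - x0| < r1 -> `|b - x0| < r1 -> `|b - a| <= kap * d a b.
Proof.
move=> ar br; apply/ler_addgt0Pr => e ep.
pose e' := Order.min (e / kap) e0 / 2.
have m0 : 0 < Order.min (e / kap) e0 by rewrite lt_min divr_gt0.
have e'P : 0 < e' < e0.
  rewrite divr_gt0//= ltr_pdivrMr// ; apply: (@le_lt_trans _ _ e0); first by rewrite ge_min lexx orbT.
  by rewrite ltr_pMr// ltr1n.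
have [c [c0 c1 cP]] := d_curve ar br e'P.
have e'0 : 0 < e' by case/andP: e'P.
have : `|c 1 - c 0| <= kap * (d a b + e') * 1.
  apply: curve_lipschitz => // t t01; have [ct cC cb] := cP t t01; split => //.
  apply: (@coord_speed (c t)) => //; first by rewrite addr_ge0// ltW.
  by apply: (lt_le_trans ct); move: r2r r10; lra.
rewrite c0 c1 mulr1 => H; apply: (le_trans H); rewrite mulrDr lerD2l mulrC -ler_pdivlMr//.
apply: (@le_trans _ _ (Order.min (e / kap) e0)); last by rewrite ge_min lexx.
by rewrite ler_pdivrMr// ler_pMr// ler1n.
Qed.

(** An almost minimal curve from [a] to [b], displaced by the interpolation of [h] and [k], competes
    for the displaced endpoints. It stays in the ball because both displacements are shorter than
    [2 * r1] and [r2 + 2 * r1 <= r]. *)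
Lemma local_estimate_approx a b e : `|a - x0| < r1 -> `|b - x0| < r1 ->
  0 < e < e0 -> e <= 1 ->
  let dl := d a b + e in let sg := kap * dl in
  exists p q : 'rV[R]_n, [/\
    forall h k, `|a + h - x0| < r1 -> `|b + k - x0| < r1 ->
      d (a + h) (b + k) ^+ 2 <= dl ^+ 2 + 2 * (dotr p h + dotr q k) +
         K * (sg + 1) ^+ 2 * (`|h| + `|k|) ^+ 2,
    forall h, `|dotr p h + bilin (G a) (b - a) h| <= 2 * K * sg ^+ 2 * `|h|,
    forall h, `|dotr q h| <= 2 * K * (sg + 1) ^+ 2 * `|h| &
    forall h, `|dotr (p + q) h - 2^-1 * bilin (D a h) (b - a) (b - a)| <=
      2^-1 * (K * sg ^+ 3 * `|h| + K / lam * `|h| *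
      (dl ^+ 2 + K * sg ^+ 3 - bilin (G a) (b - a) (b - a)))].
Proof.
move=> ar br eP e1 dl sg; have [c [c0 c1 cP]] := d_curve ar br eP.
have ep : 0 < e by case/andP: eP.
have dl0 : 0 <= dl by rewrite addr_ge0// ltW.
have sg0 : 0 <= sg by rewrite mulr_ge0// ltW.
have r2r' : r2 <= r by move: r2r r10; lra.
have r1r : r1 <= r by move: r2r r10 r20; lra.
have ar' := lt_le_trans ar r1r.
have [t t01|p [q [H1 H2 H3 H4]]] := first_variation box Gcont Dcont sg0 c0 c1 ar' (dlt := dl).
  have [ct cC cb] := cP t t01; have ct' := lt_le_trans ct r2r'.
  by split => //; exact: coord_speed cb.
exists p, q; split => // h k ahr bkr.
have dist u v : `|u - x0| < r1 -> `|u + v - x0| < r1 -> `|v| < 2 * r1.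
  move=> ur uvr; have -> : v = (u + v - x0) - (u - x0) by rewrite opprB addrA subrK addrAC subrr add0r.
  by apply: (le_lt_trans (ler_normB _ _)); lra.
have hr := dist _ _ ar ahr; have kr := dist _ _ br bkr.
pose c2 (t : R) := c t + (h + t *: (k - h)).
have c2r t : 0 <= t <= 1 -> `|c2 t - x0| < r.
  move=> t01; have [ct _ _] := cP t t01.
  have -> : c2 t - x0 = (c t - x0) + (h + t *: (k - h) - 0) by rewrite subr0 /c2 addrAC.
  apply: (le_lt_trans (ler_normD _ _)).
  have : `|h + t *: (k - h) - 0| < 2 * r1 by apply: segment_ball; rewrite ?subr0.
  by move: ct r2r; lra.
have c2C t : 0 <= t <= 1 -> C1_at c2 t.
  move=> t01; have [_ cC _] := cP t t01.
  exact: (C1_atD cC (C1_at_segment h (k - h) t)).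
have := d_energy (c := c2) (fun t t01 => conj (c2r t t01) (c2C t t01)).
have -> : c2 0 = a + h by rewrite /c2 scale0r addr0 c0.
have -> : c2 1 = b + k by rewrite /c2 scale1r [h + _]addrC subrK c1.
move=> H.
apply: (le_trans H); apply: le_trans (H1 h k _) => //.
rewrite le_eqVlt; apply/orP; left; apply/eqP; apply: unit_int_eq => t t01.
suff -> : derive1 c2 t = derive1 c t + (k - h) by [].
have [_ cC _] := cP t t01.
have D1 := nbhs_singleton (C1_at_is_derive cC).
have := is_deriveD D1 (is_derive_segment h (k - h) t).
by case=> _ <-; rewrite derive1E.
Qed.

Let kap2 := Num.sqrt (K * (1 + 2 * r)).
Let ck := kap * kap2.

(** The limit of [local_estimate_approx] for [e] tending to 0. The coordinate speed [sg] becomes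
    [kap * d a b], which is at most [ck * |b - a|]; this turns the errors of the covectors into
    powers of [|b - a|]. *)
Lemma local_estimate : exists C, 0 <= C /\ forall a b, `|a - x0| < r1 -> `|b - x0| < r1 ->
  exists p q : 'rV[R]_n, [/\
    forall h k, `|a + h - x0| < r1 -> `|b + k - x0| < r1 ->
      d (a + h) (b + k) ^+ 2 / 2 <= d a b ^+ 2 / 2 + dotr p h + dotr q k +
         C * (`|h| + `|k|) ^+ 2,
    forall h, `|dotr p h + bilin (G a) (b - a) h| <= C * `|b - a| ^+ 2 * `|h| &
    forall h, `|dotr (p + q) h - 2^-1 * bilin (D a h) (b - a) (b - a)| <=
      C * `|b - a| ^+ 3 * `|h|].
Proof.
have r0 := mb_r box.
have r1r : r1 <= r by move: r2r r10 r20; lra.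
pose C1 := K * (kap * (kap2 * (2 * r) + 1) + 1) ^+ 2.
pose C2 := 2 * K * ck ^+ 2.
pose C3 := 2^-1 * (K * ck ^+ 3 + K / lam * (K + K * ck ^+ 3)).
have kl : 0 <= K / lam by rewrite divr_ge0// ltW.
have kap2_0 : 0 <= kap2 by exact: sqrtr_ge0.
have ck0 : 0 <= ck by rewrite mulr_ge0// ltW.
have Kck3 : 0 <= K * ck ^+ 3 by rewrite mulr_ge0 ?exprn_ge0// ltW.
have C10 : 0 <= C1 by rewrite mulr_ge0 ?sqr_ge0// ltW.
have C20 : 0 <= C2 by rewrite !mulr_ge0 ?exprn_ge0// ltW.
have C30 : 0 <= C3 by rewrite mulr_ge0// addr_ge0// mulr_ge0// addr_ge0// ltW.
exists (C1 + C2 + C3); split; first by rewrite !addr_ge0.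
move=> a b ar br; set s := `|b - a|; have s0 : 0 <= s by exact: normr_ge0.
have ar' := lt_le_trans ar r1r; have br' := lt_le_trans br r1r.
have dab0 := d_ge0 a b.
have ds : d a b <= kap2 * s by exact: d_upper2.
have s2r : s <= 2 * r.
  rewrite /s; have -> : b - a = (b - x0) - (a - x0) by rewrite opprB addrA subrK.
  by apply: (le_trans (ler_normB _ _)); move: r1r ar br; lra.
have kd : kap * d a b <= ck * s by rewrite -mulrA ler_pM2l.
have kd0 : 0 <= kap * d a b by rewrite mulr_ge0// ltW.
pose FV e (p q : 'rV[R]_n) := let dl := d a b + e in let sg := kap * dl in [/\ e <= 1,
    forall h k, `|a + h - x0| < r1 -> `|b + k - x0| < r1 ->
      d (a + h) (b + k) ^+ 2 <= dl ^+ 2 + 2 * (dotr p h + dotr q k) +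
         K * (sg + 1) ^+ 2 * (`|h| + `|k|) ^+ 2,
    forall h, `|dotr p h + bilin (G a) (b - a) h| <= 2 * K * sg ^+ 2 * `|h| &
    forall h, `|dotr (p + q) h - 2^-1 * bilin (D a h) (b - a) (b - a)| <=
      2^-1 * (K * sg ^+ 3 * `|h| + K / lam * `|h| *
      (dl ^+ 2 + K * sg ^+ 3 - bilin (G a) (b - a) (b - a)))].
pose m := Order.min e0 1.
have m0 : 0 < m by rewrite lt_min e00 ltr01.
(* As [e <= 1], [S1] bounds the coordinate speed for every [e]; hence [B] bounds the covectors
   uniformly in [e], as the limit point requires. *)
pose S1 := kap * (d a b + 1).
have S10 : 0 <= S1 by rewrite mulr_ge0 ?addr_ge0// ltW.
pose B := 2 * K * (S1 + 1) ^+ 2 + K * s.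
have K0' := ltW K0.
have Ks : 0 <= K * s by rewrite mulr_ge0.
have B0 : 0 <= B by rewrite addr_ge0// mulr_ge0 ?sqr_ge0// mulr_ge0.
have [e eP|P [Q PQ]] := cluster_pair (FV := FV) (B := B) m0.
  have e0' : 0 < e < e0 by move: eP; rewrite lt_min => /andP[-> /andP[-> _]].
  have e1 : e <= 1 by move: eP; rewrite lt_min => /andP[_ /andP[_ /ltW]].
  have [p [q [H1 H2 H3 H4]]] := local_estimate_approx ar br e0' e1.
  have ep : 0 <= e by case/andP: e0' => /ltW.
  have sgS : kap * (d a b + e) <= S1 by rewrite ler_pM2l// lerD2l.
  have sg0 : 0 <= kap * (d a b + e) by rewrite mulr_ge0 ?addr_ge0// ltW.
  have S11 : 0 <= S1 + 1 by rewrite addr_ge0.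
  have sgS2 : (kap * (d a b + e)) ^+ 2 <= (S1 + 1) ^+ 2.
    by rewrite ler_pXn2r// ?nnegrE//; apply: (le_trans sgS); rewrite lerDl.
  have sgS3 : (kap * (d a b + e) + 1) ^+ 2 <= (S1 + 1) ^+ 2.
    by rewrite ler_pXn2r// ?nnegrE ?lerD2r// addr_ge0.
  exists p, q; split; first by split.
  - apply: rV_norm_le => // j; rewrite -dotr_delta; set h := delta_mx 0 j.
    have h1 : `|h| <= 1.
      apply: rV_norm_le => // k; rewrite !mxE; case: (_ && _); rewrite ?normr1 ?normr0//.
    have -> : dotr p h = (dotr p h + bilin (G a) (b - a) h) - bilin (G a) (b - a) h by rewrite addrK.
    apply: (le_trans (ler_normB _ _)); apply: lerD.
      apply: (le_trans (H2 h)); rewrite -[leRHS]mulr1; apply: ler_pM => //; first by rewrite mulr_ge0 ?sqr_ge0// mulr_ge0.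
      by rewrite ler_wpM2l// mulr_ge0.
    apply: (le_trans (mb_up box _ _ ar')); rewrite -/s -[leRHS]mulr1 ler_wpM2l// mulr_ge0// ltW.
  - apply: rV_norm_le => // j; rewrite -dotr_delta; set h := delta_mx 0 j.
    have h1 : `|h| <= 1.
      apply: rV_norm_le => // k; rewrite !mxE; case: (_ && _); rewrite ?normr1 ?normr0//.
    apply: (le_trans (H3 h)); apply: (@le_trans _ _ (2 * K * (S1 + 1) ^+ 2 * 1)).
      apply: ler_pM => //; first by rewrite mulr_ge0 ?sqr_ge0// mulr_ge0.
      by rewrite ler_wpM2l// mulr_ge0.
    by rewrite mulr1 /B lerDl mulr_ge0// ltW.
have dd (p P' h : 'rV[R]_n) (eta : R) : `|p - P'| <= eta -> `|dotr p h - dotr P' h| <= n%:R * eta * `|h|.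
  move=> pP; rewrite -dotrNl -dotrDl; apply: (le_trans (dotr_norm _ _)).
  by rewrite ler_wpM2r// ler_wpM2l.
have PQ' eta : 0 < eta -> exists e p q, [/\ FV e p q, 0 < e & [/\ e <= eta, `|p - P| <= eta & `|q - Q| <= eta]].
  by move=> /PQ[e [p [q [H1 /andP[H2 _] H3]]]]; exists e, p, q.
have n0 : 0 <= (n%:R : R) by [].
exists P, Q; split.
- move=> h k ahr bkr; set rho := `|h| + `|k|.
  have rho0 : 0 <= rho by rewrite addr_ge0.
  apply: (@le_trans _ _ (d a b ^+ 2 / 2 + dotr P h + dotr Q k + C1 * rho ^+ 2)); last first.
    rewrite lerD2l ler_wpM2r ?exprn_ge0//; lra.
  apply: (@le_eps _ _ _ ((2 * d a b + 1) / 2 + n%:R * rho)).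
    by rewrite addr_ge0 ?mulr_ge0 ?invr_ge0 ?addr_ge0 ?mulr_ge0.
  move=> eta eta0; have [e [p [q [[e1 H1 _ _] ep [ee pP qQ]]]]] := PQ' eta eta0.
  have [ub _] := unit_bound dab0 (ltW ep) e1.
  have ub' : (d a b + e) ^+ 2 <= d a b ^+ 2 + (2 * d a b + 1) * eta.
    by apply: (le_trans ub); rewrite lerD2l ler_wpM2l// addr_ge0// mulr_ge0.
  have := dd _ _ h _ pP; rewrite ler_norml => /andP[_ ph].
  have := dd _ _ k _ qQ; rewrite ler_norml => /andP[_ qk].
  have := H1 h k ahr bkr; rewrite -/rho.
  have Kb : K * (kap * (d a b + e) + 1) ^+ 2 * rho ^+ 2 <= C1 * rho ^+ 2.
    have A0 : 0 <= kap * (d a b + e) + 1 by rewrite addr_ge0// mulr_ge0 ?addr_ge0// ltW.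
    have A1 : kap * (d a b + e) + 1 <= kap * (kap2 * (2 * r) + 1) + 1.
      by rewrite lerD2r ler_pM2l// lerD//; apply: (le_trans ds); rewrite ler_wpM2l.
    rewrite ler_wpM2r ?exprn_ge0// /C1 ler_wpM2l// ler_pXn2r// nnegrE.
    exact: le_trans A1.
  have -> : n%:R * rho = n%:R * `|h| + n%:R * `|k| by rewrite /rho mulrDr.
  have C1r : 0 <= C1 * rho ^+ 2 by rewrite mulr_ge0 ?exprn_ge0.
  move: ub' ph qk Kb C1r; clear -eta0.
  move: (d (a + h) (b + k) ^+ 2) ((d a b + e) ^+ 2) (d a b ^+ 2) (K * _ ^+ 2 * _) (C1 * _).
  move: (dotr p h) (dotr P h) (dotr q k) (dotr Q k) (d a b) (`|h|) (`|k|).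
  by move=> *; lra.
- move=> h; set g := bilin _ _ _.
  apply: (@le_trans _ _ (2 * K * (kap * d a b) ^+ 2 * `|h|)); last first.
    rewrite ler_wpM2r//; apply: (@le_trans _ _ (C2 * s ^+ 2)).
        have -> : C2 * s ^+ 2 = 2 * K * (ck * s) ^+ 2 by rewrite /C2; ring.
        by rewrite ler_wpM2l ?mulr_ge0// ler_pXn2r// nnegrE// mulr_ge0.
      by rewrite ler_wpM2r ?exprn_ge0//; lra.
  apply: (@le_eps _ _ _ (2 * K * kap ^+ 2 * (2 * d a b + 1) * `|h| + n%:R * `|h|)).
    by rewrite addr_ge0 ?mulr_ge0 ?exprn_ge0 ?addr_ge0 ?mulr_ge0 ?(ltW kap0).
  move=> eta eta0; have [e [p [q [[e1 _ H2 _] ep [ee pP _]]]]] := PQ' eta eta0.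
  have [ub _] := unit_bound dab0 (ltW ep) e1.
  have ub' : (d a b + e) ^+ 2 <= d a b ^+ 2 + (2 * d a b + 1) * eta.
    by apply: (le_trans ub); rewrite lerD2l ler_wpM2l// addr_ge0// mulr_ge0.
  have -> : dotr P h + g = (dotr p h + g) - (dotr p h - dotr P h) by ring.
  apply: (le_trans (ler_normB _ _)).
  apply: (le_trans (lerD (H2 h) (dd _ _ h _ pP))).
  have : 2 * K * (kap * (d a b + e)) ^+ 2 * `|h| <= 2 * K * (kap * d a b) ^+ 2 * `|h| + 2 * K * kap ^+ 2 * (2 * d a b + 1) * `|h| * eta.
    have -> : 2 * K * (kap * d a b) ^+ 2 * `|h| + 2 * K * kap ^+ 2 * (2 * d a b + 1) * `|h| * eta =
      2 * K * kap ^+ 2 * `|h| * (d a b ^+ 2 + (2 * d a b + 1) * eta) by ring.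
    have -> : 2 * K * (kap * (d a b + e)) ^+ 2 * `|h| = 2 * K * kap ^+ 2 * `|h| * (d a b + e) ^+ 2 by ring.
    by rewrite ler_wpM2l// !mulr_ge0 ?exprn_ge0 ?(ltW kap0).
  move: (2 * K * (kap * (d a b + e)) ^+ 2 * `|h|) (2 * K * (kap * d a b) ^+ 2 * `|h|) (2 * K * kap ^+ 2 * (2 * d a b + 1) * `|h|).
  by move: (`|h|) => *; lra.
move=> h; set g := bilin (D a h) _ _; set gv := bilin (G a) (b - a) (b - a).
have gvs : d a b ^+ 2 - gv <= K * s ^+ 3 by rewrite lerBlDl; exact: d_upper.
have dc3 : K * (kap * d a b) ^+ 3 <= K * ck ^+ 3 * s ^+ 3.
  by rewrite -mulrA -exprMn ler_wpM2l// ler_pXn2r// nnegrE// mulr_ge0.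
apply: (@le_trans _ _ (2^-1 * (K * (kap * d a b) ^+ 3 * `|h| + K / lam * `|h| * (d a b ^+ 2 + K * (kap * d a b) ^+ 3 - gv)))); last first.
  apply: (@le_trans _ _ (C3 * s ^+ 3 * `|h|)); last first.
    by rewrite ler_wpM2r// ler_wpM2r ?exprn_ge0//; lra.
  have -> : C3 * s ^+ 3 * `|h| = 2^-1 * (K * ck ^+ 3 * s ^+ 3 * `|h| + K / lam * `|h| * (K * s ^+ 3 + K * ck ^+ 3 * s ^+ 3)).
    by rewrite /C3; ring.
  rewrite ler_pM2l ?invr_gt0// lerD ?ler_wpM2r// ler_wpM2l ?mulr_ge0 ?invr_ge0 ?(ltW lam0)//.
  move: gvs dc3; move: (d a b ^+ 2) (K * s ^+ 3) (K * (kap * d a b) ^+ 3) (K * ck ^+ 3 * s ^+ 3) => *; lra.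
pose T1 := K * kap ^+ 3 * (3 * d a b ^+ 2 + 3 * d a b + 1).
pose T2 := 2 * d a b + 1.
have T10 : 0 <= T1 by rewrite !mulr_ge0 ?exprn_ge0 ?(ltW kap0)// !addr_ge0// !mulr_ge0// exprn_ge0.
have T20 : 0 <= T2 by rewrite addr_ge0// mulr_ge0.
apply: (@le_eps _ _ _ (2^-1 * (T1 * `|h| + K / lam * `|h| * (T2 + T1)) + 2 * n%:R * `|h|)).
  have Y0 : 0 <= K / lam * `|h| * (T2 + T1) := (mulr_ge0 (mulr_ge0 kl (normr_ge0 h)) (addr_ge0 T20 T10)).
  have Y1 : 0 <= T1 * `|h| := mulr_ge0 T10 (normr_ge0 h).
  have i2 : 0 <= (2^-1 : R) by rewrite invr_ge0.
  exact: (addr_ge0 (mulr_ge0 i2 (addr_ge0 Y1 Y0)) (mulr_ge0 (mulr_ge0 (ler0n R 2) n0) (normr_ge0 h))).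
move=> eta eta0; have [e [p [q [[e1 _ _ H3] ep [ee pP qQ]]]]] := PQ' eta eta0.
have [ub ub3] := unit_bound dab0 (ltW ep) e1.
have ub' : (d a b + e) ^+ 2 <= d a b ^+ 2 + T2 * eta.
  by apply: (le_trans ub); rewrite lerD2l ler_wpM2l.
have ub3' : K * (kap * (d a b + e)) ^+ 3 <= K * (kap * d a b) ^+ 3 + T1 * eta.
  have -> : K * (kap * d a b) ^+ 3 + T1 * eta = K * kap ^+ 3 * (d a b ^+ 3 + (3 * d a b ^+ 2 + 3 * d a b + 1) * eta) by rewrite /T1; ring.
  have -> : K * (kap * (d a b + e)) ^+ 3 = K * kap ^+ 3 * (d a b + e) ^+ 3 by ring.
  rewrite ler_wpM2l ?mulr_ge0 ?exprn_ge0 ?(ltW kap0)//; apply: (le_trans ub3).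
  by rewrite lerD2l ler_wpM2l// !addr_ge0// !mulr_ge0// exprn_ge0.
have -> : dotr (P + Q) h - 2^-1 * g = (dotr (p + q) h - 2^-1 * g) - ((dotr p h - dotr P h) + (dotr q h - dotr Q h)).
  by rewrite !dotrDl; ring.
apply: (le_trans (ler_normB _ _)).
have := lerD (H3 h) (le_trans (ler_normD _ _) (lerD (dd _ _ h _ pP) (dd _ _ h _ qQ))).
move/le_trans; apply.
have : K * (kap * (d a b + e)) ^+ 3 * `|h| <= (K * (kap * d a b) ^+ 3 + T1 * eta) * `|h| by rewrite ler_wpM2r.
have : K / lam * `|h| * ((d a b + e) ^+ 2 + K * (kap * (d a b + e)) ^+ 3 - gv) <=
   K / lam * `|h| * ((d a b ^+ 2 + T2 * eta) + (K * (kap * d a b) ^+ 3 + T1 * eta) - gv).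
  by apply: ler_wpM2l; [exact: mulr_ge0 kl (normr_ge0 h)|rewrite lerD2r; exact: lerD].
move: (K * (kap * (d a b + e)) ^+ 3) (K * (kap * d a b) ^+ 3) ((d a b + e) ^+ 2) (d a b ^+ 2) => X1 X2 X3 X4.
rewrite -/gv; set Y1 := K / lam * `|h|; clear gvs dc3 T10 T20 ub' ub3'; move: (gv) Y1 T1 T2 (`|h|) (n%:R : R).
by move=> *; lra.
Qed.

End LocalDistance.

Lemma subr_continuous {R : realType} {V : normedModType R} (x0 a : V) :
  {for a, continuous (fun b : V => b - x0)}.
Proof. by rewrite /continuous_at; apply: cvgB; [exact: cvg_id|exact: cvg_cst]. Qed.

Lemma closed_ball_compact {R : realType} {n : nat} (x0 : 'rV[R]_n) (r : R) :
  compact [set a : 'rV[R]_n | `|a - x0| <= r].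
Proof.
apply: bounded_closed_compact.
  exists (r + `|x0|); split; first by rewrite num_real.
  move=> e re a /= ar; apply: ltW; apply: le_lt_trans re.
  by rewrite -[a in `|a|](subrK x0); apply: (le_trans (ler_normD _ _)); rewrite lerD2r.
have -> : [set a : 'rV[R]_n | `|a - x0| <= r] = (fun a => `|a - x0|) @^-1` [set x | x <= r] by [].
apply: preimage_closed; last exact: closed_le.
move=> a _; exact: (cvg_norm (@subr_continuous _ 'rV[R]_n x0 a)).
Qed.

(** * Short curves stay in a chart *)

Section Stay.
Context {R : realType} {n : nat} {M : topologicalType}.
Context {A : smooth_atlas R n M} (g : riemannian_metric A).
Hypothesis hM : hausdorff_space M.
Variables (i : chart_index A) (D : 'rV[R]_n -> 'rV[R]_n -> 'M[R]_n).
Variables (x0 : 'rV[R]_n) (r lam K : R).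
Hypothesis box : metric_box (metric g i) D x0 r lam K.
Hypothesis ball_img : forall a, `|a - x0| < r -> (chart i @` chart_dom i) a.

Let kap := (Num.sqrt lam)^-1.

(** The image of a compact coordinate ball is compact, hence closed in a Hausdorff space: a curve
    cannot leave the chart from inside the ball. *)
Lemma chart_closed_ball (s : R) : s < r ->
  closed [set x | chart_dom i x /\ `|chart i x - x0| <= s].
Proof.
move=> sr; apply: (compact_closed hM).
have -> : [set x | chart_dom i x /\ `|chart i x - x0| <= s] =
    chart_inv i @` [set a | `|a - x0| <= s].
  apply/seteqP; split => [x [ix xs]|x [a /= as_ <-]]; first by exists (chart i x) => //; rewrite chartK.
  by have [] := chart_imgP (ball_img (le_lt_trans as_ sr)) => H ->.
apply: continuous_compact; last exact: closed_ball_compact.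
apply: continuous_in_subspaceT => a; rewrite inE/= => as_.
exact/chart_inv_continuous_at/ball_img/(le_lt_trans as_).
Qed.

Lemma chart_open_ball (s : R) x : chart_dom i x -> `|chart i x - x0| < s ->
  \forall y \near x, chart_dom i y /\ `|chart i y - x0| < s.
Proof.
move=> ix xs; apply: filterI.
  by apply: open_nbhs_nbhs; split => //; exact: chart_dom_open.
have : nbhs (chart i x) (fun a : 'rV[R]_n => `|a - x0| < s).
  by apply: (@near_norm_lt _ _ _ (fun a : 'rV[R]_n => a - x0)) => //; exact: subr_continuous.
exact: (chart_continuous_at ix).
Qed.

(** Consider the first exit time. Before it the speed bound confines the curve to the ball of radius
    [s1 < s], which is closed in [M]; so the curve is still inside at the exit time, and then also
    shortly after. *)
Lemma curve_stay w (l s : R) a : C1_curve A w -> w 0 = chart_inv i a ->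
  (forall t, 0 <= t <= 1 -> speed g w t <= l) -> `|a - x0| + kap * l < s -> s <= r ->
  forall t, 0 <= t <= 1 -> chart_dom i (w t) /\ `|chart i (w t) - x0| < s.
Proof.
move=> wC w0 wl als sr; set s1 := `|a - x0| + kap * l in als.
have kap0 : 0 < kap by rewrite invr_gt0 sqrtr_gt0 (mb_lam box).
have l0 : 0 <= l by apply: le_trans (wl 0 _); [exact: speed_ge0|rewrite lexx ler01].
have s1r := lt_le_trans als sr.
have ar : `|a - x0| < r by apply: le_lt_trans s1r; rewrite lerDl mulr_ge0// ltW.
have [ia ca] := chart_imgP (ball_img ar).
pose V x := chart_dom i x /\ `|chart i x - x0| < s.
have V0 : V (w 0).
  by rewrite /V w0 ca; split => //; apply: le_lt_trans als; rewrite lerDl mulr_ge0// ltW.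
have step t : 0 <= t <= 1 -> (forall u, 0 <= u <= t -> V (w u)) -> `|chart i (w t) - x0| <= s1.
  move=> /andP[t0 t1] Vt.
  have := @curve_lipschitz R n (chart i \o w) (kap * l) t t0.
  rewrite /comp w0 ca => /(_ _)/wrap[].
    move=> u /andP[u0 ut]; have u01 : 0 <= u <= 1 by rewrite u0 (le_trans ut).
    have [iu ur] := Vt u (introT andP (conj u0 ut)).
    have [wc /(_ i iu) wd] := wC u u01; split; first exact: wd.
    apply: (coord_speed box l0 (lt_le_trans ur sr)).
    have := wl u u01; rewrite (speedE g wc iu (nbhs_singleton wd.1)) /chart_speed => H.
    rewrite -(ler_pXn2r (n := 2)) ?nnegrE ?sqrtr_ge0// in H.
    by rewrite sqr_sqrtr// in H; apply: (le_trans _ (mb_low box _ (lt_le_trans ur sr)));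
       rewrite mulr_ge0 ?exprn_ge0// ltW// (mb_lam box).
  move=> H; have -> : chart i (w t) - x0 = (chart i (w t) - a) + (a - x0) by rewrite addrA subrK.
  apply: (le_trans (ler_normD _ _)); rewrite addrC lerD2l; apply: (le_trans H).
  by rewrite ler_piMr// mulr_ge0// ltW.
apply: contrapT => /existsNP[t1 /not_implyP[t101 nV1]].
pose B := [set t | 0 <= t <= 1 /\ ~ V (w t)].
have Binf : has_inf B by split; [exists t1|exists 0 => t [/andP[]]].
have lbB u : B u -> inf B <= u by exact: (ge_inf Binf.2).
set b := inf B in lbB.
have b01 : 0 <= b <= 1.
  rewrite lb_le_inf ?(le_trans (lbB t1 _))//; first by case/andP: t101.
  by exact: Binf.1.
  by move=> u [/andP[]].
have ltb u : 0 <= u -> u < b -> V (w u).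
  move=> u0 ub; apply: contrapT => nVu; have : B u by split => //; rewrite u0 (le_trans (ltW ub))//; case/andP: b01.
  by move=> /lbB; rewrite leNgt ub.
have wcb : {for b, continuous w} by have [] := wC b b01.
have nVb : ~ V (w b).
  move=> [ib rb]; have /wcb /nbhs_ballP[e e0 He] := chart_open_ball ib rb.
  have [u Bu ue] := inf_adherent e0 Binf; case: (Bu) => _; apply.
  have bu : ball b e u.
    rewrite -ball_normE/= ltr_norml; have := lbB u Bu; move: ue; rewrite -/b; move: (b) (e) (u).
    by move=> b' e' u' *; apply/andP; split; lra.
  exact: He bu.
have b0 : 0 < b.
  by have /andP[+ _] := b01; rewrite le_eqVlt => /predU1P[b0|//]; exfalso; apply: nVb; rewrite -b0.
apply: nVb; have Fb : [set x | chart_dom i x /\ `|chart i x - x0| <= s1] (w b).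
  apply: (chart_closed_ball s1r) => U /wcb /nbhs_ballP[e e0 He].
  pose u := Order.max 0 (b - e / 2).
  have e20 : 0 < e / 2 by rewrite divr_gt0.
  have u0 : 0 <= u by rewrite le_max lexx.
  have ub : u < b by rewrite gt_max b0/=; lra.
  exists (w u); split; last first.
    have bu : ball b e u.
      have ub2 : b - e / 2 <= u by rewrite le_max lexx orbT.
      rewrite -ball_normE/= ltr_norml; move: ub ub2 e20; move: (u) (e / 2) (splitr e) => u' e' ->.
      by move=> *; apply/andP; split; lra.
    exact: He bu.
  split; first by case: (ltb u u0 ub).
  apply: step; first by rewrite u0 (le_trans (ltW ub))//; case/andP: b01.
  by move=> v /andP[v0 vu]; apply: ltb => //; exact: le_lt_trans ub.
by case: Fb => ib rb; split => //; exact: le_lt_trans als.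
Qed.

End Stay.

Lemma metric_box_sub {R : realType} {n : nat} (G : 'rV[R]_n -> 'M[R]_n) D x0 (r r' lam K : R) :
  metric_box G D x0 r lam K -> 0 < r' -> r' <= r -> metric_box G D x0 r' lam K.
Proof.
move=> box r'0 r'r; have sub a : `|a - x0| < r' -> `|a - x0| < r by move=> /lt_le_trans; apply.
split=> //.
- exact: mb_lam box.
- exact: mb_K box.
- by move=> a v /sub; exact: mb_low box _ _.
- by move=> a u v /sub; exact: mb_sym box _ _ _.
- by move=> a u v /sub; exact: mb_up box _ _ _.
- by move=> a b u v /sub ar /sub; exact: mb_lip box _ _ _ _ ar.
- by move=> a c h k /sub; exact: mb_dlin box _ _ _ _.
- by move=> a h u v /sub; exact: mb_dup box _ _ _ _.
- by move=> a b h u v /sub ar /sub; exact: mb_dlip box _ _ _ _ _ ar.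
- by move=> a b u v /sub ar /sub; exact: mb_taylor box _ _ _ _ ar.
Qed.

Section GeodesicBox.
Context {R : realType} {n : nat} {M : topologicalType}.
Context {A : smooth_atlas R n M} (g : riemannian_metric A).
Hypothesis hM : hausdorff_space M.
Hypothesis reach : forall x y, curve_lengths g x y !=set0.
Implicit Types (i : chart_index A) (a b h k : 'rV[R]_n) (x y z : M).

(* In [gb_est], [- p] and [q] approximate the initial and final momenta of a minimal geodesic
   from [a] to [b]. *)
Record geodesic_box i D (x0 : 'rV[R]_n) (r lam K C L : R) : Prop := GeodesicBox {
  gb_box : metric_box (metric g i) D x0 r lam K;
  gb_img : forall a, `|a - x0| < r -> (chart i @` chart_dom i) a;
  gb_C : 0 <= C;
  gb_L : 0 < L;
  gb_est : forall a b, `|a - x0| < r -> `|b - x0| < r -> exists p q : 'rV[R]_n, [/\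
    forall h k, `|a + h - x0| < r -> `|b + k - x0| < r ->
      rdist g (chart_inv i (a + h)) (chart_inv i (b + k)) ^+ 2 / 2 <=
      rdist g (chart_inv i a) (chart_inv i b) ^+ 2 / 2 + dotr p h + dotr q k +
         C * (`|h| + `|k|) ^+ 2,
    forall h, `|dotr p h + bilin (metric g i a) (b - a) h| <= C * `|b - a| ^+ 2 * `|h| &
    forall h, `|dotr (p + q) h - 2^-1 * bilin (D a h) (b - a) (b - a)| <=
      C * `|b - a| ^+ 3 * `|h|];
  gb_low : forall a b, `|a - x0| < r -> `|b - x0| < r ->
    `|b - a| <= L * rdist g (chart_inv i a) (chart_inv i b);
  gb_up : forall a b, `|a - x0| < r -> `|b - x0| < r ->
    rdist g (chart_inv i a) (chart_inv i b) <= L * `|b - a|;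
  gb_stay : forall a y, `|a - x0| + L * rdist g (chart_inv i a) y < r ->
    chart_dom i y /\ `|chart i y - x0| < r
}.

Lemma geodesic_box_exists (p0 : M) : exists i D r lam K C L,
  chart_dom i p0 /\ geodesic_box i D (chart i p0) r lam K C L.
Proof.
set i := chart_at A p0; have ip0 : chart_dom i p0 by exact: chart_at_dom.
set x0 := chart i p0; pose G := metric g i; pose U := chart i @` chart_dom i.
have [r [lam [K [box rU]]]] : exists r lam K, metric_box G (fun a h => 'D_h G a) x0 r lam K /\
    forall a, `|a - x0| < r -> U a.
  apply: metric_box_exists.
  - exact: chart_image_open.
  - exact: metric_smooth.
  - by exists p0.
  - by move=> _ [p ip <-]; rewrite /G (Defs.metric_sym g ip).
  - by move=> v v0; exact: (metric_pos g ip0 v0).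
set D := (fun a h => 'D_h G a) in box.
pose d a b := rdist g (chart_inv i a) (chart_inv i b).
have d0 a b : 0 <= d a b by exact: rdist_ge0.
have oU : open U by exact: chart_image_open.
have Gs : smooth_on U G by exact: metric_smooth.
have Gcont a : `|a - x0| < r -> {for a, continuous G}.
  by move=> /rU Ua; have [+ _] := Gs 0%N; apply; exact: mem_set.
have Dcont a h : `|a - x0| < r -> {for a, continuous (fun b => D b h)}.
  by move=> /rU Ua; have [_ /(_ h)[_ [+ _]]] := Gs 1%N; apply; exact: mem_set.
have d_energy c : (forall t, 0 <= t <= 1 -> `|c t - x0| < r /\ C1_at c t) ->
    d (c 0) (c 1) ^+ 2 <= unit_int (fun t => bilin (G (c t)) (derive1 c t) (derive1 c t)).
  by move=> cP; apply: rdist_energy => t /cP[/rU].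
pose kap := (Num.sqrt lam)^-1; pose kap2 := Num.sqrt (K * (1 + 2 * r)).
have r0 := mb_r box.
have kap0 : 0 < kap by rewrite invr_gt0 sqrtr_gt0 (mb_lam box).
have kap20 : 0 <= kap2 by exact: sqrtr_ge0.
have kk0 : 0 <= kap * kap2 by rewrite mulr_ge0// ltW.
have kk1 : 0 < 8 * (1 + kap * kap2) by rewrite mulr_gt0// ltr_pwDl.
(* With excess below [r / (8 * kap)], an almost minimal curve between points of the ball of radius
   [r1] moves by less than [2 * kap * kap2 * r1 + r / 8] in coordinates, so it stays within [r / 2]
   of [x0]; the displacements, below [2 * r1], still fit into the ball of radius [r]. *)
pose r1 := r / (8 * (1 + kap * kap2)).
have r1E : r1 * (1 + kap * kap2) = r / 8.
  by rewrite /r1 invfM mulrA mulfVK// gt_eqF// ltr_pwDl.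
have r10 : 0 < r1 by rewrite divr_gt0.
have kkr : 0 <= kap * kap2 * r1 by rewrite mulr_ge0// ltW.
have e00 : 0 < r / (8 * kap) by rewrite divr_gt0// mulr_gt0.
have keE : kap * (r / (8 * kap)) = r / 8 by field; rewrite gt_eqF.
have r1E' : r1 + kap * kap2 * r1 = r / 8 by rewrite -r1E; ring.
have r1r : r1 <= r by lra.
have r2r : r / 2 + 2 * r1 <= r by lra.
have r20 : 0 < r / 2 by rewrite divr_gt0.
have upper a b : `|a - x0| < r1 -> `|b - x0| < r1 -> d a b <= kap2 * `|b - a|.
  by move=> ar br; apply: (d_upper2 box Gcont d0 d_energy); exact: lt_le_trans r1r.
have d_curve a b : `|a - x0| < r1 -> `|b - x0| < r1 -> forall e, 0 < e < r / (8 * kap) ->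
    exists c : R -> 'rV[R]_n, [/\ c 0 = a, c 1 = b &
   forall t, 0 <= t <= 1 -> [/\ `|c t - x0| < r / 2, C1_at c t &
     bilin (G (c t)) (derive1 c t) (derive1 c t) <= (d a b + e) ^+ 2]].
  move=> ar br e /andP[ep ee].
  have ar' := lt_le_trans ar r1r; have br' := lt_le_trans br r1r.
  have [ia ca] := chart_imgP (rU _ ar'); have [ib cb] := chart_imgP (rU _ br').
  have [w [wC w0 w1 wl]] := rdist_joins (reach (chart_inv i a) (chart_inv i b)) ep.
  have ab2 : `|b - a| <= 2 * r1.
    have -> : b - a = (b - x0) - (a - x0) by rewrite opprB addrA subrK.
    by apply: (le_trans (ler_normB _ _)); lra.
  have le0 : 0 <= d a b + e by rewrite addr_ge0// ltW.
  have b1 : `|a - x0| + kap * (d a b + e) < r / 2.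
    have : kap * d a b <= kap * kap2 * (2 * r1).
      by rewrite -mulrA ler_pM2l//; apply: (le_trans (upper _ _ ar br)); rewrite ler_wpM2l.
    have : kap * e <= r / 8 by rewrite -keE ler_pM2l// ltW.
    rewrite mulrDr; move: r1E' ar kkr r0 r10; rewrite (_ : kap * kap2 * (2 * r1) = 2 * (kap * kap2 * r1)); last by ring.
    by move: (kap * e) (kap * d a b) (kap * kap2 * r1) (`|a - x0|) => *; lra.
  have rr : r / 2 <= r by lra.
  have st := curve_stay hM box rU wC w0 wl b1 rr.
  exists (chart i \o w); split; rewrite /comp ?w0 ?w1//.
  move=> t t01; have [it tr] := st t t01; have [wc /(_ i it) wd] := wC t t01.
  split => //.
  have := wl t t01; rewrite (speedE g wc it (nbhs_singleton wd.1)) /chart_speed => H.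
  rewrite -(ler_pXn2r (n := 2)) ?nnegrE ?sqrtr_ge0// in H.
  rewrite sqr_sqrtr// in H; apply: le_trans (mb_low box _ (lt_le_trans tr rr)).
  by rewrite mulr_ge0 ?exprn_ge0// ltW// (mb_lam box).
have [C [C0 CP]] := local_estimate box Gcont Dcont d0 r10 e00 r2r r20 d_energy d_curve.
have k2k : kap2 <= kap + kap2 by rewrite lerDr ltW.
have kk2 : kap <= kap + kap2 by rewrite lerDl.
exists i, D, r1, lam, K, C, (kap + kap2); split => //; split => //.
- exact: metric_box_sub box r10 r1r.
- by move=> a ar; apply: rU; exact: lt_le_trans r1r.
- by rewrite ltr_wpDr.
- move=> a b ar br; have := d_lower box d0 r10 e00 r2r d_curve ar br.
  by move/le_trans; apply; rewrite ler_wpM2r.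
- by move=> a b ar br; apply: (le_trans (upper _ _ ar br)); rewrite ler_wpM2r.
move=> a y ayr.
have ay0 : 0 <= rdist g (chart_inv i a) y by exact: rdist_ge0.
have ar : `|a - x0| < r1 by apply: le_lt_trans ayr; rewrite lerDl mulr_ge0// addr_ge0// ltW.
pose e := (r1 - (`|a - x0| + kap * rdist g (chart_inv i a) y)) / (2 * kap).
have H : 0 < r1 - (`|a - x0| + kap * rdist g (chart_inv i a) y).
  by rewrite subr_gt0; apply: le_lt_trans ayr; rewrite lerD2l ler_wpM2r.
have ep : 0 < e by rewrite divr_gt0// mulr_gt0.
have [w [wC w0 w1 wl]] := rdist_joins (reach (chart_inv i a) y) ep.
have b1 : `|a - x0| + kap * (rdist g (chart_inv i a) y + e) < r1.
  have : kap * e = (r1 - (`|a - x0| + kap * rdist g (chart_inv i a) y)) / 2.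
    by rewrite /e; field; rewrite gt_eqF.
  rewrite mulrDr; move: H; move: (kap * rdist _ _ _) (kap * e) (`|a - x0|) => *; lra.
have := curve_stay hM box rU wC w0 wl b1 r1r (t := 1); rewrite w1; apply.
by rewrite ler01 lexx.
Qed.

End GeodesicBox.

(** * Topology and geodesics *)

Section MetricTopology.
Context {R : realType} {n : nat} {M : topologicalType}.
Context {A : smooth_atlas R n M} (g : riemannian_metric A).
Hypothesis hM : hausdorff_space M.
Hypothesis cM : compact [set: M].
Hypothesis reach : forall x y, curve_lengths g x y !=set0.
Implicit Types (i : chart_index A) (a b h k : 'rV[R]_n) (x y z : M).

Local Notation d := (rdist g).
Let dsym := rdist_sym reach.
Let dtri := rdist_triangle reach.

(** Together with [near_rdist] this says that the distance induces the given topology. *)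
Lemma rdist_nbhs x (U : set M) : nbhs x U -> exists2 e, 0 < e & forall y, d x y < e -> U y.
Proof.
have [i [D [r [lam [K [C [L [ix gb]]]]]]]] := geodesic_box_exists hM reach x.
have r0 := mb_r (gb_box gb); have L0 := gb_L gb.
rewrite -{1}(chartK ix) => xU.
have ia : (chart i @` chart_dom i) (chart i x) by exists x.
have /nbhs_ballP[s s0 sU] := chart_inv_continuous_at ia xU.
pose m := Order.min r s; have m0 : 0 < m by rewrite lt_min r0.
exists (m / L); first by rewrite divr_gt0.
move=> y; rewrite ltr_pdivlMr// mulrC => ym.
have [] := gb_stay gb (a := chart i x) (y := y).
  by rewrite chartK// subrr normr0 add0r; apply: (lt_le_trans ym); rewrite ge_min lexx.
move=> iy yr; rewrite -(chartK iy); apply: sU.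
rewrite -ball_normE/= distrC; have := gb_low gb (a := chart i x) (b := chart i y).
rewrite subrr normr0 !chartK// => /(_ r0 yr) /le_lt_trans; apply.
by apply: (lt_le_trans ym); rewrite ge_min lexx orbT.
Qed.

Lemma near_rdist x (e : R) : 0 < e -> \forall y \near x, d x y < e.
Proof.
move=> e0; have [i [D [r [lam [K [C [L [ix gb]]]]]]]] := geodesic_box_exists hM reach x.
have r0 := mb_r (gb_box gb); have L0 := gb_L gb.
pose m := Order.min r (e / L).
have m0 : 0 < m by rewrite lt_min r0 divr_gt0.
have xm : `|chart i x - chart i x| < m by rewrite subrr normr0.
apply: filterS (chart_open_ball (s := m) ix xm) => y [iy yx].
have := gb_up gb (a := chart i x) (b := chart i y).
rewrite subrr normr0 !chartK// => /(_ r0 _)/wrap[]; first by apply: (lt_le_trans yx); rewrite ge_min lexx.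
move=> /le_lt_trans; apply; rewrite mulrC -ltr_pdivlMr//.
by apply: (lt_le_trans yx); rewrite ge_min lexx orbT.
Qed.

Lemma rdist_eq0 x y : d x y <= 0 -> x = y.
Proof.
move=> xy; apply: hM => U V /rdist_nbhs[e e0 xU] yV; exists y; split; last exact: nbhs_singleton.
by apply: xU; exact: le_lt_trans e0.
Qed.

Lemma rdist_continuous2 : continuous (fun p : M * M => d p.1 p.2).
Proof.
move=> [x y]; apply/cvgrPdist_lt => e e0 /=.
have e2 : 0 < e / 2 by rewrite divr_gt0.
exists ([set x' | d x x' < e / 2], [set y' | d y y' < e / 2]) => /=.
  by split; exact: near_rdist.
move=> [x' y'] /= [xx yy]; rewrite ltr_norml.
have := dtri x x' y; have := dtri x' y' y; have := dtri x' x y'; have := dtri x y y'.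
rewrite (dsym y' y) (dsym x' x).
move: xx yy; rewrite [e in - e]splitr [e in _ && (_ < e)]splitr.
move: (e / 2) (d x x') (d y y') (d x y) (d x' y') (d x' y) (d x y') => *.
by apply/andP; split; lra.
Qed.

Lemma rdist_continuousr x : continuous (d x).
Proof.
move=> y; apply: (@continuous_comp _ _ _ (fun y => (x, y)) (fun p : M * M => d p.1 p.2)).
  by apply: cvg_pair; [exact: cvg_cst|exact: cvg_id].
exact: rdist_continuous2.
Qed.

Lemma rdist_bounded : exists2 B, 0 < B & forall x y, d x y <= B.
Proof.
have [[p _]|M0] := pselect ([set: M] !=set0); last first.
  by exists 1 => // x; exfalso; apply: M0; exists x.
have [q _ qP] : exists2 q, [set: M] q & forall y, [set: M] y -> - d p q <= - d p y.
  have [||q qT qP] := @compact_EVT_min _ R (fun y => - d p y) [set: M] _ cM.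
  - by exists p.
  - by apply: continuous_subspaceT => x; apply: cvgN; exact: rdist_continuousr.
  by exists q => // y _; apply: qP; rewrite inE.
exists (2 * d p q + 1); first by rewrite ltr_wpDl// mulr_ge0// rdist_ge0.
move=> x y; have := dtri x p y; rewrite (dsym x p).
have := qP x I; have := qP y I.
by move: (d p q) (d p x) (d p y) (d x y) => *; lra.
Qed.

(** The larger of the two excesses is continuous in [z], and points of almost minimal curves make it
    arbitrarily small; on a compact space its minimum is therefore at most 0. *)
Lemma geodesic_point x y (t : R) : 0 <= t <= 1 ->
  exists2 z, d x z <= t * d x y & d z y <= (1 - t) * d x y.
Proof.
move=> t01; pose f z := Order.max (d x z - t * d x y) (d z y - (1 - t) * d x y).
have fc : continuous f.
  move=> z; apply: (@continuous_max _ _ (fun z => d x z - t * d x y) (fun z => d z y - (1 - t) * d x y)).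
    by apply: cvgB; [exact: rdist_continuousr|exact: cvg_cst].
  apply: cvgB; last exact: cvg_cst.
  have -> : (fun z => d z y) = d y by apply/funext => u; exact: dsym.
  by rewrite (dsym z y); exact: rdist_continuousr.
have [z _ zP] := compact_EVT_min (ex_intro _ x I) cM (continuous_subspaceT fc).
suff : f z <= 0 by rewrite /f ge_max !subr_le0 => /andP[? ?]; exists z.
apply/ler_addgt0Pr => e e0; rewrite add0r.
have [w [wC w0 w1 wl]] := rdist_joins (reach x y) e0.
apply: (le_trans (zP (w t) (mem_set I))); rewrite /f ge_max.
have dxy : 0 <= d x y by exact: rdist_ge0.
have /andP[t0 t1] := t01.
have le0 : 0 <= d x y + e by rewrite addr_ge0// ltW.
have H1 : d x (w t) <= t * (d x y + e).
  rewrite -{1}w0; apply: joins_rdist.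
  have := @joins_sub _ _ _ _ g w (d x y + e) t 0 wC wl; rewrite addr0 (ger0_norm t0); apply.
  by move=> s /andP[s0 s1]; rewrite addr0 mulr_ge0//= mulr_ile1.
have H2 : d (w t) y <= (1 - t) * (d x y + e).
  rewrite -{1}w1; apply: joins_rdist.
  have t1' : 0 <= 1 - t by rewrite subr_ge0.
  have := @joins_sub _ _ _ _ g w (d x y + e) (1 - t) t wC wl; rewrite subrK (ger0_norm t1'); apply.
  move=> s /andP[s0 s1]; rewrite addr_ge0 ?mulr_ge0//=.
  have : (1 - t) * s <= 1 - t by rewrite ler_piMr.
  by move=> *; lra.
have te : t * e <= e by rewrite ler_piMl// ltW.
have te' : (1 - t) * e <= e by rewrite ler_piMl ?(ltW e0)// gerBl.
by move: H1 H2; rewrite !mulrDr => H1 H2; apply/andP; split; lra.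
Qed.

End MetricTopology.

(** * Stability of the Euler scheme *)

Section DiscreteGeodesics.
Context {R : realType} {n : nat}.
Variables (G : 'rV[R]_n -> 'M[R]_n) (D : 'rV[R]_n -> 'rV[R]_n -> 'M[R]_n).
Variables (x0 : 'rV[R]_n) (r lam K : R).
Hypothesis box : metric_box G D x0 r lam K.
Variables B C : R.
Hypothesis (B0 : 0 <= B) (C0 : 0 <= C).
Implicit Types (a pi : nat -> 'rV[R]_n) (h : 'rV[R]_n) (N k : nat).

(* One Euler step, with time step [1 / N], of the cogeodesic flow; [pi] is the momentum. *)
Definition euler_step N a pi k := let V := N%:R *: (a k.+1 - a k) in
  [/\ `|a k - x0| < r, `|V| <= B,
    forall h, `|dotr (pi k) h - bilin (G (a k)) V h| <= C / N%:R * `|h| &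
    forall h, `|dotr (pi k.+1 - pi k) h - (2 * N%:R)^-1 * bilin (D (a k) h) V V| <=
      C / N%:R ^+ 2 * `|h|].

Let K0 : 0 < K := mb_K box.
Let lam0 : 0 < lam := mb_lam box.
(** [L1] multiplies the previous gap and [L2] collects the consistency errors. The division by [lam]
    stems from recovering velocities from momenta, and [n] from the bound of [dotr] in the sup
    norm. *)
Let L1 := (1 + K * B) * (n%:R + K * B) / lam + K * B ^+ 2.
Let L2 := (1 + K * B) * (2 * C) / lam + 2 * C.
Let L := L1 + L2.

Let KB0 : 0 <= K * B. Proof. by rewrite mulr_ge0// ltW. Qed.
Let L10 : 0 <= L1.
Proof.
have n0 : 0 <= n%:R :> R by [].
apply: addr_ge0; last by rewrite mulr_ge0 ?exprn_ge0// ltW.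
by rewrite mulr_ge0 ?invr_ge0 ?(ltW lam0)// mulr_ge0 ?addr_ge0.
Qed.
Let L20 : 0 <= L2.
Proof.
have C20 : 0 <= 2 * C by rewrite mulr_ge0.
apply: addr_ge0 => //; by rewrite mulr_ge0 ?invr_ge0 ?(ltW lam0)// mulr_ge0 ?addr_ge0.
Qed.

(** Stability of one step without inverting the metric: the velocity difference [W] is tested
    against itself, and coercivity bounds it by the gaps of position and momentum. *)
Lemma euler_step_dist N a pi a' pi' k : (0 < N)%N -> euler_step N a pi k -> euler_step N a' pi' k ->
  `|a k.+1 - a' k.+1| + `|pi k.+1 - pi' k.+1| <=
  (1 + L / N%:R) * (`|a k - a' k| + `|pi k - pi' k|) + L / N%:R ^+ 2.
Proof.
move=> N0; rewrite /euler_step; set V := N%:R *: _; set V' := N%:R *: (a' _ - _).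
move=> [ar VB Vp pp] [ar' VB' Vp' pp'].
have Nr0 : 0 < N%:R :> R by rewrite ltr0n.
set e := `|a k - a' k|; set f := `|pi k - pi' k|; pose W := V - V'; pose v := `|W|.
have e0 : 0 <= e := normr_ge0 _; have f0 : 0 <= f := normr_ge0 _; have v0 : 0 <= v := normr_ge0 _.
have n0 : 0 <= n%:R :> R by [].
have CN0 : 0 <= C / N%:R by rewrite divr_ge0.
have vle : lam * v <= 2 * (C / N%:R) + n%:R * f + K * B * e.
  have [v00|vN0] := eqVneq v 0.
    by rewrite v00 mulr0 !addr_ge0// mulr_ge0.
  have vp : 0 < v by rewrite lt_def vN0.
  rewrite -(ler_pM2r vp) (_ : lam * v * v = lam * v ^+ 2); last by rewrite expr2 mulrA.
  apply: (le_trans (mb_low box W ar)).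
  have -> : bilin (G (a k)) W W = - (dotr (pi k) W - bilin (G (a k)) V W) +
     dotr (pi k - pi' k) W + (dotr (pi' k) W - bilin (G (a' k)) V' W) -
     bilin (G (a k) - G (a' k)) V' W.
    by rewrite {1}/W bilinDl bilinNl dotrDl dotrNl bilinDm bilinNm; ring.
  have := Vp W; rewrite ler_norml => /andP[H1 _].
  have := Vp' W; rewrite ler_norml => /andP[_ H2].
  have := dotr_norm (pi k - pi' k) W; rewrite ler_norml -/f -/v => /andP[_ H3].
  have := mb_lip box V' W ar ar'; rewrite ler_norml -/e -/v => /andP[H4 _].
  have H5 : K * e * `|V'| * v <= K * B * e * v.
    have -> : K * B * e * v = K * e * B * v by ring.
    by rewrite ler_wpM2r// ler_wpM2l// mulr_ge0// ltW.
  move: H1 H2 H3 H4 H5; rewrite -/v; 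
  move: (dotr (pi k) W - bilin (G (a k)) V W) (dotr (pi' k) W - bilin (G (a' k)) V' W) => X1 X2.
  move: (dotr (pi k - pi' k) W) (bilin (G (a k) - G (a' k)) V' W) (K * e * `|V'| * v) => X3 X4 X5.
  rewrite (_ : (2 * (C / N%:R) + n%:R * f + K * B * e) * v = C / N%:R * v + C / N%:R * v + n%:R * f * v + K * B * e * v); last by ring.
  by move: (C / N%:R * v) (n%:R * f * v) (K * B * e * v) => *; lra.
have step1 : `|a k.+1 - a' k.+1| <= e + v / N%:R.
  have -> : a k.+1 - a' k.+1 = (a k - a' k) + N%:R^-1 *: W.
    rewrite /W /V /V' scalerBr !scalerA mulVf ?gt_eqF// !scale1r.
    by apply/rowP => j; rewrite !mxE; ring.
  apply: (le_trans (ler_normD _ _)); rewrite lerD2l normrZ ger0_norm ?invr_ge0 ?ler0n//.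
  by rewrite mulrC.
have step2 : `|pi k.+1 - pi' k.+1| <= f + (2 * (C / N%:R ^+ 2) + (2 * N%:R)^-1 * (K * e * B ^+ 2 + 2 * (K * B) * v)).
  have -> : pi k.+1 - pi' k.+1 = (pi k - pi' k) + ((pi k.+1 - pi k) - (pi' k.+1 - pi' k)).
    by apply/rowP => j; rewrite !mxE; ring.
  have CN2 : 0 <= C / N%:R ^+ 2 by rewrite divr_ge0// exprn_ge0.
  have N20 : 0 <= (2 * N%:R)^-1 :> R by rewrite invr_ge0 mulr_ge0.
  have Q0 : 0 <= K * e * B ^+ 2 + 2 * (K * B) * v.
    by rewrite addr_ge0// ?mulr_ge0 ?exprn_ge0// ltW.
  apply: (le_trans (ler_normD _ _)); rewrite lerD2l; apply: rV_norm_le => [|j].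
    by rewrite addr_ge0// mulr_ge0.
  rewrite -dotr_delta; set h := delta_mx 0 j.
  have h1 : `|h| <= 1.
    by apply: rV_norm_le => // l; rewrite !mxE; case: (_ && _); rewrite ?normr1 ?normr0.
  have hb (x : R) : 0 <= x -> x * `|h| <= x by move=> x0'; rewrite ler_piMr.
  rewrite dotrDl dotrNl.
  have -> : dotr (pi k.+1 - pi k) h - dotr (pi' k.+1 - pi' k) h =
     (dotr (pi k.+1 - pi k) h - (2 * N%:R)^-1 * bilin (D (a k) h) V V) -
     (dotr (pi' k.+1 - pi' k) h - (2 * N%:R)^-1 * bilin (D (a' k) h) V' V') +
     (2 * N%:R)^-1 * (bilin (D (a k) h - D (a' k) h) V V + (bilin (D (a' k) h) W V + bilin (D (a' k) h) V' W)).
    rewrite /W bilinDm bilinNm !bilinDl !bilinDr !bilinNl !bilinNr.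
    by move: (dotr _ _) (dotr _ _) (_^-1) (bilin _ _ _) (bilin _ _ _) (bilin _ _ _) (bilin _ _ _) => *; ring.
  apply: (le_trans (ler_normD _ _)); apply: lerD.
    apply: (le_trans (ler_normB _ _)); rewrite (_ : 2 * (C / N%:R ^+ 2) = C / N%:R ^+ 2 + C / N%:R ^+ 2); last by ring.
    by apply: lerD; [apply: (le_trans (pp h))|apply: (le_trans (pp' h))]; exact: hb.
  rewrite normrM ger0_norm// ler_wpM2l//; apply: (le_trans (ler_normD _ _)); apply: lerD.
    apply: (le_trans (mb_dlip box h V V ar ar')); rewrite -/e.
    have -> : K * e * `|h| * `|V| * `|V| = (K * e * (`|V| * `|V|)) * `|h| by ring.
    apply: (le_trans (hb _ _)); first by rewrite !mulr_ge0// ltW.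
    by rewrite expr2 ler_wpM2l ?mulr_ge0 ?(ltW K0)// ler_pM.
  apply: (le_trans (ler_normD _ _)).
  have -> : 2 * (K * B) * v = K * v * B + K * B * v by ring.
  apply: lerD.
    apply: (le_trans (mb_dup box h W V ar')); rewrite -/v.
    have -> : K * `|h| * v * `|V| = K * v * `|V| * `|h| by ring.
    apply: (le_trans (hb _ _)); first by rewrite !mulr_ge0// ltW.
    by rewrite ler_wpM2l// mulr_ge0// ltW.
  apply: (le_trans (mb_dup box h V' W ar')); rewrite -/v.
  have -> : K * `|h| * `|V'| * v = K * `|V'| * v * `|h| by ring.
  apply: (le_trans (hb _ _)); first by rewrite !mulr_ge0// ltW.
  by rewrite ler_wpM2r// ler_wpM2l// ltW.
apply: (le_trans (lerD step1 step2)).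
have vle' : v <= (2 * (C / N%:R) + (n%:R + K * B) * (e + f)) / lam.
  rewrite ler_pdivlMr// mulrC; apply: (le_trans vle); rewrite -addrA lerD2l.
  have -> : (n%:R + K * B) * (e + f) = n%:R * f + K * B * e + (n%:R * e + K * B * f) by ring.
  by rewrite lerDl addr_ge0// mulr_ge0.
have S0 : 0 <= e + f by rewrite addr_ge0.
have -> : (1 + L / N%:R) * (e + f) + L / N%:R ^+ 2 = e + f + N%:R^-1 * (L * (e + f) + L / N%:R).
  by field; rewrite gt_eqF.
have -> : e + v / N%:R + (f + (2 * (C / N%:R ^+ 2) + (2 * N%:R)^-1 * (K * e * B ^+ 2 + 2 * (K * B) * v))) =
  e + f + N%:R^-1 * ((1 + K * B) * v + K * B ^+ 2 / 2 * e + 2 * C / N%:R).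
  by field; rewrite gt_eqF.
rewrite lerD2l ler_pM2l ?invr_gt0//.
have KBB : 0 <= K * B ^+ 2 by rewrite mulr_ge0 ?exprn_ge0// ltW.
have H1 : (1 + K * B) * v <= (1 + K * B) * ((2 * (C / N%:R) + (n%:R + K * B) * (e + f)) / lam).
  by rewrite ler_wpM2l// addr_ge0.
have H2 : K * B ^+ 2 / 2 * e <= K * B ^+ 2 * (e + f).
  have : K * B ^+ 2 * e <= K * B ^+ 2 * (e + f) by rewrite ler_wpM2l// lerDl.
  have : 0 <= K * B ^+ 2 * e by rewrite mulr_ge0.
  by rewrite mulrAC; move: (K * B ^+ 2 * e) (K * B ^+ 2 * (e + f)) => *; lra.
apply: (le_trans (lerD (lerD H1 H2) (lexx _))).
have -> : (1 + K * B) * ((2 * (C / N%:R) + (n%:R + K * B) * (e + f)) / lam) + K * B ^+ 2 * (e + f) + 2 * C / N%:R =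
   L1 * (e + f) + L2 / N%:R.
  by rewrite /L1 /L2; field; rewrite !gt_eqF.
by apply: lerD; [rewrite ler_wpM2r// lerDl|rewrite ler_pM2r ?invr_gt0// lerDr].
Qed.

(** A discrete Gronwall argument: the gap after [k] steps is at most [((1 + L / N)^k - 1) / N], and
    [(1 + L / N)^N <= exp L]. *)
Lemma euler_unique N a pi a' pi' : (0 < N)%N ->
  (forall k, (k < N)%N -> euler_step N a pi k /\ euler_step N a' pi' k) ->
  a 0%N = a' 0%N -> pi 0%N = pi' 0%N -> `|a N - a' N| <= expR L / N%:R.
Proof.
move=> N0 H a0 p0; have Nr0 : 0 < N%:R :> R by rewrite ltr0n.
have L0 : 0 <= L by exact: addr_ge0.
have Sk k : (k <= N)%N -> `|a k - a' k| + `|pi k - pi' k| <= ((1 + L / N%:R) ^+ k - 1) / N%:R.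
  elim: k => [_|k IH kN]; first by rewrite a0 p0 !subrr !normr0 addr0 mul0r.
  have [s1 s2] := H k kN; apply: (le_trans (euler_step_dist N0 s1 s2)).
  apply: (@le_trans _ _ ((1 + L / N%:R) * (((1 + L / N%:R) ^+ k - 1) / N%:R) + L / N%:R ^+ 2)).
    rewrite lerD2r ler_wpM2l ?IH ?(ltnW kN)// addr_ge0// divr_ge0//.
  rewrite le_eqVlt; apply/orP; left; apply/eqP; rewrite [in RHS]exprS.
  by move: ((1 + L / N%:R) ^+ k) => X; field; rewrite gt_eqF.
apply: (@le_trans _ _ (`|a N - a' N| + `|pi N - pi' N|)); first by rewrite lerDl.
apply: (le_trans (Sk N (leqnn N))).
rewrite ler_pM2r ?invr_gt0//.
have : (1 + L / N%:R) ^+ N <= expR L.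
  have -> : expR L = expR (L / N%:R) ^+ N by rewrite -expRM_natl [_ * (L / _)]mulrC divfK// gt_eqF.
  rewrite lerXn2r// ?nnegrE ?expR_ge0//; first by rewrite addr_ge0// divr_ge0.
  exact: expR_ge1Dx.
by move=> *; lra.
Qed.

End DiscreteGeodesics.

Lemma dotr0 {R : realType} {n : nat} (p : 'rV[R]_n) : dotr p 0 = 0.
Proof. by rewrite -(scale0r (0 : 'rV[R]_n)) dotrZr mul0r. Qed.

(** * The twist condition *)

Section Superdifferential.
Context {R : realType} {n : nat} {M : topologicalType}.
Context {A : smooth_atlas R n M}.
Implicit Types (i : chart_index A) (a b h k p q : 'rV[R]_n) (x y z : M) (f : M -> R).

(** A proximal superdifferential in the chart [i]: the remainder is quadratic, as in the expansion
    of the squared distance. *)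
Definition superdiff i f x p := exists C : R, exists2 dlt, 0 < dlt &
  forall h, `|h| < dlt -> f (chart_inv i (chart i x + h)) <= f x + dotr p h + C * `|h| ^+ 2.

Lemma superdiff_le i f f' x p : (forall w, f w <= f' w) -> f' x <= f x ->
  superdiff i f' x p -> superdiff i f x p.
Proof.
move=> ff fx [C [dlt d0 H]]; exists C, dlt => // h hd.
by apply: (le_trans (ff _)); apply: (le_trans (H h hd)); rewrite !lerD2r.
Qed.

Lemma superdiff_affine i f x p (c e : R) : 0 <= c -> superdiff i f x p ->
  superdiff i (fun w => c * f w + e) x (c *: p).
Proof.
move=> c0 [C [dlt d0 H]]; exists (c * C), dlt => // h hd.
rewrite dotrZl; have := ler_wpM2l c0 (H h hd).
by rewrite !mulrDr mulrA; move: (c * f _) (c * f _) (c * dotr _ _) (c * C * _) => *; lra.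
Qed.

Lemma superdiffD i f f' x p p' : superdiff i f x p -> superdiff i f' x p' ->
  superdiff i (fun w => f w + f' w) x (p + p').
Proof.
move=> [C [e e0 H]] [C' [e' e'0 H']]; exists (C + C'), (Order.min e e'); first by rewrite lt_min e0.
move=> h; rewrite lt_min => /andP[he he']; rewrite dotrDl mulrDl.
have := H h he; have := H' h he'.
by move: (C * _) (C' * _) (dotr _ _) (dotr _ _) (f _) (f _) (f' _) (f' _) => *; lra.
Qed.

Lemma superdiff_cst i (c : R) x : superdiff i (fun=> c) x 0.
Proof.
by exists 0, 1 => // h _; rewrite mul0r addr0 dotrC dotr0 addr0.
Qed.

Lemma superdiff_sum i (I : finType) (P : pred I) (F : I -> M -> R) (p : I -> 'rV[R]_n) x :
  (forall j, P j -> superdiff i (F j) x (p j)) ->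
  superdiff i (fun w => \sum_(j | P j) F j w) x (\sum_(j | P j) p j).
Proof.
move=> H; rewrite -[index_enum I]/(index_enum I); elim: (index_enum I) => [|j s IH].
  have -> : (fun w => \sum_(j <- [::] | P j) F j w) = fun=> 0.
    by apply/funext => w; rewrite big_nil.
  by rewrite big_nil; exact: superdiff_cst.
rewrite big_cons.
have -> : (fun w => \sum_(j <- j :: s | P j) F j w) =
    (fun w => (if P j then F j w else 0) + \sum_(j <- s | P j) F j w).
  by apply/funext => w; rewrite big_cons; case: ifP => // _; rewrite add0r.
case: ifP => [/H|] Pj; first exact: superdiffD.
by rewrite -[\sum_(j <- s | P j) p j]add0r; apply: superdiffD => //; exact: superdiff_cst.
Qed.

Lemma superdiff_min i f x p : (forall w, f x <= f w) -> superdiff i f x p -> p = 0.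
Proof.
move=> fmin [C [dlt d0 H]].
have pp : dotr p p <= 0.
  have [->|p0] := eqVneq p 0; first by rewrite dotr0.
  have np : 0 < `|p| by rewrite normr_gt0.
  apply: (@le_eps _ _ _ (`|C| * `|p| ^+ 2)); first by rewrite mulr_ge0 ?exprn_ge0.
  move=> eta eta0; pose t := Order.min eta (dlt / (2 * `|p|)).
  have t0 : 0 < t by rewrite lt_min eta0 divr_gt0// mulr_gt0.
  have te : t <= eta by rewrite ge_min lexx.
  have := H (- t *: p); rewrite normrZ normrN (gtr0_norm t0) dotrZr => /(_ _)/wrap[].
    apply: (@le_lt_trans _ _ (dlt / (2 * `|p|) * `|p|)).
      by rewrite ler_wpM2r// ge_min lexx orbT.
    have -> : dlt / (2 * `|p|) * `|p| = dlt / 2 by field; rewrite gt_eqF.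
    by rewrite ltr_pdivrMr// ltr_pMr// ltr1n.
  move=> H'; have := le_trans (fmin _) H'; rewrite -addrA lerDl exprMn.
  have H3 : C * (t ^+ 2 * `|p| ^+ 2) <= t * (eta * (`|C| * `|p| ^+ 2)).
    apply: (@le_trans _ _ (`|C| * (t ^+ 2 * `|p| ^+ 2))).
      by rewrite ler_wpM2r ?ler_norm// mulr_ge0 ?exprn_ge0// ltW.
    have -> : `|C| * (t ^+ 2 * `|p| ^+ 2) = t * (t * (`|C| * `|p| ^+ 2)) by ring.
    by rewrite ler_pM2l// ler_wpM2r// mulr_ge0 ?exprn_ge0.
  move=> H4; have : 0 <= t * (- dotr p p + eta * (`|C| * `|p| ^+ 2)).
    rewrite mulrDr mulrN; move: H3 H4; rewrite mulNr.
    by move: (t * dotr p p) (C * _) (t * (eta * _)) => *; lra.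
  by rewrite pmulr_rge0// add0r addrC subr_ge0 mulrC.
apply/rowP => j; rewrite mxE; apply/eqP; rewrite -sqrf_eq0 eq_le sqr_ge0 andbT.
apply: le_trans pp; rewrite /dotr expr2.
by apply: (@ler_term _ _ (fun j => p 0 j * p 0 j)) => k; rewrite -expr2 sqr_ge0.
Qed.

End Superdifferential.

(** A midpoint minimizes the sum of the half squared distances to the two ends. This is why
    successive momenta along a divided geodesic match. *)
Lemma midpoint_ineq {R : realType} (u v t e e1 e2 : R) : 0 <= u -> 0 <= v -> u <= e -> v <= e ->
  2 * e <= t -> t <= e1 + e2 -> u ^+ 2 / 2 + v ^+ 2 / 2 <= e1 ^+ 2 / 2 + e2 ^+ 2 / 2.
Proof.
move=> u0 v0 ue ve et te; have e0 : 0 <= e by exact: le_trans ue.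
have : e ^+ 2 <= ((e1 + e2) / 2) ^+ 2 by rewrite ler_pXn2r ?nnegrE//; lra.
have : u ^+ 2 <= e ^+ 2 by rewrite ler_pXn2r ?nnegrE.
have : v ^+ 2 <= e ^+ 2 by rewrite ler_pXn2r ?nnegrE.
have := sqr_ge0 (e1 - e2).
have -> : ((e1 + e2) / 2) ^+ 2 = e1 ^+ 2 / 4 + e2 ^+ 2 / 4 + e1 * e2 / 2 by field.
have -> : (e1 - e2) ^+ 2 = e1 ^+ 2 + e2 ^+ 2 - 2 * (e1 * e2) by ring.
by move: (e1 * e2) (e1 ^+ 2) (e2 ^+ 2) (u ^+ 2) (v ^+ 2) (e ^+ 2) => *; lra.
Qed.

(** * The local twist condition *)

Section Twist.
Context {R : realType} {n : nat} {M : topologicalType}.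
Context {A : smooth_atlas R n M} (g : riemannian_metric A).
Hypothesis hM : hausdorff_space M.
Hypothesis cM : compact [set: M].
Hypothesis reach : forall x y, curve_lengths g x y !=set0.
Implicit Types (i : chart_index A) (a b h p q : 'rV[R]_n) (x y z : M) (f : M -> R).

Local Notation d := (rdist g).
Let dsym := rdist_sym reach.
Let dtri := rdist_triangle reach.

Definition hsq y x : R := d x y ^+ 2 / 2.

Lemma hsq_sym x y : hsq x y = hsq y x. Proof. by rewrite /hsq dsym. Qed.

(* The inequality (a + b)^2 <= a^2 / t + b^2 / (1 - t), for the triangle inequality through z. *)
Lemma hsq_weighted x y z (t : R) : 0 < t < 1 ->
  hsq y x <= t^-1 * hsq z x + (1 - t)^-1 * hsq y z.
Proof.
move=> /andP[t0 t1]; rewrite /hsq.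
have a0 := rdist_ge0 g x z; have b0 := rdist_ge0 g z y; have c0 := rdist_ge0 g x y.
have := dtri x z y; move: (d x z) (d z y) (d x y) a0 b0 c0 => a b c a0 b0 c0 cab.
have t1' : 0 < 1 - t by rewrite subr_gt0.
have -> : t^-1 * (a ^+ 2 / 2) + (1 - t)^-1 * (b ^+ 2 / 2) =
   ((a + b) ^+ 2 + ((1 - t) * a - t * b) ^+ 2 / (t * (1 - t))) / 2.
  by field; rewrite !gt_eqF.
rewrite ler_pM2r ?invr_gt0//; apply: (@le_trans _ _ ((a + b) ^+ 2)).
  by rewrite ler_pXn2r// nnegrE addr_ge0.
by rewrite lerDl divr_ge0 ?sqr_ge0// ltW// mulr_gt0.
Qed.

(** The equality case of [hsq_weighted], reached at points that divide a geodesic in the ratio of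
    [t] to [1 - t]. *)
Lemma hsq_geodesic x y z (t : R) : 0 < t < 1 ->
  d x z <= t * d x y -> d z y <= (1 - t) * d x y ->
  t^-1 * hsq z x + (1 - t)^-1 * hsq y z <= hsq y x.
Proof.
move=> /andP[t0 t1]; rewrite /hsq.
have a0 := rdist_ge0 g x z; have b0 := rdist_ge0 g z y; have c0 := rdist_ge0 g x y.
move: (d x z) (d z y) (d x y) a0 b0 c0 => a b c a0 b0 c0 ac bc.
have t1' : 0 < 1 - t by rewrite subr_gt0.
have H1 : a ^+ 2 <= (t * c) ^+ 2 by rewrite ler_pXn2r// nnegrE// mulr_ge0// ltW.
have H2 : b ^+ 2 <= ((1 - t) * c) ^+ 2 by rewrite ler_pXn2r// nnegrE// mulr_ge0// ltW.
have -> : c ^+ 2 / 2 = t^-1 * ((t * c) ^+ 2 / 2) + (1 - t)^-1 * (((1 - t) * c) ^+ 2 / 2).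
  by field; rewrite !gt_eqF.
by apply: lerD; rewrite ler_wpM2l ?invr_ge0 ?(ltW t0) ?(ltW t1')// ler_wpM2r.
Qed.

(** By [hsq_weighted] and its equality case, [t^-1 * hsq z] plus a constant touches [hsq y] from
    above at [x]. *)
Lemma superdiff_geodesic i x y z (t : R) q : 0 < t <= 1 ->
  d x z <= t * d x y -> d z y <= (1 - t) * d x y ->
  superdiff i (hsq z) x q -> superdiff i (hsq y) x (t^-1 *: q).
Proof.
move=> /andP[t0]; rewrite le_eqVlt => /predU1P[->|t1] xz zy H.
  by rewrite invr1 scale1r; move: zy H; rewrite subrr mul0r => /(rdist_eq0 hM reach) ->.
have t01 : 0 < t < 1 by rewrite t0.
apply: superdiff_le (superdiff_affine ((1 - t)^-1 * hsq y z) _ H).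
- by move=> w; exact: hsq_weighted.
- exact: hsq_geodesic.
- by rewrite invr_ge0 ltW.
Qed.

Lemma geodesic_chain (N : nat) x z : exists c : nat -> M, [/\ c 0%N = x, c N.+1 = z &
  forall k, (k <= N)%N -> d (c k) (c k.+1) <= d x z / N.+1%:R].
Proof.
elim: N x => [|N IH] x.
  exists (fun k => if k is 0%N then x else z); split => // k.
  by rewrite leqn0 => /eqP ->; rewrite divr1.
have N20 : 0 < N.+2%:R :> R by rewrite ltr0n.
have N10 : 0 < N.+1%:R :> R by rewrite ltr0n.
have [|w xw wz] := @geodesic_point _ _ _ _ g hM cM reach x z N.+2%:R^-1.
  by rewrite invr_ge0 ltW//= invf_le1// ler1n.
have [c [c0 c1 cP]] := IH w.
exists (fun k => if k is k'.+1 then c k' else x); split => // -[_|k kN].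
  by rewrite c0 mulrC.
apply: (le_trans (cP k kN)); rewrite ler_pdivrMr//; apply: (le_trans wz).
rewrite le_eqVlt; apply/orP; left; apply/eqP.
rewrite -[N.+2%:R]natr1; move: N10; move: (N.+1%:R : R) (d x z) => u v u0.
by field; rewrite gt_eqF// addr_gt0.
Qed.

Section Box.
Variables (i : chart_index A) (D : 'rV[R]_n -> 'rV[R]_n -> 'M[R]_n).
Variables (x0 : 'rV[R]_n) (r lam K C L : R).
Hypothesis gb : geodesic_box g i D x0 r lam K C L.

Let C0 : 0 <= C := gb_C gb.
Let L0 : 0 < L := gb_L gb.

Lemma box_chartK a : `|a - x0| < r -> chart_dom i (chart_inv i a) /\ chart i (chart_inv i a) = a.
Proof. by move=> /(gb_img gb)/chart_imgP. Qed.

Lemma box_semiconcave a b : `|a - x0| < r -> `|b - x0| < r -> exists p, forall h, `|a + h - x0| < r ->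
  hsq (chart_inv i b) (chart_inv i (a + h)) <=
  hsq (chart_inv i b) (chart_inv i a) + dotr p h + C * `|h| ^+ 2.
Proof.
move=> ar br; have [p [q [H _ _]]] := gb_est gb ar br; exists p => h ahr.
have := H h 0; rewrite addr0 normr0 addr0 => /(_ ahr br).
by rewrite dotr0 addr0.
Qed.

Lemma near_box a : `|a - x0| < r -> exists2 dlt, 0 < dlt & forall h, `|h| < dlt -> `|a + h - x0| < r.
Proof.
move=> ar; exists (r - `|a - x0|); first by rewrite subr_gt0.
move=> h; rewrite ltrBrDl addrAC => H; apply: le_lt_trans H; exact: ler_normD.
Qed.

(** The expansions along the equal parts of a geodesic, rescaled by [N], are Euler steps. The first
    covector, multiplied by [N], is a superdifferential of [hsq z] at the start, hence equals [p]:
    the initial data depend on [a] and [p] only. *)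
Lemma twist_chain (B : R) : 0 <= B -> forall a z p (N : nat), (1 < N)%N ->
  `|a - x0| + B < r -> L * d (chart_inv i a) z <= B ->
  (forall q, superdiff i (hsq z) (chart_inv i a) q -> q = p) ->
  exists al pi : nat -> 'rV[R]_n, [/\ al 0%N = a, pi 0%N = - p, al N = chart i z,
    chart_dom i z &
    forall k, (k < N)%N ->
     euler_step (metric g i) D x0 r B (C * (B ^+ 2 + B ^+ 3)) N al pi k].
Proof.
move=> B0 a z p [//|N] N1 aB zB pP; set x := chart_inv i a.
have ar : `|a - x0| < r by apply: le_lt_trans aB; rewrite lerDl.
have [ix ca] := box_chartK ar.
have [c [c0 cN cP]] := geodesic_chain N x z.
have N0 : 0 < N.+1%:R :> R by rewrite ltr0n.
set l := d x z in zB cP; have l0 : 0 <= l by exact: rdist_ge0.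
have cx k : (k <= N.+1)%N -> d x (c k) <= k%:R * (l / N.+1%:R).
  elim: k => [_|k IH kN]; first by rewrite c0 rdistxx mul0r.
  apply: (le_trans (dtri _ (c k) _)); rewrite -natr1 mulrDl mul1r lerD ?IH ?(ltnW kN)//.
  exact: cP.
have cz k : (k <= N.+1)%N -> d (c (N.+1 - k)%N) z <= k%:R * (l / N.+1%:R).
  elim: k => [_|k IH kN]; first by rewrite subn0 cN rdistxx mul0r.
  apply: (le_trans (dtri _ (c (N.+1 - k)%N) _)).
  rewrite -natr1 mulrDl mul1r addrC lerD ?IH ?(ltnW kN)//.
  have -> : (N.+1 - k)%N = (N.+1 - k.+1).+1 by rewrite subnS prednK// subn_gt0.
  by apply: cP; rewrite subSS leq_subr.
have lN0 : 0 <= l / N.+1%:R by rewrite divr_ge0// ltW.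
have cxl k : (k <= N.+1)%N -> d x (c k) <= l.
  move=> kN; apply: (le_trans (cx k kN)); rewrite mulrCA ler_piMr// ler_pdivrMr// mul1r ler_nat//.
have cB k : (k <= N.+1)%N -> chart_dom i (c k) /\ `|chart i (c k) - x0| < r.
  move=> kN; apply: (gb_stay gb (a := a)); apply: le_lt_trans aB; rewrite lerD2l.
  by apply: le_trans zB; rewrite ler_pM2l// cxl.
pose al k := chart i (c k).
have alK k : (k <= N.+1)%N -> chart_inv i (al k) = c k by move=> /cB[ic _]; exact: chartK.
have alr k : (k <= N.+1)%N -> `|al k - x0| < r by move=> /cB[].
have /choice[pq pqP] k : exists pq : 'rV[R]_n * 'rV[R]_n, (k < N.+1)%N -> [/\
    forall h k', `|al k + h - x0| < r -> `|al k.+1 + k' - x0| < r ->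
      d (chart_inv i (al k + h)) (chart_inv i (al k.+1 + k')) ^+ 2 / 2 <=
      d (chart_inv i (al k)) (chart_inv i (al k.+1)) ^+ 2 / 2 + dotr pq.1 h + dotr pq.2 k' +
         C * (`|h| + `|k'|) ^+ 2,
    forall h, `|dotr pq.1 h + bilin (metric g i (al k)) (al k.+1 - al k) h| <=
       C * `|al k.+1 - al k| ^+ 2 * `|h| &
    forall h, `|dotr (pq.1 + pq.2) h - 2^-1 * bilin (D (al k) h) (al k.+1 - al k) (al k.+1 - al k)| <=
      C * `|al k.+1 - al k| ^+ 3 * `|h|].
  have [kN|] := boolP (k < N.+1)%N; last by exists (0, 0).
  by have [p' [q' H]] := gb_est gb (alr k (ltnW kN)) (alr k.+1 kN); exists (p', q').
have sdp k : (k < N.+1)%N -> superdiff i (hsq (c k.+1)) (c k) (pq k).1.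
  move=> kN; have [H _ _] := pqP k kN; have [dlt d0 Hd] := near_box (alr k (ltnW kN)).
  exists C, dlt => // h /Hd hr; have := H h 0 hr; rewrite addr0 normr0 addr0 => /(_ (alr _ kN)).
  by rewrite dotr0 addr0 (alK _ (ltnW kN)) (alK _ kN).
have sdq k : (k < N.+1)%N -> superdiff i (hsq (c k)) (c k.+1) (pq k).2.
  move=> kN; have [H _ _] := pqP k kN; have [dlt d0 Hd] := near_box (alr k.+1 kN).
  exists C, dlt => // h /Hd hr; have := H 0 h; rewrite addr0 normr0 add0r => /(_ (alr _ (ltnW kN)) hr).
  rewrite dotr0 addr0 (alK _ (ltnW kN)) (alK _ kN).
  by rewrite /hsq (dsym (c k.+1) (c k)) (dsym _ (c k)).
(* The point [c k.+1] is a midpoint of its neighbours, so the covectors of the arriving and the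
   departing part add up to zero. *)
have pq0 k : (k.+1 < N.+1)%N -> (pq k).2 + (pq k.+1).1 = 0.
  move=> kN; have kN' := ltnW kN.
  apply: superdiff_min (superdiffD (sdq k kN') (sdp k.+1 kN)) => w.
  rewrite /hsq (dsym (c k.+1) (c k)).
  have H1 := cP k kN'; have H2 := cP k.+1 kN.
  have H3 : 2 * (l / N.+1%:R) <= d (c k) (c k.+2).
    have := cx k (ltnW kN'); have := cz (N.+1 - k.+2)%N (leq_subr _ _); rewrite subKn//.
    have := dtri x (c k) z; have := dtri (c k) (c k.+2) z; rewrite -/l.
    have : l = N.+1%:R * (l / N.+1%:R) by rewrite mulrC divfK// gt_eqF.
    rewrite natrB// -[k.+2%:R]natr1 -natr1 mulrBl.
    move: (l / N.+1%:R) (d (c k) z) (d _ _) (d _ _) (d _ _) => e e1 e2 e3 e4 *; lra.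
  have H4 := dtri (c k) w (c k.+2); rewrite (dsym (c k) w) in H4.
  exact: (midpoint_ineq (rdist_ge0 _ _ _) (rdist_ge0 _ _ _) H1 H2 H3 H4).
(* After index 0 the momentum is read off from the arriving part, since no part departs from the
   last point; [piE] gives the expression by the departing part at the other indices. *)
pose pi k := if k is k'.+1 then N.+1%:R *: (pq k').2 else - (N.+1%:R *: (pq 0%N).1).
have piE k : (k < N.+1)%N -> pi k = - (N.+1%:R *: (pq k).1).
  case: k => // k kN; rewrite /pi -scalerN; congr (_ *: _); apply/eqP.
  by rewrite -addr_eq0 pq0.
exists al, pi; split.
- by rewrite /al c0.
- rewrite /pi; congr (- _); apply: pP.
  have N10 : 0 < (N.+1%:R^-1 : R) <= 1 by rewrite invr_gt0 N0 invf_le1// ler1n.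
  have := @superdiff_geodesic i x z (c 1%N) N.+1%:R^-1 (pq 0%N).1 N10; rewrite invrK; apply.
  + by apply: (le_trans (cx 1%N _)) => //; rewrite mul1r mulrC.
  + have := cz N (leqnSn N); rewrite subSnn => H; apply: (le_trans H); rewrite -/l.
    rewrite le_eqVlt; apply/orP; left; apply/eqP; move: N0; rewrite -natr1.
    by move: (N%:R : R) => u u0; field; rewrite gt_eqF.
  + by have := sdp 0%N (ltn0Sn N); rewrite c0.
- by rewrite /al cN.
- by have [] := cB N.+1 (leqnn _); rewrite cN.
move=> k kN; have [_ H2 H3] := pqP k kN.
set De := al k.+1 - al k in H2 H3.
have DeB : `|De| <= B / N.+1%:R.
  have := gb_low gb (alr k (ltnW kN)) (alr k.+1 kN); rewrite !alK ?(ltnW kN)// -/De.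
  move/le_trans; apply; rewrite ler_pdivlMr// -mulrA; apply: le_trans zB.
  by rewrite ler_pM2l// -ler_pdivlMr//; exact: cP.
split.
- exact: alr (ltnW kN).
- by rewrite -/De normrZ ger0_norm ?ler0n// mulrC -ler_pdivlMr.
- move=> h; rewrite -/De piE// -scaleNr dotrZl bilinZl mulNr -opprD -mulrDr normrN normrM ger0_norm ?ler0n//.
  apply: (@le_trans _ _ (N.+1%:R * (C * (B / N.+1%:R) ^+ 2 * `|h|))).
    rewrite ler_pM2l//; apply: (le_trans (H2 h)); rewrite ler_wpM2r// ler_wpM2l//.
    by rewrite ler_pXn2r// nnegrE// divr_ge0// ltW.
  rewrite mulrA ler_wpM2r// (_ : N.+1%:R * _ = C * B ^+ 2 / N.+1%:R); last by field; rewrite gt_eqF.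
  by rewrite ler_pM2r ?invr_gt0// ler_wpM2l// lerDl exprn_ge0.
move=> h; rewrite -/De (piE k kN) opprK -scalerDr dotrZl bilinZl bilinZr [(pq k).2 + _]addrC.
rewrite (_ : _ * dotr _ h - _ = N.+1%:R * (dotr ((pq k).1 + (pq k).2) h - 2^-1 * bilin (D (al k) h) De De)); last first.
  by field; rewrite gt_eqF.
rewrite normrM ger0_norm ?ler0n//.
apply: (@le_trans _ _ (N.+1%:R * (C * (B / N.+1%:R) ^+ 3 * `|h|))).
  rewrite ler_pM2l//; apply: (le_trans (H3 h)); rewrite ler_wpM2r// ler_wpM2l//.
  by rewrite ler_pXn2r// nnegrE// divr_ge0// ltW.
rewrite mulrA ler_wpM2r// (_ : N.+1%:R * _ = C * B ^+ 3 / N.+1%:R ^+ 2); last by field; rewrite gt_eqF.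
by rewrite ler_pM2r ?invr_gt0 ?exprn_gt0// ler_wpM2l// lerDr exprn_ge0.
Qed.

(** The chains to [z] and [z'] follow the same scheme from the same initial data, so in the chart
    the endpoints differ by at most a constant over [N], for every [N > 1]. *)
Lemma local_twist (B : R) : 0 <= B -> forall a z z' p,
  `|a - x0| + B < r -> L * d (chart_inv i a) z <= B -> L * d (chart_inv i a) z' <= B ->
  (forall q, superdiff i (hsq z) (chart_inv i a) q -> q = p) ->
  (forall q, superdiff i (hsq z') (chart_inv i a) q -> q = p) -> z = z'.
Proof.
move=> B0 a z z' p aB zB zB' zp zp'.
have BC : 0 <= C * (B ^+ 2 + B ^+ 3) by rewrite mulr_ge0// addr_ge0// exprn_ge0.
(* Any number of parts shows that both endpoints lie in the chart domain; here it is 2. *)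
have [iz iz'] : chart_dom i z /\ chart_dom i z'.
  have [al [pi [_ _ _ iz _]]] := twist_chain B0 (ltnSn 1) aB zB zp.
  by have [al' [pi' [_ _ _ iz' _]]] := twist_chain B0 (ltnSn 1) aB zB' zp'.
suff E : chart i z = chart i z' by rewrite -(chartK iz) E chartK.
apply/eqP; rewrite -subr_eq0 -normr_le0.
have [E H] : exists E : R, 0 <= E /\ forall N : nat, (1 < N)%N -> `|chart i z - chart i z'| <= E / N%:R.
  eexists; split; last first.
    move=> N N1; have [al [pi [a0 p0 <- _ H]]] := twist_chain B0 N1 aB zB zp.
    have [al' [pi' [a0' p0' <- _ H']]] := twist_chain B0 N1 aB zB' zp'.
    apply: (euler_unique (gb_box gb) B0 BC (pi := pi) (pi' := pi')).
    - exact: ltnW.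
    - by move=> k kN; split; [exact: H|exact: H'].
    - by rewrite a0.
    - by rewrite p0.
  exact: expR_ge0.
case: H => E0 H; apply: (@le_eps _ _ _ E) => // eta eta0; rewrite add0r.
pose N := (Num.bound eta^-1).+2.
have N0 : 0 < N%:R :> R by rewrite ltr0n.
apply: (le_trans (H N isT)); rewrite ler_wpM2l// -[eta]invrK lef_pV2 ?posrE ?invr_gt0//.
have /archi_boundP : 0 <= eta^-1 by rewrite invr_ge0 ltW.
by move=> /ltW/le_trans; apply; rewrite ler_nat (leq_trans (leqnSn _)).
Qed.

End Box.
End Twist.

(** * From short to arbitrary distances *)

Section GlobalTwist.
Context {R : realType} {n : nat} {M : topologicalType}.
Context {A : smooth_atlas R n M} (g : riemannian_metric A).
Hypothesis hM : hausdorff_space M.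
Hypothesis cM : compact [set: M].
Hypothesis reach : forall x y, curve_lengths g x y !=set0.
Implicit Types (i : chart_index A) (a b h p q : 'rV[R]_n) (x y z : M).

Local Notation d := (rdist g).
Local Notation hsq := (hsq g).
Let dtri := rdist_triangle reach.

(** The premises say that [p] is the only possible superdifferential; existence is kept apart, in
    [twist_point]. *)
Definition twist i (s : R) x := forall z z' p, d x z <= s -> d x z' <= s ->
  (forall q, superdiff i (hsq z) x q -> q = p) ->
  (forall q, superdiff i (hsq z') x q -> q = p) -> z = z'.

Record good_chart i (x0 : 'rV[R]_n) (rho s C L : R) : Prop := GoodChart {
  gc_rho : 0 < rho;
  gc_s : 0 < s;
  gc_img : forall a, `|a - x0| < rho -> (chart i @` chart_dom i) a;
  gc_twist : forall a, `|a - x0| < rho -> twist i s (chart_inv i a);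
  gc_C : 0 <= C;
  gc_semiconcave : forall a y, `|a - x0| < rho -> exists p, forall h, `|a + h - x0| < rho ->
    hsq y (chart_inv i (a + h)) <= hsq y (chart_inv i a) + dotr p h + C * `|h| ^+ 2;
  gc_L : 0 < L;
  gc_lip : forall a b, `|a - x0| < rho -> `|b - x0| < rho ->
    d (chart_inv i a) (chart_inv i b) <= L * `|b - a|
}.

(** Semiconcavity of [hsq y] for distant [y] comes from a geodesic point [z] near [a], since
    [t^-1 * hsq z] plus a constant touches [hsq y] from above. The fraction [t] is fixed by the
    diameter, so the constant [t^-1 * C] is the same for all [y]. *)
Lemma good_chart_exists (p0 : M) : exists i rho s C L,
  chart_dom i p0 /\ good_chart i (chart i p0) rho s C L.
Proof.
have [i [D [r [lam [K [C [L [ip gb]]]]]]]] := geodesic_box_exists hM reach p0.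
have [Bd Bd0 BdP] := rdist_bounded hM cM reach.
set x0 := chart i p0 in gb.
have r0 := mb_r (gb_box gb); have L0 := gb_L gb; have C0 := gb_C gb.
have r20 : 0 < r / 2 by rewrite divr_gt0.
have r2r : r / 2 < r by rewrite ltr_pdivrMr// ltr_pMr// ltr1n.
have s0 : 0 < r / 2 / L by rewrite divr_gt0.
have half a : `|a - x0| < r / 2 -> `|a - x0| + r / 2 < r.
  by move: (`|a - x0|) => u *; lra.
pose N := (Num.bound (Bd / (r / 2 / L))).+2; pose t : R := N%:R^-1.
have N1 : 1 < N%:R :> R by rewrite ltr1n.
have N0 : 0 < N%:R :> R by rewrite ltr0n.
have t0 : 0 < t by rewrite invr_gt0.
have t1 : t < 1 by rewrite invf_lt1.
have t01 : 0 < t < 1 by rewrite t0.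
have tB : t * Bd <= r / 2 / L.
  rewrite mulrC ler_pdivrMr// mulrC -ler_pdivrMr//; apply: ltW.
  have /archi_boundP : 0 <= Bd / (r / 2 / L) by rewrite divr_ge0 ?ltW.
  by move=> /lt_le_trans; apply; rewrite ler_nat (leq_trans (leqnSn _)).
exists i, (r / 2), (r / 2 / L), (t^-1 * C), L; split => //; split => //.
- by move=> a ar; apply: (gb_img gb); exact: lt_trans r2r.
- move=> a ar z z' p zs zs' zp zp'.
  apply: (local_twist hM cM reach gb (ltW r20) (half a ar) _ _ zp zp').
    by rewrite mulrC -ler_pdivlMr.
  by rewrite mulrC -ler_pdivlMr.
- by rewrite mulr_ge0// invr_ge0 ltW.
- move=> a y ar; set x := chart_inv i a.
  have [|z xz zy] := @geodesic_point _ _ _ _ g hM cM reach x y t; first by rewrite (ltW t0) ltW.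
  have zB : L * d x z <= r / 2.
    rewrite mulrC -ler_pdivlMr//; apply: (le_trans xz); apply: le_trans tB.
    by rewrite ler_pM2l.
  have [iz zr] : chart_dom i z /\ `|chart i z - x0| < r.
    by apply: (gb_stay gb (a := a)); apply: le_lt_trans (half a ar); rewrite lerD2l.
  have [p pP] := box_semiconcave gb (lt_trans ar r2r) zr.
  exists (t^-1 *: p) => h hr; rewrite (chartK iz) in pP.
  apply: (le_trans (hsq_weighted reach _ y z t01)).
  have := hsq_geodesic t01 xz zy; have := pP h (lt_trans hr r2r).
  rewrite -/x dotrZl -mulrA => H1 H2.
  have ti : 0 <= t^-1 by rewrite invr_ge0 ltW.
  have := ler_wpM2l ti H1; rewrite !mulrDr; move: H2.
  move: (t^-1 * hsq z x) (t^-1 * hsq z (chart_inv i (a + h))) ((1 - t)^-1 * hsq y z) (hsq y x).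
  by move: (t^-1 * dotr p h) (t^-1 * (C * `|h| ^+ 2)) => *; lra.
by move=> a b ar br; apply: (gb_up gb); exact: lt_trans r2r.
Qed.

Lemma good_chart_superdiff i (x0 : 'rV[R]_n) rho s C L : good_chart i x0 rho s C L ->
  forall a y, `|a - x0| < rho -> exists p, superdiff i (hsq y) (chart_inv i a) p.
Proof.
move=> gc a y ar; have [p pP] := gc_semiconcave gc y ar.
exists p, C; exists (rho - `|a - x0|); first by rewrite subr_gt0.
have [ia ->] := chart_imgP (gc_img gc ar).
move=> h hr; apply: pP; have := ler_normD (a - x0) h.
by rewrite addrAC => /le_lt_trans; apply; move: hr; rewrite ltrBrDl.
Qed.

Definition twist_point (s : R) x i := [/\ chart_dom i x, twist i s x &
  forall y, exists p, superdiff i (hsq y) x p].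

Lemma uniform_twist : exists2 s, 0 < s & forall x, exists i, twist_point s x i.
Proof.
have H : \forall s \near (0 : R)^'+, [set: M] `<=` [set x | exists i, twist_point s x i].
  apply: (iffLR (compact_near_coveringP _) cM) => p0 _.
  have [i [rho [s [C [L [ip gc]]]]]] := good_chart_exists p0.
  exists ([set x | chart_dom i x /\ `|chart i x - chart i p0| < rho], [set s' | s' < s]) => /=.
    split; last by apply: nbhs_right_lt; exact: gc_s gc.
    by apply: chart_open_ball => //; rewrite subrr normr0 (gc_rho gc).
  move=> [x s'] /= [[ix xr] ss]; exists i; split => //.
    move=> z z' p zs zs'; have := gc_twist gc xr; rewrite chartK//; apply.
      exact: le_trans (ltW ss).
    exact: le_trans (ltW ss).
  by move=> y; have := good_chart_superdiff gc y xr; rewrite chartK.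
have [s [s0 sP]] := filter_ex (filterI (nbhs_right_gt (0 : R)) H).
by exists s => // x; exact: sP.
Qed.

(** Induction on the distance in units of [s]: a short first piece towards [y] and [y'] ends at a
    common point [z], where both again have a single superdifferential. *)
Lemma superdiff_determines_step (s : R) : 0 < s -> (forall x, exists i, twist_point s x i) ->
  forall (K : nat) x i y y' p, twist_point s x i -> d x y <= K.+1%:R * s -> d x y' <= K.+1%:R * s ->
  (forall q, superdiff i (hsq y) x q -> q = p) ->
  (forall q, superdiff i (hsq y') x q -> q = p) -> y = y'.
Proof.
move=> s0 uni; elim=> [|K IH] x i y y' p [ix tw sd] ys ys' yp yp'.
  by apply: (tw y y' p) => //; rewrite -[s]mul1r.
have K0 : 0 < K.+1%:R :> R by rewrite ltr0n.
have KE : K.+2%:R = K.+1%:R + 1 :> R by rewrite natr1.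
(* The first of [K + 2] equal parts has length at most [s], the rest at most [(K + 1) * s]. *)
pose t : R := K.+2%:R^-1.
have t0 : 0 < t by rewrite invr_gt0 ltr0n.
have t1 : t < 1 by rewrite invf_lt1 ?ltr1n ?ltr0n.
have t01 : 0 < t < 1 by rewrite t0.
have t01' : 0 <= t <= 1 by rewrite !ltW.
have t01'' : 0 < t <= 1 by rewrite t0 ltW.
have [z xz zy] := geodesic_point hM cM reach x y t01'.
have [z' xz' zy'] := geodesic_point hM cM reach x y' t01'.
have tK : t * (K.+2%:R * s) = s by rewrite mulrA mulVf ?mul1r// gt_eqF// ltr0n.
have tK' : (1 - t) * (K.+2%:R * s) = K.+1%:R * s by rewrite mulrBl tK KE; ring.
(* Multiplication by [t^-1] maps superdifferentials of [hsq v] to superdifferentials of [hsq w], so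
   uniqueness passes to the intermediate point. *)
have sdz w v : (forall q, superdiff i (hsq w) x q -> q = p) ->
    d x v <= t * d x w -> d v w <= (1 - t) * d x w ->
    forall q, superdiff i (hsq v) x q -> q = t *: p.
  move=> wp xv vw q /(superdiff_geodesic hM reach t01'' xv vw)/wp <-.
  by rewrite scalerA mulfV ?scale1r// gt_eqF.
have zz : z = z'.
  apply: (tw z z' (t *: p)).
  - by apply: (le_trans xz); rewrite -[leRHS]tK ler_pM2l.
  - by apply: (le_trans xz'); rewrite -[leRHS]tK ler_pM2l.
  - exact: sdz yp xz zy.
  - exact: sdz yp' xz' zy'.
rewrite -{}zz in xz' zy'.
have [j [jz twj sdj]] := uni z; have [u uP] := sdj x.
have t1' : 0 < 1 - t by rewrite subr_gt0.
(* Along a geodesic from [x] through [z] to [w], the weighted sum of [hsq x] and [hsq w] is minimal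
   at [z]. So one superdifferential [u] of [hsq x] determines every superdifferential of [hsq w] at
   [z]. *)
have foc w : d x z <= t * d x w -> d z w <= (1 - t) * d x w ->
    forall q, superdiff j (hsq w) z q -> q = - ((1 - t) / t) *: u.
  move=> xzw zw q qP.
  have H1 := superdiff_affine 0 (_ : 0 <= t^-1) uP.
  have H2 := superdiff_affine 0 (_ : 0 <= (1 - t)^-1) qP.
  have : t^-1 *: u + (1 - t)^-1 *: q = 0.
    apply: superdiff_min (superdiffD (H1 _) (H2 _)); rewrite ?invr_ge0 ?(ltW t0) ?(ltW t1')//.
    move=> v /=; rewrite !addr0 (hsq_sym reach x v) (hsq_sym reach x z).
    apply: le_trans (hsq_weighted reach x w v t01).
    by exact: hsq_geodesic t01 xzw zw.
  move/eqP; rewrite addrC addr_eq0 => /eqP E.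
  have : (1 - t) *: ((1 - t)^-1 *: q) = (1 - t) *: - (t^-1 *: u) by rewrite E.
  by rewrite scalerA mulfV ?gt_eqF// scale1r scalerN scalerA scaleNr => ->.
apply: (IH z j y y' (- ((1 - t) / t) *: u)); first by split.
- by apply: (le_trans zy); rewrite -tK' ler_pM2l.
- by apply: (le_trans zy'); rewrite -tK' ler_pM2l.
- exact: foc.
- exact: foc.
Qed.

Lemma superdiff_determines (s : R) : 0 < s -> (forall x, exists i, twist_point s x i) ->
  forall x i y y' p, twist_point s x i ->
  (forall q, superdiff i (hsq y) x q -> q = p) ->
  (forall q, superdiff i (hsq y') x q -> q = p) -> y = y'.
Proof.
move=> s0 uni x i y y' p xi; have [B B0 BP] := rdist_bounded hM cM reach.
have bnd z : d x z <= (Num.bound (B / s)).+1%:R * s.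
  apply: (le_trans (BP x z)); rewrite -ler_pdivrMr//; apply: ltW.
  have /archi_boundP : 0 <= B / s by rewrite divr_ge0 ?ltW.
  by move=> /lt_le_trans; apply; rewrite ler_nat.
by apply: (superdiff_determines_step s0 uni xi).
Qed.

End GlobalTwist.

(** * Kinks of semiconcave functions *)

Lemma lebesgue_null_seq {R : realType} {n : nat} (N : set 'rV[R]_n) :
  (forall e, 0 < e -> exists s : seq ('rV[R]_n * 'rV[R]_n), [/\
     forall ab j, ab \in s -> ab.1 0 j <= ab.2 0 j,
     forall x, N x -> exists2 ab, ab \in s & forall j, ab.1 0 j <= x 0 j <= ab.2 0 j
   & \sum_(ab <- s) \prod_j (ab.2 0 j - ab.1 0 j) <= e]) -> lebesgue_null N.
Proof.
move=> H e e0; have [s [sle sN se]] := H e e0.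
pose ab k := nth (0, 0) s k.
have able k j : (ab k).1 0 j <= (ab k).2 0 j.
  have [ks|ks] := ltnP k (size s); first by apply: sle; exact: mem_nth.
  by rewrite /ab nth_default// lexx.
exists [set` iota 0 (size s)], (fun k => (ab k).1), (fun k => (ab k).2); split => //.
  move=> x /sN[c cs cx]; exists (index c s) => /=.
    by rewrite mem_iota add0n index_mem.
  by move=> j; rewrite /ab nth_index.
rewrite esum_fset; last first.
- by move=> k _; rewrite lee_fin; apply: prodr_ge0 => j _; rewrite subr_ge0.
- exact: finite_seq.
rewrite -(fsbig_seq _ _ (iota_uniq _ _)) sumEFin lee_fin; apply: le_trans se.
by rewrite [leRHS](big_nth (0, 0)) /index_iota subn0.
Qed.

Lemma grid_index {R : realType} (al w u : R) (T : nat) : (0 < T)%N ->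
  al <= u <= al + T%:R * w -> exists i : 'I_T, al + i%:R * w <= u <= al + i.+1%:R * w.
Proof.
elim: T => // -[_ _ |T IH _ /andP[au ut]]; first by rewrite mul1r => H; exists ord0; rewrite mul0r addr0 mul1r.
have [tu|] := leP (al + T.+1%:R * w) u; first by exists ord_max; rewrite /= tu.
move=> /ltW tu; have [|i Hi] := IH isT _; first by rewrite au.
by exists (widen_ord (leqnSn _) i).
Qed.

(* Increments over a fixed length decrease for a concave function; this is the semiconcave version. *)
Lemma semiconcave_increment {R : realType} (phi : R -> R) (C al be x y h : R) :
  (forall u, al <= u <= be -> exists p, forall v, al <= v <= be ->
     phi v <= phi u + p * (v - u) + C * (v - u) ^+ 2) ->
  al <= y -> y <= x -> 0 < h -> x + h <= be ->
  phi (x + h) - phi x <= phi (y + h) - phi y + 2 * C * h * (x - y).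
Proof.
move=> H ay; rewrite le_eqVlt => /predU1P[->|yx] h0 xb; first by rewrite subrr mulr0 addr0.
have [|p pP] := H x _; first by apply/andP; split; lra.
have [|q qP] := H (y + h) _; first by apply/andP; split; lra.
pose d := x - y; have d0 : 0 < d by rewrite subr_gt0.
have xE : x = y + d by rewrite /d addrC subrK.
have P1 := pP y ltac:(apply/andP; split; lra); have P2 := pP (x + h) ltac:(apply/andP; split; lra).
have Q1 := qP y ltac:(apply/andP; split; lra); have Q2 := qP (x + h) ltac:(apply/andP; split; lra).
clear pP qP H; rewrite -/d; clearbody d; subst x.
have dh : 0 < d + h by rewrite addr_gt0.
move: P1 P2 Q1 Q2.
rewrite (_ : y - (y + d) = - d); last by ring.
rewrite (_ : y + d + h - (y + d) = h); last by ring.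
rewrite (_ : y + d + h - (y + h) = d); last by ring.
rewrite (_ : y - (y + h) = - h); last by ring.
move: (phi y) (phi (y + d)) (phi (y + h)) (phi (y + d + h)) => A B E F P1 P2 Q1 Q2.
have {}P : (h * A + d * F) / (d + h) <= B + C * (h * d).
  rewrite ler_pdivrMr//; have := lerD (ler_wpM2l (ltW h0) P1) (ler_wpM2l (ltW d0) P2).
  by have -> : (B + C * (h * d)) * (d + h) = h * (B + p * - d + C * (- d) ^+ 2) + d * (B + p * h + C * h ^+ 2) by ring.
have {}Q : (d * A + h * F) / (d + h) <= E + C * (h * d).
  rewrite ler_pdivrMr//; have := lerD (ler_wpM2l (ltW d0) Q1) (ler_wpM2l (ltW h0) Q2).
  by have -> : (E + C * (h * d)) * (d + h) = d * (E + q * - h + C * (- h) ^+ 2) + h * (E + q * d + C * d ^+ 2) by ring.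
have : (h * A + d * F) / (d + h) + (d * A + h * F) / (d + h) = A + F by field; rewrite gt_eqF.
have -> : 2 * C * h * d = C * (h * d) + C * (h * d) by ring.
by move: P Q; move: ((h * A + _) / _) ((d * A + _) / _) (C * (h * d)) => *; lra.
Qed.

Lemma telescope2 {R : realType} (inc : nat -> R) (Q : nat) :
  \sum_(i < Q) (inc i.+2 - inc i) = inc Q.+1 + inc Q - inc 1%N - inc 0%N.
Proof.
elim: Q => [|Q IH]; first by rewrite big_ord0; ring.
by rewrite big_ord_recr /= IH; ring.
Qed.

(* Every kink lowers the slope by a definite amount, and the slopes are bounded. *)
Lemma kink_count {R : realType} (phi : R -> R) (C L al h kap : R) (Q : nat) (P : pred 'I_Q) :
  0 <= C -> 0 < h -> 0 < kap ->
  (forall u, al <= u <= al + Q.+3%:R * h -> exists p, forall v, al <= v <= al + Q.+3%:R * h ->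
     phi v <= phi u + p * (v - u) + C * (v - u) ^+ 2) ->
  (forall u v, al <= u <= al + Q.+3%:R * h -> al <= v <= al + Q.+3%:R * h ->
     `|phi u - phi v| <= L * `|u - v|) ->
  (forall i, P i -> phi (al + i.+3%:R * h) - phi (al + i.+2%:R * h) -
     (phi (al + i.+1%:R * h) - phi (al + i%:R * h)) <= - (kap * h)) ->
  #|P|%:R * kap <= 4 * L + 4 * C * (Q%:R * h).
Proof.
move=> C0 h0 k0 sc lip bad.
pose s (k : nat) : R := al + k%:R * h; pose inc (k : nat) := phi (s k.+1) - phi (s k).
have sS k : s k.+1 = s k + h by rewrite /s -natr1; ring.
have sle k : (k <= Q.+3)%N -> al <= s k <= al + Q.+3%:R * h.
  by move=> kQ; rewrite lerDl mulr_ge0 ?(ltW h0)//= lerD2l ler_pM2r// ler_nat.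
have E1 (i : 'I_Q) : inc i.+2 - inc i <= 4 * C * h ^+ 2.
  have iQ : (i.+3 <= Q.+3)%N by rewrite !ltnS ltnW.
  have := @semiconcave_increment R phi C al (al + Q.+3%:R * h) (s i.+2) (s i) h sc.
  rewrite -!sS -/(inc _) -/(inc _) => /(_ _ _ h0 _)/wrap[].
  - by have /andP[] := sle i (ltnW (ltnW (ltnW iQ))).
  - by rewrite !sS -addrA lerDl addr_ge0// ltW.
  - by have /andP[] := sle _ iQ.
  rewrite (_ : s i.+2 - s i = 2 * h); last by rewrite !sS; ring.
  by rewrite (_ : 2 * C * h * (2 * h) = 4 * C * h ^+ 2); [move=> *; lra|ring].
have E2 (i : 'I_Q) : inc i.+2 - inc i <= 4 * C * h ^+ 2 - (P i)%:R * (kap * h).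
  have := E1 i; case: (boolP (P i)) => [/bad|_]; last by rewrite mul0r subr0.
  rewrite mul1r -/(s _) -/(s _) -/(s _) -/(s _) -/(inc _) -/(inc _) => + _.
  have : 0 <= 4 * C * h ^+ 2 by rewrite mulr_ge0 ?exprn_ge0// ?mulr_ge0// ltW.
  by move: (4 * C * h ^+ 2) (kap * h) => *; lra.
have incL k : (k.+1 <= Q.+3)%N -> `|inc k| <= L * h.
  move=> kQ; have := lip _ _ (sle _ kQ) (sle _ (ltnW kQ)).
  by rewrite {2}sS addrAC subrr add0r (gtr0_norm h0).
(* The left side telescopes to at least [- 4 * L * h], while every kink contributes [- kap * h] on
   the right. *)
have H : \sum_(i < Q) (inc i.+2 - inc i) <= \sum_(i < Q) (4 * C * h ^+ 2 - (P i)%:R * (kap * h)).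
  by apply: ler_sum => i _; exact: E2.
move: H; rewrite telescope2 sumrB sumr_const card_ord -mulr_suml -natr_sum.
have -> : (\sum_(i < Q) P i)%N = #|P|.
  by rewrite -[RHS]sum1_card [RHS]big_mkcond; apply: eq_bigr => i _; rewrite unfold_in; case: (P i).
have := incL Q.+1 (leqnSn _); have := incL Q (leqW (leqnSn _)); have := incL 1%N isT; have := incL 0%N isT.
rewrite !ler_norml => /andP[? ?] /andP[? ?] /andP[? ?] /andP[? ?] H.
rewrite -(ler_pM2r h0); move: H; rewrite -[4 * C * h ^+ 2 *+ Q]mulr_natr.
rewrite (_ : #|P|%:R * (kap * h) = #|P|%:R * kap * h); last by ring.
rewrite (_ : (4 * L + 4 * C * (Q%:R * h)) * h = 4 * (L * h) + 4 * C * h ^+ 2 * Q%:R); last by ring.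
by move=> *; lra.
Qed.

Lemma small_frac {R : realType} (W eta : R) : 0 < W -> 0 < eta ->
  exists Q : nat, (0 < Q)%N /\ W / Q%:R <= eta.
Proof.
move=> W0 e0; exists (Num.bound (W / eta)).+1; split => //.
rewrite ler_pdivrMr ?ltr0n// mulrC -ler_pdivrMr//; apply: ltW.
have /archi_boundP : 0 <= W / eta by rewrite divr_ge0 ?ltW.
by move=> /lt_le_trans; apply; rewrite ler_nat.
Qed.

(** * The kinks of a semiconcave function form a null set *)

Section KinkSet.
Context {R : realType} {n : nat}.
Variables (f : 'rV[R]_n -> R) (x0 : 'rV[R]_n) (rho C L : R).
Hypotheses (rho0 : 0 < rho) (C0 : 0 <= C) (L0 : 0 <= L).
Hypothesis f_lip : forall a b, `|a - x0| < rho -> `|b - x0| < rho -> `|f a - f b| <= L * `|a - b|.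
Hypothesis f_sc : forall a, `|a - x0| < rho -> exists p, forall h, `|a + h - x0| < rho ->
  f (a + h) <= f a + dotr p h + C * `|h| ^+ 2.
Implicit Types (a b : 'rV[R]_n) (j : 'I_n).

Definition upd a j (s : R) : 'rV[R]_n := \row_l (if l == j then s else a 0 l).

Lemma upd_id a j : upd a j (a 0 j) = a.
Proof. by apply/rowP => l; rewrite mxE; case: eqP => // ->. Qed.

Lemma upd_shift a j u v : upd a j v = upd a j u + (v - u) *: delta_mx 0 j.
Proof.
apply/rowP => l; rewrite !mxE eqxx /=; case: eqP => _ /=; last by rewrite mulr0 addr0.
by rewrite mulr1 addrC subrK.
Qed.

Lemma norm_delta j : `|delta_mx 0 j : 'rV[R]_n| = 1.
Proof.
apply/eqP; rewrite eq_le; apply/andP; split.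
  by apply: rV_norm_le => // l; rewrite !mxE; case: (_ && _); rewrite ?normr1 ?normr0.
by have := rV_coord_le (delta_mx 0 j : 'rV[R]_n) j; rewrite mxE !eqxx normr1.
Qed.

Lemma upd_ball a j s (r : R) : 0 < r -> `|a - x0| < r -> `|s - x0 0 j| < r -> `|upd a j s - x0| < r.
Proof.
move=> r0 ar sr; apply: rV_norm_lt => // l; rewrite !mxE; case: eqP => [->//|_].
by have := rV_coord_le (a - x0) l; rewrite !mxE => /le_lt_trans; apply.
Qed.

(* Two superdifferentials at [a] with different [j]-th entries put [a] in such a set. *)
Definition kink j (kap : R) := [set a | `|a - x0| <= rho / 4 /\ forall t, 0 < t < kap ->
  f (upd a j (a 0 j + t)) + f (upd a j (a 0 j - t)) - 2 * f a <= - (kap * t)].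

Lemma line_semiconcave a j : `|a - x0| < rho -> forall u, `|u - x0 0 j| < rho ->
  exists p, forall v, `|v - x0 0 j| < rho ->
    f (upd a j v) <= f (upd a j u) + p * (v - u) + C * (v - u) ^+ 2.
Proof.
move=> ar u ur; have [p pP] := f_sc (upd_ball rho0 ar ur).
exists (p 0 j) => v vr; have := pP ((v - u) *: delta_mx 0 j).
rewrite -upd_shift => /(_ (upd_ball rho0 ar vr)).
by rewrite dotrZr dotr_delta normrZ norm_delta mulr1 real_normK ?num_real// mulrC.
Qed.

Lemma kink_cell a b j (kap h w : R) (al : R) (i : nat) : `|b - x0| < rho ->
  kink j kap a -> 0 < h -> h < kap -> 4 * C * h <= kap / 4 -> 4 * L * w <= kap / 4 * h ->
  (forall l, l != j -> `|a 0 l - b 0 l| <= w) -> 0 <= w ->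
  (forall k, (k <= i.+3)%N -> `|al + k%:R * h - x0 0 j| < rho) ->
  al + i.+1%:R * h <= a 0 j <= al + i.+2%:R * h ->
  f (upd b j (al + i.+3%:R * h)) - f (upd b j (al + i.+2%:R * h)) -
     (f (upd b j (al + i.+1%:R * h)) - f (upd b j (al + i%:R * h))) <= - (kap / 2 * h).
Proof.
move=> br [ar ak] h0 hk Ch Lw abw w0 alr /andP[sl sr].
have ar' : `|a - x0| < rho by apply: (le_lt_trans ar); rewrite ltr_pdivrMr// ltr_pMr// ltr1n.
have := ak h; rewrite h0 hk => /(_ isT) {}ak.
pose s (k : nat) : R := al + k%:R * h.
have sS k : s k.+1 = s k + h by rewrite /s -natr1; ring.
have fab k : (k <= i.+3)%N -> `|f (upd b j (s k)) - f (upd a j (s k))| <= L * w.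
  move=> kQ; apply: (le_trans (f_lip (upd_ball rho0 br (alr k kQ)) (upd_ball rho0 ar' (alr k kQ)))).
  rewrite ler_wpM2l//; apply: rV_norm_le => // l; rewrite !mxE; case: eqP => [_|/eqP lj].
    by rewrite subrr normr0.
  by rewrite distrC; exact: abw.
have s0r : `|s 0%N - x0 0 j| < rho by exact: alr.
have si0 : `|s i - x0 0 j| < rho by apply: alr; rewrite -addn3 leq_addr.
have si3 : `|s i.+3 - x0 0 j| < rho by exact: alr.
have sc u : s i <= u <= s i.+3 -> exists p, forall v, s i <= v <= s i.+3 ->
    f (upd a j v) <= f (upd a j u) + p * (v - u) + C * (v - u) ^+ 2.
  have inr v : s i <= v <= s i.+3 -> `|v - x0 0 j| < rho.
    move: si0 si3; rewrite !ltr_norml => /andP[? ?] /andP[? ?] /andP[? ?].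
    by apply/andP; split; lra.
  move=> /inr ur; have [p pP] := line_semiconcave ar' ur.
  by exists p => v /inr; exact: pP.
have e2 : s i.+2 = s i + 2 * h by rewrite !sS; ring.
have e3 : s i.+3 = s i + 3 * h by rewrite !sS; ring.
have e1 : s i.+1 = s i + h by rewrite !sS.
have sl' : s i + h <= a 0 j by rewrite -e1.
have sr' : a 0 j <= s i + 2 * h by rewrite -e2.
have I1 := @semiconcave_increment R (fun u => f (upd a j u)) C (s i) (s i.+3) (s i.+2) (a 0 j) h sc.
have I2 := @semiconcave_increment R (fun u => f (upd a j u)) C (s i) (s i.+3) (a 0 j - h) (s i) h sc.
have {}I1 := I1 ltac:(lra) ltac:(lra) h0 ltac:(lra).
have {}I2 := I2 ltac:(lra) ltac:(lra) h0 ltac:(lra).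
rewrite /= subrK upd_id -sS in I2; rewrite /= upd_id -sS in I1.
have J1 : 2 * C * h * (s i.+2 - a 0 j) <= 2 * C * h * h.
  by rewrite ler_wpM2l ?mulr_ge0 ?(ltW h0)//; lra.
have J2 : 2 * C * h * (a 0 j - h - s i) <= 2 * C * h * h.
  by rewrite ler_wpM2l ?mulr_ge0 ?(ltW h0)//; lra.
have J3 : 4 * C * h * h <= kap / 4 * h by rewrite ler_pM2r.
have iQ : (i <= i.+3)%N by rewrite -addn3 leq_addr.
have := fab i.+3 (leqnn _); have := fab i.+2 (leqnSn _); have := fab i.+1 (leqW (leqnSn _)); have := fab i iQ.
rewrite !ler_norml => /andP[? ?] /andP[? ?] /andP[? ?] /andP[? ?].
rewrite -/(s _) -/(s _) -/(s _) -/(s _).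
move: I1 I2 J1 J2 J3 ak Lw.
rewrite (_ : 2 * C * h * h = 4 * C * h * h / 2); last by field.
rewrite (_ : 4 * L * w = 4 * (L * w)); last by ring.
rewrite (_ : kap / 4 * h = kap * h / 4); last by field.
rewrite (_ : kap / 2 * h = kap * h / 2); last by field.
move: (4 * C * h * h) (2 * C * h * _) (2 * C * h * _) (kap * h) (f a) (f (upd a j (a 0 j + h))) (f (upd a j (a 0 j - h))).
by move=> *; lra.
Qed.

(** In a column of cells of height [h] along direction [j], at most [Kc] cells contain kinks,
    whatever [h] is. So the kinks are covered by cells of total volume at most [Kc * h * W^(n - 1)],
    which tends to 0 with [h]. *)
Lemma kink_null j (kap : R) : 0 < kap -> lebesgue_null (kink j kap).
Proof.
move=> k0; apply: lebesgue_null_seq => e e0; pose r4 := rho / 4; pose W := 2 * r4.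
have r40 : 0 < r4 by rewrite divr_gt0.
have W0 : 0 < W by rewrite mulr_gt0.
pose Kc := (4 * L + 4 * C * W) / (kap / 2); pose V := Kc * W ^+ n.-1.
have Kc0 : 0 <= Kc by rewrite divr_ge0 ?addr_ge0 ?mulr_ge0// ltW.
have V0 : 0 <= V by rewrite mulr_ge0// exprn_ge0// ltW.
(* The four bounds on [h] give, in order: the increment [h] is a legitimate test of the kink, the
   prolonged lines stay in the ball, the semiconcavity error is small, and the total volume is at
   most [e]. *)
pose eta := Order.min (Order.min (kap / 2) r4) (Order.min (kap / (16 * (C + 1))) (e / (V + 1))).
have C10 : 0 < C + 1 by rewrite ltr_wpDl.
have V10 : 0 < V + 1 by rewrite ltr_wpDl.
have eta0 : 0 < eta by rewrite !lt_min !divr_gt0// mulr_gt0.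
have [Q [Q0 Qe]] := small_frac W0 eta0.
have kL0 : 0 < kap / (16 * (L + 1)) by rewrite divr_gt0// mulr_gt0// ltr_wpDl.
have [S [S0 Se]] := small_frac (ltr01 : 0 < (1 : R)) kL0.
(* Cells are narrower across direction [j], because passing to another line of the column changes
   increments by multiples of [L * w], which must be small compared with [kap * h]. *)
pose h := W / Q%:R; pose w := h / S%:R; pose T := (Q * S)%N.
have Qr0 : 0 < Q%:R :> R by rewrite ltr0n.
have Sr0 : 0 < S%:R :> R by rewrite ltr0n.
have h0 : 0 < h by rewrite divr_gt0.
have w0 : 0 < w by rewrite divr_gt0.
have T0 : (0 < T)%N by rewrite muln_gt0 Q0.
have QhW : Q%:R * h = W by rewrite mulrC divfK// gt_eqF.
have TwW : T%:R * w = W by rewrite natrM -mulrA [S%:R * _]mulrC divfK ?gt_eqF.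
have [hk2 hr4 hC hV] : [/\ h <= kap / 2, h <= r4, h <= kap / (16 * (C + 1)) & h <= e / (V + 1)].
  by move: Qe; rewrite !le_min => /andP[/andP[? ?] /andP[? ?]].
have hk : h < kap by apply: (le_lt_trans hk2); rewrite ltr_pdivrMr// ltr_pMr// ltr1n.
have Ch : 4 * C * h <= kap / 4.
  have : 4 * (C + 1) * h <= 4 * (C + 1) * (kap / (16 * (C + 1))) by rewrite ler_pM2l// mulr_gt0.
  have -> : 4 * (C + 1) * (kap / (16 * (C + 1))) = kap / 4 by field; rewrite gt_eqF.
  by apply: le_trans; rewrite ler_pM2r// ler_pM2l// lerDl.
have Lw : 4 * L * w <= kap / 4 * h.
  have -> : 4 * L * w = 4 * L * (1 / S%:R) * h by rewrite /w; field; rewrite gt_eqF.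
  rewrite ler_pM2r//.
  have L10 : 0 < L + 1 by rewrite ltr_wpDl.
  have : 4 * (L + 1) * (1 / S%:R) <= 4 * (L + 1) * (kap / (16 * (L + 1))) by rewrite ler_pM2l// mulr_gt0.
  have -> : 4 * (L + 1) * (kap / (16 * (L + 1))) = kap / 4 by field; rewrite gt_eqF.
  by apply: le_trans; rewrite ler_pM2r ?divr_gt0// ler_pM2l// lerDl.
pose y0 : 'I_T := Ordinal T0.
pose lo l := x0 0 l - r4.
pose cell (c : {ffun 'I_n -> 'I_T}) (i : 'I_Q) : 'rV[R]_n * 'rV[R]_n :=
  (\row_l (if l == j then lo j + i%:R * h else lo l + (c l)%:R * w),
   \row_l (if l == j then lo j + i.+1%:R * h else lo l + (c l).+1%:R * w)).
pose incell c i (a : 'rV[R]_n) := forall l, (cell c i).1 0 l <= a 0 l <= (cell c i).2 0 l.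
pose P c : pred 'I_Q := fun i => `[< exists2 a, kink j kap a & incell c i a >].
(* Column indices are pinned to the dummy value [y0] at [j], so that there are [T^(n - 1)] of
   them. *)
pose cols := enum (pffun_on y0 (predC1 j) predT).
pose s := [seq cell c i | c <- cols, i <- enum (P c)].
have count c : #|P c|%:R <= Kc.
  pose b : 'rV[R]_n := \row_l (if l == j then x0 0 j else lo l + (c l)%:R * w).
  have br : `|b - x0| < rho.
    apply: rV_norm_lt => // l; rewrite !mxE; case: eqP => [->|_]; first by rewrite subrr normr0.
    have : (c l)%:R * w <= W.
      by rewrite -TwW ler_pM2r// ler_nat ltnW.
    have : 0 <= (c l)%:R * w by rewrite mulr_ge0// ltW.
    rewrite ltr_norml /lo; move: ((c l)%:R * w) => u u0 uW; rewrite /W /r4 in uW *.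
    by move: rho0 u0 uW => *; apply/andP; split; lra.
  rewrite /Kc ler_pdivlMr ?divr_gt0//; rewrite -QhW.
  (* The grid for [kink_count] starts one cell early, so that cell [i] lies between its nodes
     [i + 1] and [i + 2]; as [h <= rho / 4], it stays in the ball. *)
  have inb u : lo j - h <= u <= lo j - h + Q.+3%:R * h -> `|u - x0 0 j| < rho.
    rewrite (_ : Q.+3%:R * h = W + 3 * h); last by rewrite -QhW -addn3 natrD; ring.
    move=> /andP[u1 u2]; rewrite ltr_norml; move: u1 u2 hr4 r40 h0; rewrite /lo /W /r4 => *.
    by apply/andP; split; lra.
  apply: (@kink_count R (fun u => f (upd b j u)) C L (lo j - h) h (kap / 2) Q (P c)) => //.
  - by rewrite divr_gt0.
  - move=> u /inb ur; have [p pP] := line_semiconcave br ur.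
    by exists p => v /inb; exact: pP.
  - move=> u v /inb ur /inb vr; apply: (le_trans (f_lip (upd_ball rho0 br ur) (upd_ball rho0 br vr))).
    rewrite ler_wpM2l//; apply: rV_norm_le => // l; rewrite !mxE; case: eqP => // _.
    by rewrite subrr normr0.
  move=> i /asboolP[a ak ac]; apply: (kink_cell (a := a) (w := w) br ak) => //.
  - move=> l lj; have := ac l; rewrite !mxE (negPf lj) -natr1 mulrDl mul1r ler_norml.
    move: w0; move: ((c l)%:R * w) (lo l) (a 0 l) (w) => u v z w' w'0 /andP[? ?].
    by apply/andP; split; lra.
  - exact: ltW.
  - move=> k ki; apply: inb; rewrite lerDl mulr_ge0 ?(ltW h0)//= lerD2l ler_pM2r// ler_nat.
    by apply: (leq_trans ki); rewrite !ltnS ltnW.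
  - have := ac j; rewrite !mxE eqxx -[i.+2%:R]natr1 -natr1 !mulrDl !mul1r.
    by move: (i%:R * h) (lo j) (a 0 j) => u v z /andP[? ?]; apply/andP; split; lra.
have vol c i : \prod_l ((cell c i).2 0 l - (cell c i).1 0 l) = h * w ^+ n.-1.
  rewrite (bigD1 j)//= !mxE eqxx; congr (_ * _); first by rewrite -natr1; ring.
  rewrite (eq_bigr (fun=> w)); last by move=> l /negPf lj; rewrite !mxE lj -natr1; ring.
  by rewrite prodr_const cardC1 card_ord.
exists s; split.
- move=> ab l /allpairsPdep[c [i [_ _ ->]]]; rewrite !mxE.
  by case: eqP => _; rewrite lerD2l ler_pM2r// ler_nat.
- move=> a ak; have [ar _] := ak.
  have alo l : lo l <= a 0 l <= lo l + W.
    have := le_trans (rV_coord_le (a - x0) l) ar; rewrite !mxE ler_norml /lo /W -/r4 => /andP[? ?].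
    by apply/andP; split; lra.
  have /choice[k kP] l : exists i : 'I_T, lo l + i%:R * w <= a 0 l <= lo l + i.+1%:R * w.
    by apply: grid_index => //; rewrite TwW.
  have [i iP] : exists i : 'I_Q, lo j + i%:R * h <= a 0 j <= lo j + i.+1%:R * h.
    by apply: grid_index => //; rewrite QhW.
  pose c : {ffun 'I_n -> 'I_T} := [ffun l => if l == j then y0 else k l].
  have ac : incell c i a.
    move=> l; rewrite !mxE; case: eqP => [->//|/eqP lj].
    by rewrite ffunE (negPf lj).
  exists (cell c i); last exact: ac.
  apply/allpairsPdep; exists c, i; split => //.
    rewrite mem_enum; apply/pffun_onP; split => //.
    by apply/fintype.subsetP => l; rewrite !inE; apply: contra => /eqP ->; rewrite ffunE eqxx.
  by rewrite mem_enum; apply/asboolP; exists a.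
rewrite big_allpairs_dep/=.
apply: (@le_trans _ _ (\sum_(c <- cols) Kc * (h * w ^+ n.-1))).
  apply: ler_sum => c _; rewrite (eq_bigr (fun=> h * w ^+ n.-1)); last by move=> i _; exact: vol.
  rewrite big_const_seq count_predT iter_addr_0 -mulr_natl -cardE.
  by rewrite ler_wpM2r// mulr_ge0 ?exprn_ge0 ?ltW.
rewrite big_const_seq count_predT iter_addr_0 -mulr_natl -cardE card_pffun_on cardC1 !card_ord.
have -> : (T ^ n.-1)%:R * (Kc * (h * w ^+ n.-1)) = V * h.
  rewrite /V (_ : W ^+ n.-1 = T%:R ^+ n.-1 * w ^+ n.-1); last by rewrite -exprMn TwW.
  by rewrite natrX; move: (T%:R ^+ n.-1) (w ^+ n.-1) => u v; ring.
apply: (@le_trans _ _ ((V + 1) * h)); first by rewrite ler_pM2r// lerDl.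
by rewrite mulrC -ler_pdivlMr.
Qed.

End KinkSet.

(** * The cost function and contact tuples *)

Lemma sum_continuous {R : realType} {T : topologicalType} (I : finType) (F : I -> T -> R) :
  (forall l, continuous (F l)) -> continuous (fun x => \sum_l F l x).
Proof.
by move=> H x; apply: cvg_big => [|l _]; [exact: add_continuous|exact: H].
Qed.

Lemma hsqE {R : realType} {n : nat} {M : topologicalType} {A : smooth_atlas R n M}
  (g : riemannian_metric A) y x : hsq g y x = rdist g x y ^+ 2 / 2.
Proof. by []. Qed.

Section CostFunction.
Context {R : realType} {n : nat} {M : ptopologicalType}.
Context {A : smooth_atlas R n M} (g : riemannian_metric A).
Hypothesis hM : hausdorff_space M.
Hypothesis cM : compact [set: M].
Hypothesis reach : forall x y, curve_lengths g x y !=set0.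
Implicit Types (i : chart_index A) (a b h p q : 'rV[R]_n) (w y : M).

Local Notation d := (rdist g).
Local Notation hsq := (hsq g).
Let dsym := rdist_sym reach.
Let dtri := rdist_triangle reach.

Lemma hsq_continuous w : continuous (hsq w).
Proof.
move=> y; apply: cvgM; last exact: cvg_cst.
have dc : {for y, continuous (fun y => d y w)}.
  have -> : (fun y => d y w) = d w by apply/funext => u; exact: dsym.
  exact: rdist_continuousr.
by apply: (cvgM dc dc).
Qed.

Lemma hsq_ge0 w y : 0 <= hsq w y.
Proof. by rewrite divr_ge0// sqr_ge0. Qed.

(** By the factorization of a difference of squares, a bound of the diameter serves as a Lipschitz
    constant. *)
Lemma hsq_lip B w y y' : (forall x x', d x x' <= B) -> hsq w y <= hsq w y' + B * d y y'.
Proof.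
move=> dB; rewrite !hsqE.
have := dtri y y' w; have := dB y w; have := dB y' w; have := rdist_ge0 g y w.
have := rdist_ge0 g y' w; have := rdist_ge0 g y y'.
move: (d y w) (d y' w) (d y y') => u v t t0 v0 u0 vB uB utv.
have : (u - v) * (u + v) <= t * (2 * B).
  have [uv|vu] := leP u v.
    apply: (@le_trans _ _ 0); last by rewrite mulr_ge0// mulr_ge0//; lra.
    by rewrite mulr_le0_ge0 ?addr_ge0// subr_le0.
  by apply: ler_pM; rewrite ?subr_ge0 ?addr_ge0 ?(ltW vu)//; lra.
have -> : (u - v) * (u + v) = u ^+ 2 - v ^+ 2 by ring.
have -> : t * (2 * B) = 2 * (B * t) by ring.
by move: (B * t) (u ^+ 2) (v ^+ 2) => *; lra.
Qed.

Section FixedSize.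
Variable k : nat.
Implicit Types (x z : 'I_k -> M).

Local Notation c := (cost g k).

Let total x y : R := \sum_(l < k) hsq y (x l).

Let costE x : c x = inf (range (total x)).
Proof.
rewrite /cost; congr (inf _); apply/seteqP; split => [_ [y _ <-]|_ [y _ <-]]; exists y => //;
  by apply: eq_bigr => l _; rewrite hsqE mulrC.
Qed.

Let total_lb x : has_lbound (range (total x)).
Proof. by exists 0 => _ [y _ <-]; apply: sumr_ge0 => l _; exact: hsq_ge0. Qed.

Lemma cost_le x y : c x <= \sum_(l < k) hsq y (x l).
Proof. by rewrite costE; apply: ge_inf => //; exists y. Qed.

Lemma cost_attained x : exists y, c x = \sum_(l < k) hsq y (x l).
Proof.
have tc : continuous (total x).
  apply: sum_continuous => l y.
  have -> : (fun y => hsq y (x l)) = hsq (x l) by apply/funext => u; exact: hsq_sym.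
  exact: hsq_continuous.
have [y _ yP] := compact_EVT_min (ex_intro _ point I) cM (continuous_subspaceT tc).
exists y; apply/eqP; rewrite eq_le cost_le /= costE; apply: lb_le_inf.
  by exists (total x y); exists y.
by move=> _ [v _ <-]; apply: yP; rewrite inE.
Qed.

Lemma cost_ge0 x : 0 <= c x.
Proof. by have [y ->] := cost_attained x; apply: sumr_ge0 => l _; exact: hsq_ge0. Qed.

Lemma cost_lip B x z : (forall w w', d w w' <= B) -> c x <= c z + B * \sum_(l < k) d (x l) (z l).
Proof.
move=> dB; have [y yP] := cost_attained z; rewrite yP; apply: (le_trans (cost_le x y)).
by rewrite mulr_sumr -big_split/=; apply: ler_sum => l _; exact: hsq_lip.
Qed.

Lemma cost_continuous : continuous (c : power k M -> R).
Proof.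
have [B B0 dB] := rdist_bounded hM cM reach.
move=> x; apply/cvgrPdist_lt => e e0.
have H : \forall z \near (x : power k M), \sum_(l < k) d (x l) (z l) < e / B.
  have sc : continuous (fun z : power k M => \sum_(l < k) d (x l) (z l)).
    apply: sum_continuous => l z.
    apply: (@continuous_comp _ _ _ (fun z : power k M => z l) (d (x l))).
      exact: (@proj_continuous _ (fun=> M) l z).
    exact: rdist_continuousr.
  have := sc x => /cvgrPdist_lt/(_ (e / B)); rewrite divr_gt0// => /(_ isT).
  apply: filterS => z; rewrite [X in `|X - _|]big1 ?sub0r ?normrN; last by move=> l _; exact: rdistxx.
  by apply: le_lt_trans; exact: ler_norm.
apply: filterS H => z xz; have := cost_lip x z dB; have := cost_lip z x dB.
have -> : \sum_(l < k) d (z l) (x l) = \sum_(l < k) d (x l) (z l) by apply: eq_bigr => l _; exact: dsym.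
have : B * \sum_(l < k) d (x l) (z l) < e by rewrite mulrC -ltr_pdivlMr.
move: (B * _) => u *; rewrite ltr_norml; apply/andP; split; lra.
Qed.

End FixedSize.

(** * Contact tuples *)

Section Contact.
Variable m : nat.
Implicit Types (x z : 'I_m.+1 -> M).
Variable u : 'I_m.+1 -> M -> R.
Hypothesis u_adm : forall x, \sum_l u l (x l) <= cost g m.+1 x.

Definition contact x := \sum_l u l (x l) = cost g m.+1 x.

Definition replace x (l : 'I_m.+1) (v : M) : 'I_m.+1 -> M := fun l' => if l' == l then v else x l'.

Lemma sum_replace (F : 'I_m.+1 -> M -> R) x l v :
  \sum_l' F l' (replace x l v l') = F l v + \sum_(l' | l' != l) F l' (x l').
Proof.
rewrite (bigD1 l)//= /replace eqxx; congr (_ + _).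
by apply: eq_bigr => l' /negPf ->.
Qed.

(** One entry is changed, and [y] is kept as a competitor for the new cost. *)
Lemma contact_bound x y l v : cost g m.+1 x = \sum_l hsq y (x l) -> contact x ->
  u l v - u l (x l) <= hsq y v - hsq y (x l).
Proof.
move=> cy; rewrite /contact cy (bigD1 l)//= [RHS](bigD1 l)//= => E.
have := le_trans (u_adm (replace x l v)) (cost_le _ y).
rewrite sum_replace (sum_replace (fun=> hsq y)).
move: E; move: (\sum_(_ | _) _) (\sum_(_ | _) _) => s t *; lra.
Qed.

(* The points at which some [hsq y] touches [u 0] from above; their momentum is that of [u 0]. *)
Lemma contact_superdiff i x y q : cost g m.+1 x = \sum_l hsq y (x l) -> contact x ->
  superdiff i (hsq y) (x ord0) q -> superdiff i (u ord0) (x ord0) q.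
Proof.
move=> cy cx H; have := superdiff_affine (u ord0 (x ord0) - hsq y (x ord0)) ler01 H.
rewrite scale1r; apply: superdiff_le => [w|].
  by rewrite mul1r addrA; have := contact_bound ord0 w cy cx; lra.
by rewrite mul1r addrC subrK.
Qed.

Lemma twistW (s s' : R) i (w : M) : s' <= s -> twist g i s w -> twist g i s' w.
Proof. by move=> ss H z z' p zs zs'; apply: H; [exact: le_trans ss|exact: le_trans ss]. Qed.

(** The point [w] comes with its own chart and radius, while [superdiff_determines] wants one radius
    for all points: the smaller of the two radii serves both. *)
Lemma twist_superdiff (s : R) (w : M) i y y' p : 0 < s -> twist_point g s w i ->
  (forall q, superdiff i (hsq y) w q -> q = p) ->
  (forall q, superdiff i (hsq y') w q -> q = p) -> y = y'.
Proof.
move=> s0 [iw tw sd]; have [s1 s10 uni] := uniform_twist hM cM reach.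
have m0 : 0 < Order.min s s1 by rewrite lt_min s0.
apply: (superdiff_determines hM cM reach m0).
  move=> v; have [j [jv tv sv]] := uni v; exists j; split => //.
  by apply: twistW tv; rewrite ge_min lexx orbT.
by split => //; apply: twistW tw; rewrite ge_min lexx.
Qed.

Lemma contact_unique (s : R) i p x x' : 0 < s -> x ord0 = x' ord0 -> contact x -> contact x' ->
  twist_point g s (x ord0) i -> (forall q, superdiff i (u ord0) (x ord0) q -> q = p) -> x = x'.
Proof.
move=> s0 xx cx cx' tw up.
have [y yP] := cost_attained x; have [y' yP'] := cost_attained x'.
have yy : y = y'.
  apply: (twist_superdiff (p := p) s0 tw) => q H; apply: up.
    exact: contact_superdiff H.
  by rewrite xx in H *; exact: contact_superdiff H.
rewrite -{}yy in yP'; clear y'.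
apply/funext => l; have [->//|l0] := eqVneq l ord0.
have [s1 s10 uni] := uniform_twist hM cM reach; have [j tj] := uni y.
have [_ _ sd] := tj.
have /choice[r rP] : forall l', exists r, superdiff j (hsq (x l')) y r by move=> l'; exact: sd.
(* If [y] minimizes the sum for the tuple with [v] in place [l], then a superdifferential of [hsq v]
   at [y] is opposite to the sum of the others, which does not depend on [v]. *)
have key v : contact x -> (forall w, \sum_l' hsq y (replace x l v l') <= \sum_l' hsq w (replace x l v l')) ->
    forall q, superdiff j (hsq v) y q -> q = - \sum_(l' | l' != l) r l'.
  move=> _ vmin q qP; apply/eqP; rewrite -addr_eq0; apply/eqP.
  apply: (superdiff_min (i := j) (f := fun w => hsq v w + \sum_(l' | l' != l) hsq (x l') w) (x := y)).
    move=> w; have := vmin w.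
    rewrite (sum_replace (fun=> hsq y)) (sum_replace (fun=> hsq w)) (hsq_sym reach y v) (hsq_sym reach w v).
    rewrite (eq_bigr (fun l' => hsq (x l') y)); last by move=> l' _; exact: hsq_sym.
    by rewrite [X in _ <= _ + X](eq_bigr (fun l' => hsq (x l') w)); last by move=> l' _; exact: hsq_sym.
  by apply: superdiffD => //; apply: superdiff_sum => l' _; exact: rP.
have replace_id : replace x l (x l) = x by apply/funext => l'; rewrite /replace; case: eqP => // ->.
apply: (twist_superdiff (p := - \sum_(l' | l' != l) r l') s10 tj); apply: key => // w.
  by rewrite replace_id -yP; exact: cost_le.
(* Exchanging the l-th points of two tuples with the same barycenter gives tuples with that barycenter. *)
suff : \sum_l' hsq y (replace x l (x' l) l') <= cost g m.+1 (replace x l (x' l)).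
  by move/le_trans; apply; exact: cost_le.
apply: le_trans (u_adm _); rewrite (sum_replace (fun=> hsq y)) sum_replace.
have := contact_bound l (x l) yP' cx'.
move: cx; rewrite /contact yP (bigD1 l)//= [RHS](bigD1 l)//=.
by move: (\sum_(_ | _) _) (\sum_(_ | _) _) => S T *; lra.
Qed.

End Contact.
End CostFunction.

(** * Kinks and non-unique superdifferentials *)

Section KinkClosed.
Context {R : realType} {n : nat}.
Variables (f : 'rV[R]_n -> R) (x0 : 'rV[R]_n) (rho C L : R).
Hypotheses (rho0 : 0 < rho) (L0 : 0 <= L).
Hypothesis f_lip : forall a b, `|a - x0| < rho -> `|b - x0| < rho -> `|f a - f b| <= L * `|a - b|.
Implicit Types (a b p q : 'rV[R]_n) (j : 'I_n).

(** For each [t] the kink inequality is closed in [a], by the Lipschitz bound; [kap <= rho / 4]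
    keeps the test points in the ball. Compactness later makes the set of kinks in the manifold
    Borel. *)
Lemma kink_compact j (kap : R) : kap <= rho / 4 -> compact (kink f x0 rho j kap).
Proof.
move=> kr; have r4 : 0 < rho / 4 by rewrite divr_gt0.
apply: (subclosed_compact _ (@closed_ball_compact R n x0 (rho / 4))); last by move=> a [].
move=> a aN; have ar : `|a - x0| <= rho / 4.
  apply/ler_addgt0Pr => e e0; have [|b [[br _] ba]] := aN (ball a e); first exact: nbhsx_ballx.
  move: ba; rewrite -ball_normE/= => ba.
  have -> : a - x0 = (b - x0) + (a - b) by rewrite [RHS]addrC addrA subrK.
  by apply: (le_trans (ler_normD _ _)); rewrite lerD// ltW.
split => // t /andP[t0 tk].
apply: (@le_eps _ _ _ (4 * L)); first by rewrite mulr_ge0.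
move=> eta eta0; pose e := Order.min eta (rho / 4).
have e0 : 0 < e by rewrite lt_min eta0.
have [|b [[br bk] ba]] := aN (ball a e); first exact: nbhsx_ballx.
move: ba; rewrite -ball_normE/= => ba.
have t0' : 0 < t < kap by rewrite t0.
have := bk t t0'.
have coord (s : R) : `|s| <= t -> `|f (upd a j (a 0 j + s)) - f (upd b j (b 0 j + s))| <= L * e.
  move=> st; have inb (v : 'rV[R]_n) : `|v - x0| <= rho / 4 -> `|upd v j (v 0 j + s) - x0| < rho.
    move=> vr; apply: upd_ball => //; first by apply: (le_lt_trans vr); rewrite ltr_pdivrMr// ltr_pMr// ltr1n.
    have := rV_coord_le (v - x0) j; rewrite !mxE => vj.
    have -> : v 0 j + s - x0 0 j = (v 0 j - x0 0 j) + s by ring.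
    by apply: (le_lt_trans (ler_normD _ _)); lra.
  apply: (le_trans (f_lip (inb _ ar) (inb _ br))); rewrite ler_wpM2l//.
  apply: le_trans (ltW ba); apply: rV_norm_le => // l; rewrite !mxE; case: eqP => [_|_].
    rewrite opprD addrACA subrr addr0; have := rV_coord_le (a - b) j; by rewrite !mxE.
  by have := rV_coord_le (a - b) l; rewrite !mxE.
have rr : rho / 4 < rho by rewrite ltr_pdivrMr// ltr_pMr// ltr1n.
have H0 := f_lip (le_lt_trans ar rr) (le_lt_trans br rr).
have H0' : L * `|a - b| <= L * e by rewrite ler_wpM2l// ltW.
have H1 := coord t; have H2 := coord (- t).
have {}H1 := H1 ltac:(by rewrite gtr0_norm).
have {}H2 := H2 ltac:(by rewrite normrN gtr0_norm).
have Le : L * e <= L * eta by rewrite ler_wpM2l// ge_min lexx.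
move: H0 H0' H1 H2 Le; rewrite !ler_norml.
move: (L * `|a - b|) (L * e) (f (upd a j (a 0 j + t))) (f (upd a j (a 0 j - t))) (f a) (f b)
  (f (upd b j (b 0 j + t))) (f (upd b j (b 0 j - t))) (kap * t).
rewrite -(mulrA 4 L eta); move: (L * eta) => u1 u2 u3 u4 u5 u6 u7 u8 u9 u10.
by move=> /andP[? ?] ? /andP[? ?] /andP[? ?] *; lra.
Qed.

Definition sdiff a p := exists K : R, exists2 dlt, 0 < dlt &
  forall h : 'rV[R]_n, `|h| < dlt -> f (a + h) <= f a + dotr p h + K * `|h| ^+ 2.

(** If [q] and [p] differ by [del > 0] in entry [j], use [q] for the step [+ t] and [p] for the step
    [- t]: the second difference is at most [- del * t] plus a quadratic term. For small [t] the
    latter takes at most half of [del], and the rest is a kink of size at most [del / 2]. *)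
Lemma no_kink_unique a p q : `|a - x0| <= rho / 4 ->
  (forall j (k : nat), ~ kink f x0 rho j (rho / 4 / k.+1%:R) a) ->
  sdiff a p -> sdiff a q -> p = q.
Proof.
move=> ar nk ap aq; apply/rowP => j; apply: contrapT => /eqP pq.
wlog lt_pq : p q ap aq pq / q 0 j < p 0 j.
  move=> W; move: (pq); rewrite neq_lt => /orP[lt|lt]; last exact: W lt.
  by apply: (W q p) => //; rewrite eq_sym.
have [K [dlt d0 pP]] := ap; have [K' [dlt' d0' qP]] := aq.
pose del := p 0 j - q 0 j; have del0 : 0 < del by rewrite subr_gt0.
pose KK := `|K| + `|K'| + 1.
have KK0 : 0 < KK by rewrite ltr_wpDl// addr_ge0.
pose eta := Order.min (Order.min dlt dlt') (Order.min (del / 2) (del / (2 * KK))).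
have eta0 : 0 < eta by rewrite !lt_min d0 d0' !divr_gt0// mulr_gt0.
have r4 : 0 < rho / 4 by rewrite divr_gt0.
have [k [k0 kP]] := small_frac r4 eta0.
case: k k0 kP => // k _ kP; apply: (nk j k); split => // t /andP[t0 tk].
have te : t < eta by exact: lt_le_trans kP.
move: (te); rewrite /eta !lt_min => /andP[/andP[td td'] /andP[tdel tKK]].
have E1 := qP (t *: delta_mx 0 j); have E2 := pP (- t *: delta_mx 0 j).
rewrite normrZ norm_delta mulr1 gtr0_norm// dotrZr dotr_delta in E1.
rewrite normrZ normrN norm_delta mulr1 gtr0_norm// dotrZr dotr_delta in E2.
have {}E1 := E1 td'; have {}E2 := E2 td.
have U1 := upd_shift a j (a 0 j) (a 0 j + t); have U2 := upd_shift a j (a 0 j) (a 0 j - t).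
rewrite upd_id addrAC subrr add0r in U1; rewrite upd_id addrAC subrr add0r in U2.
rewrite U1 U2; move: E1 E2.
have kt : rho / 4 / k.+1%:R * t <= del / 2 * t.
  by rewrite ler_pM2r//; apply: (le_trans kP); rewrite /eta !ge_min lexx !orbT.
have Kt : K * t ^+ 2 + K' * t ^+ 2 <= del / 2 * t.
  have -> : K * t ^+ 2 + K' * t ^+ 2 = (K + K') * t * t by ring.
  rewrite ler_pM2r//; apply: (@le_trans _ _ (KK * t)).
    rewrite ler_pM2r// /KK; have := ler_norm K; have := ler_norm K'.
    by move: (`|K|) (`|K'|) => *; lra.
  rewrite mulrC -ler_pdivlMr//; apply: (le_trans (ltW tKK)).
  by rewrite le_eqVlt; apply/orP; left; apply/eqP; field; rewrite gt_eqF.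
move: kt Kt; rewrite (_ : del / 2 * t = (t * p 0 j - t * q 0 j) / 2); last by rewrite /del; field.
move: (rho / 4 / k.+1%:R * t) (K * t ^+ 2) (K' * t ^+ 2) (f _) (f _) (f a).
rewrite mulNr; move: (t * p 0 j) (t * q 0 j) => *; lra.
Qed.

End KinkClosed.

(** * The exceptional null set on the manifold *)

Section SingularSet.
Context {R : realType} {n : nat} {M : ptopologicalType}.
Context {A : smooth_atlas R n M} (g : riemannian_metric A).
Hypothesis hM : hausdorff_space M.
Hypothesis cM : compact [set: M].
Hypothesis reach : forall x y, curve_lengths g x y !=set0.
Implicit Types (i : chart_index A) (a b h p q : 'rV[R]_n) (w x y : M).

Local Notation d := (rdist g).
Local Notation hsq := (hsq g).

Lemma borel_open (U : set M) : open U -> measurable (U : set (borel M)).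
Proof. by move=> oU; apply: sub_sigma_algebra. Qed.

Lemma borel_closed (F : set M) : closed F -> measurable (F : set (borel M)).
Proof. by move=> cF; rewrite -[F]setCK; apply: measurableC; apply: borel_open; exact: closed_openC. Qed.

Variable f : M -> R.
Variable B : R.
Hypothesis f_lip : forall x y, f x <= f y + B * d x y.
Hypothesis f_touch : forall x, exists y e, (forall w, f w <= hsq y w + e) /\ f x = hsq y x + e.
Variable mu : probability (borel M) R.
Hypothesis mu_ac : abs_continuous A mu.

Definition regular x := exists s i p, [/\ 0 < s, twist_point g s x i &
  forall q, superdiff i f x q -> q = p].

(** [abs_continuous] speaks of measurable sets only. The exceptional set is a countable union, over
    directions and sizes [rho / 4 / (k + 1)], of compact sets of kinks, hence Borel. *)
Lemma local_singular_set (p0 : M) : exists V N : set M, [/\ open V, V p0,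
  measurable (N : set (borel M)), mu N = 0%E & forall x, V x -> ~ N x -> regular x].
Proof.
have [i [rho [s [C [L [ip gc]]]]]] := good_chart_exists hM cM reach p0.
set x0 := chart i p0 in gc; have r0 := gc_rho gc; have L0 := gc_L gc.
have r4 : 0 < rho / 4 by rewrite divr_gt0.
have rr : rho / 4 < rho by rewrite ltr_pdivrMr// ltr_pMr// ltr1n.
pose F a := f (chart_inv i a).
have BL0 : 0 <= `|B| * L by rewrite mulr_ge0// ltW.
have F_lip a b : `|a - x0| < rho -> `|b - x0| < rho -> `|F a - F b| <= (`|B| * L) * `|a - b|.
  move=> ar br; have dab := gc_lip gc br ar; have dba := gc_lip gc ar br.
  have H u v : d (chart_inv i u) (chart_inv i v) <= L * `|v - u| -> F u - F v <= (`|B| * L) * `|v - u|.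
    move=> duv; rewrite lerBlDl /F; apply: (le_trans (f_lip _ (chart_inv i v))); rewrite lerD2l -mulrA.
    apply: (@le_trans _ _ (`|B| * d (chart_inv i u) (chart_inv i v))).
      by rewrite ler_wpM2r ?ler_norm// rdist_ge0.
    by rewrite ler_wpM2l.
  rewrite ler_norml; have := H _ _ dab; have := H _ _ dba; rewrite (distrC b a).
  by move: (F a) (F b) (_ * _) => *; apply/andP; split; lra.
have F_sc a : `|a - x0| < rho -> exists p, forall h, `|a + h - x0| < rho ->
    F (a + h) <= F a + dotr p h + C * `|h| ^+ 2.
  move=> ar; have [y [e [fw fa]]] := f_touch (chart_inv i a).
  have [p pP] := gc_semiconcave gc y ar; exists p => h hr.
  rewrite /F; apply: (le_trans (fw _)); rewrite fa; have := pP h hr.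
  by move: (hsq _ _) (hsq _ _) (dotr _ _) (C * _) => *; lra.
pose Z (kj : nat * 'I_n) := chart_inv i @` kink F x0 rho kj.2 (rho / 4 / kj.1.+1%:R).
have kimg (k : nat) : rho / 4 / k.+1%:R <= rho / 4 by rewrite ler_pdivrMr// ler_peMr ?ler1n// ltW.
have Zclosed kj : closed (Z kj).
  apply: (compact_closed hM); apply: continuous_compact; last exact: (kink_compact r0 BL0 F_lip (kimg _)).
  apply: continuous_in_subspaceT => a; rewrite inE/= => -[ar _].
  exact/chart_inv_continuous_at/(gc_img gc)/(le_lt_trans ar).
have Zimg kj x : Z kj x -> chart_dom i x /\ kink F x0 rho kj.2 (rho / 4 / kj.1.+1%:R) (chart i x).
  move=> [a ak <-]; have [ar _] := ak.
  by have [ia ca] := chart_imgP (gc_img gc (le_lt_trans ar rr)); split => //; rewrite ca.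
have Zmeas kj : measurable (Z kj : set (borel M)) by exact: borel_closed.
have Znull kj : mu (Z kj) = 0%E.
  apply: (mu_ac (i := i) (Zmeas kj)); first by move=> x /Zimg[].
  have kn : lebesgue_null (kink F x0 rho kj.2 (rho / 4 / kj.1.+1%:R)).
    by apply: (kink_null r0 (gc_C gc) BL0 F_lip F_sc); rewrite divr_gt0.
  move=> e e0; have [Dk [lo [up [H1 H2 H3]]]] := kn e e0.
  by exists Dk, lo, up; split => // _ [x /Zimg[_ xk] <-]; exact: H2.
pose Zs (c : nat) : set M := if unpickle c is Some kj then Z kj else set0.
exists [set x | chart_dom i x /\ `|chart i x - x0| < rho / 4], (\bigcup_c Zs c); split.
- rewrite openE => x [ix xr]; exact: chart_open_ball.
- by split => //; rewrite subrr normr0.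
- by apply: bigcup_measurable => c _; rewrite /Zs; case: (unpickle c).
- apply/(negligibleP mu).
    by apply: bigcup_measurable => c _; rewrite /Zs; case: (unpickle c).
  apply: negligible_bigcup => c; rewrite /Zs; case: (unpickle c) => [kj|]; last exact: negligible_set0.
  by apply/(negligibleP mu (Zmeas kj)); exact: Znull.
move=> x [ix xr] nN.
have xr' : `|chart i x - x0| < rho by exact: lt_trans rr.
have tw : twist_point g s x i.
  split => //; first by have := gc_twist gc xr'; rewrite chartK.
  by move=> y; have := good_chart_superdiff gc y xr'; rewrite chartK.
have nk j k : ~ kink F x0 rho j (rho / 4 / k.+1%:R) (chart i x).
  move=> xk; apply: nN; exists (pickle (k, j)) => //; rewrite /Zs pickleK.
  by exists (chart i x) => //; rewrite chartK.
have sdE q : superdiff i f x q -> sdiff F (chart i x) q.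
  by move=> [K [dlt d0 H]]; exists K, dlt => // h hd; rewrite /F chartK//; exact: H.
(* Without any superdifferential at [x] the uniqueness clause is vacuous, and 0 serves as [p]. *)
have [[p px]|np] := pselect (exists p, superdiff i f x p).
  exists s, i, p; split; [exact: gc_s gc|exact: tw|move=> q qx].
  by apply: (no_kink_unique r0 (ltW xr) nk); exact: sdE.
exists s, i, 0; split; [exact: gc_s gc|exact: tw|move=> q qx].
by exfalso; apply: np; exists q.
Qed.

Lemma singular_set : exists N : set M, [/\ measurable (N : set (borel M)), mu N = 0%E &
  forall x, ~ N x -> regular x].
Proof.
have /choice[VN VNP] : forall p0 : M, exists VN : set M * set M, [/\ open VN.1, VN.1 p0,
  measurable (VN.2 : set (borel M)), mu VN.2 = 0%E & forall x, VN.1 x -> ~ VN.2 x -> regular x].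
  by move=> p0; have [V [N H]] := local_singular_set p0; exists (V, N).
have := cM; rewrite compact_cover => /(_ M [set: M] (fun p : M => (VN p).1))[||D' _ D'P].
- by move=> p _; case: (VNP p).
- by move=> p _; exists p => //; case: (VNP p).
have [s sP] : exists s : seq M, forall x, exists2 p, p \in s & (VN p).1 x.
  by exists (finmap.enum_fset D') => x; have [p pD xp] := D'P x I; exists p.
pose N := \big[setU/set0]_(p <- s) (VN p).2.
have Nm : measurable (N : set (borel M)).
  by apply: bigsetU_measurable => p _; case: (VNP p).
exists N; split => //.
  apply/(negligibleP mu Nm); rewrite /N; elim: s {sP N Nm} => [|p s IH].
    by rewrite big_nil; exact: negligible_set0.
  rewrite big_cons; apply: negligibleU => //.
  by have [_ _ H1 H2 _] := VNP p; exists (VN p).2; split.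
move=> x nNx; have [p pD xp] := sP x; have [_ _ _ _ H] := VNP p.
by apply: H => // px; apply: nNx; rewrite /N -bigcup_seq; exists p.
Qed.

End SingularSet.

(** * The dual problem *)

Lemma filter_seq {T : Type} (F : set_system T) {FF : Filter F} (I : eqType) (s : seq I) (P : I -> set T) :
  (forall i, F (P i)) -> F [set t | forall i, i \in s -> P i t].
Proof.
move=> FP; elim: s => [|i s IH]; first by apply: filterS filterT => t _ i; rewrite in_nil.
by apply: filterS (filterI (FP i) IH) => t [Pi Ps] j; rewrite inE => /predU1P[->//|]; exact: Ps.
Qed.

Lemma bounded_integrable {R : realType} {d : measure_display} {T : measurableType d}
  (P : probability T R) (f : T -> R) (K : R) :
  measurable_fun [set: T] f -> (forall t, `|f t| <= K) -> P.-integrable [set: T] (EFin \o f).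
Proof.
move=> mf fK; apply: measurable_bounded_integrable => //.
  by apply: (le_lt_trans (probability_le1 P measurableT)); rewrite ltry.
exists K; split; first by rewrite num_real.
by move=> e Ke t _ /=; apply: ltW; exact: le_lt_trans Ke.
Qed.

Section ContinuousIntegral.
Context {R : realType} {M : ptopologicalType}.
Hypothesis cM : compact [set: M].
Implicit Types (f h : M -> R) (mu : probability (borel M) R).

Lemma power_compact k : compact [set: power k M].
Proof.
have := @tychonoff 'I_k (fun=> M) (fun=> setT) (fun=> cM).
by congr compact; apply/seteqP; split.
Qed.

Lemma continuous_borel f : continuous f -> measurable_fun [set: borel M] (f : borel M -> R).
Proof.
move=> /continuousP cf; apply: (measurability _ (RGenOpens.measurableE R)).
move=> _ [_ [a [b ->] <-]]; rewrite setTI; apply: sub_sigma_algebra.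
exact/cf/interval_open.
Qed.

Lemma continuous_bounded f : continuous f -> exists2 T, 0 <= T & forall x, `|f x| <= T.
Proof.
move=> cf; have : compact (f @` [set: M]).
  by apply: continuous_compact => //; exact: continuous_subspaceT.
move=> /compact_bounded[T [_ /(_ (`|T| + 1))]]; rewrite ltr_pwDr ?ler_norm// => /(_ isT) H.
exists (`|T| + 1); first by rewrite addr_ge0.
by move=> x; apply: H; exists x.
Qed.

Lemma continuous_integrable mu f : continuous f -> mu.-integrable [set: borel M] (EFin \o f).
Proof.
move=> cf; have [T _ fT] := continuous_bounded cf.
exact: (bounded_integrable mu (continuous_borel cf) fT).
Qed.

Definition mean mu f : R := (\int[mu]_(x in [set: borel M]) f x)%R.

Lemma mean_le mu f h : continuous f -> continuous h -> (forall x, f x <= h x) -> mean mu f <= mean mu h.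
Proof. by move=> cf ch fh; apply: le_Rintegral => //; exact: continuous_integrable. Qed.

Lemma mean_cst mu (r : R) : mean mu (fun=> r) = r.
Proof. rewrite /mean Rintegral_cst//; transitivity (r * fine (1%E : \bar R)); last by rewrite mulr1.
by congr (_ * fine _); exact: probability_setT. Qed.

Lemma mean_linear mu f h (r : R) : continuous f -> continuous h ->
  mean mu (fun x => f x + r * h x) = mean mu f + r * mean mu h.
Proof.
move=> cf ch; rewrite /mean RintegralD//; last 2 first.
- exact: continuous_integrable.
- by apply: continuous_integrable => x; apply: cvgM; [exact: cvg_cst|exact: ch].
by rewrite RintegralZl//; exact: continuous_integrable.
Qed.

Lemma mean_shift mu f (r : R) : continuous f -> mean mu (fun x => f x + r) = mean mu f + r.
Proof.
move=> cf; transitivity (mean mu (fun x => f x + 1 * r)).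
  by congr (mean _ _); apply/funext => x; rewrite mul1r.
rewrite (mean_linear mu 1 cf (h := fun=> r)); first by rewrite mean_cst mul1r.
by move=> x; exact: cvg_cst.
Qed.

Lemma mean_EFin mu f : continuous f -> (\int[mu]_x (f x)%:E)%E = (mean mu f)%:E.
Proof.
move=> cf; rewrite /mean /Rintegral fineK//.
exact: (integrable_fin_num _ (continuous_integrable mu cf)).
Qed.

End ContinuousIntegral.

Section DualProblem.
Context {R : realType} {n : nat} {M : ptopologicalType}.
Context {A : smooth_atlas R n M} (g : riemannian_metric A).
Hypothesis hM : hausdorff_space M.
Hypothesis cM : compact [set: M].
Hypothesis reach : forall x y, curve_lengths g x y !=set0.
Variables (m : nat) (mu : 'I_m.+1 -> probability (borel M) R).
Variable B : R.
Hypothesis B0 : 0 < B.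
Hypothesis dB : forall x y, rdist g x y <= B.
Implicit Types (x z : 'I_m.+1 -> M) (v w : M) (l : 'I_m.+1) (u : 'I_m.+1 -> M -> R).

Local Notation d := (rdist g).
Local Notation c := (cost g m.+1).
Let dsym := rdist_sym reach.

Definition lip (f : M -> R) := forall v w, f v <= f w + B * d v w.

Lemma lip_continuous f : lip f -> continuous f.
Proof.
move=> fl v; apply/cvgrPdist_lt => e e0.
apply: filterS (near_rdist hM reach v (divr_gt0 e0 B0)) => w; rewrite ltr_pdivlMr// mulrC.
have := fl v w; have := fl w v; rewrite (dsym w v) ltr_norml.
by move: (B * _) => *; apply/andP; split; lra.
Qed.

Lemma lip_power_continuous (K : R) (F : ('I_m.+1 -> M) -> R) : 0 < K ->
  (forall x z, F x <= F z + K * \sum_l d (x l) (z l)) -> continuous (F : power m.+1 M -> R).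
Proof.
move=> K0 Fl x; apply/cvgrPdist_lt => e e0.
have H : \forall z \near (x : power m.+1 M), \sum_l d (x l) (z l) < e / K.
  have sc : continuous (fun z : power m.+1 M => \sum_l d (x l) (z l)).
    apply: sum_continuous => l z.
    apply: (@continuous_comp _ _ _ (fun z : power m.+1 M => z l) (d (x l))).
      exact: (@proj_continuous _ (fun=> M) l z).
    exact: rdist_continuousr.
  have := sc x => /cvgrPdist_lt/(_ (e / K)); rewrite divr_gt0// => /(_ isT).
  apply: filterS => z; rewrite [X in `|X - _|]big1 ?sub0r ?normrN; last by move=> l _; exact: rdistxx.
  by apply: le_lt_trans; exact: ler_norm.
apply: filterS H => z; rewrite ltr_pdivlMr// mulrC; have := Fl x z; have := Fl z x.
have -> : \sum_l d (z l) (x l) = \sum_l d (x l) (z l) by apply: eq_bigr => l _; exact: dsym.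
by move: (K * _) => *; rewrite ltr_norml; apply/andP; split; lra.
Qed.

Definition admissible u := forall x, \sum_l u l (x l) <= c x.
Definition dual_value u := \sum_l mean (mu l) (u l).

Lemma dual_value_le u u' : (forall l, continuous (u l)) -> (forall l, continuous (u' l)) ->
  (forall l v, u l v <= u' l v) -> dual_value u <= dual_value u'.
Proof. by move=> uc uc' uu; apply: ler_sum => l _; exact: mean_le. Qed.

Definition slack u l z : R := c z - \sum_(l' | l' != l) u l' (z l').

(** For admissible [u], the largest [l]-th component that is admissible with the other ones. *)
Definition ctransform u l v : R := inf [set slack u l z | z in [set z : 'I_m.+1 -> M | z l = v]].

Definition update u l (f : M -> R) : 'I_m.+1 -> M -> R := fun l' => if l' == l then f else u l'.

Lemma slack_ge u l z : admissible u -> u l (z l) <= slack u l z.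
Proof. by move=> /(_ z); rewrite (bigD1 l)//= /slack lerBrDr. Qed.

Lemma ctransform_le u l z : admissible u -> ctransform u l (z l) <= slack u l z.
Proof.
move=> ua; apply: ge_inf; last by exists z.
by exists (u l (z l)) => _ [z' z'l <-]; rewrite -z'l; exact: slack_ge.
Qed.

Lemma ctransform_ge u l v (t : R) : (forall z, z l = v -> t <= slack u l z) -> t <= ctransform u l v.
Proof.
move=> H; apply: lb_le_inf; first by exists (slack u l (fun=> v)); exists (fun=> v).
by move=> _ [z zl <-]; exact: H.
Qed.

Lemma ctransform_improves u l v : admissible u -> u l v <= ctransform u l v.
Proof. by move=> ua; apply: ctransform_ge => z <-; exact: slack_ge. Qed.

Lemma sum_update u l f x : \sum_l' update u l f l' (x l') = f (x l) + \sum_(l' | l' != l) u l' (x l').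
Proof.
rewrite (bigD1 l)//= {1}/update eqxx; congr (_ + _).
by apply: eq_bigr => l' /negPf l'l; rewrite /update l'l.
Qed.

Lemma ctransform_admissible u l : admissible u -> admissible (update u l (ctransform u l)).
Proof. by move=> ua x; rewrite sum_update -lerBrDr; exact: ctransform_le. Qed.

Lemma slack_replace u l z v : slack u l (replace z l v) <= slack u l z + B * d v (z l).
Proof.
rewrite /slack; have -> : \sum_(l' | l' != l) u l' (replace z l v l') = \sum_(l' | l' != l) u l' (z l').
  by apply: eq_bigr => l' /negPf l'l; rewrite /replace l'l.
rewrite addrAC lerD2r; apply: (le_trans (cost_lip hM cM reach (replace z l v) z dB)).
rewrite lerD2l (bigD1 l)//= big1 ?addr0; first by rewrite /replace eqxx.
by move=> l' /negPf l'l; rewrite /replace l'l rdistxx.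
Qed.

Lemma ctransform_lip u l : admissible u -> lip (ctransform u l).
Proof.
move=> ua v w; rewrite -lerBlDr; apply: ctransform_ge => z zl; rewrite lerBlDr.
have := ctransform_le l (replace z l v) ua; rewrite {1}/replace eqxx => /le_trans; apply.
by rewrite -zl; exact: slack_replace.
Qed.

(** Components are conjugated one after another. This never lowers them, and each conjugate inherits
    the Lipschitz constant of the cost. *)
Lemma lip_improvement u : admissible u ->
  exists u', [/\ admissible u', forall l, lip (u' l) & forall l v, u l v <= u' l v].
Proof.
move=> ua; suff H (s : seq 'I_m.+1) : exists u', [/\ admissible u',
    forall l, l \in s -> lip (u' l) & forall l v, u l v <= u' l v].
  by have [u' [H1 H2 H3]] := H (enum 'I_m.+1); exists u'; split => // l; apply: H2; rewrite mem_enum.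
elim: s => [|l s [u' [H1 H2 H3]]]; first by exists u; split.
exists (update u' l (ctransform u' l)); split; first exact: ctransform_admissible.
  move=> l'; rewrite inE /update; case: eqP => [_ _|_ /= l's]; last exact: H2.
  exact: ctransform_lip.
move=> l' v; rewrite /update; case: eqP => [->|_] //.
by apply: (le_trans (H3 _ _)); exact: ctransform_improves.
Qed.

Lemma cost_upper : exists2 T, 0 <= T & forall x, c x <= T.
Proof.
exists (\sum_(l < m.+1) B ^+ 2 / 2); first by apply: sumr_ge0 => l _; rewrite divr_ge0// sqr_ge0.
move=> x; apply: (le_trans (cost_le g x point)); apply: ler_sum => l _.
rewrite hsqE ler_pM2r// ler_pXn2r// ?nnegrE ?rdist_ge0//; exact: ltW.
Qed.

(* Constants are moved to index 0, whose potential is then replaced by its conjugate. *)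
Lemma dual_normalize : exists2 T, 0 <= T & forall u, admissible u -> (forall l, continuous (u l)) ->
  exists u', [/\ admissible u', forall l, lip (u' l), forall l v, `|u' l v| <= T &
    dual_value u <= dual_value u'].
Proof.
have [T T0 cT] := cost_upper; exists (T + m.+1%:R * (B * B)).
  by rewrite addr_ge0// mulr_ge0// mulr_ge0// ltW.
move=> u ua uc; have [u1 [u1a u1l uu1]] := lip_improvement ua.
pose s : R := \sum_(l | l != ord0) u1 l point.
(* Shifting leaves the sums unchanged and makes every component other than the first vanish at
   [point]; with Lipschitz constant and diameter both at most [B], it is then bounded by [B * B]. *)
pose u2 l v := if l == ord0 then u1 l v + s else u1 l v + - u1 l point.
have u2_0 v : u2 ord0 v = u1 ord0 v + s by rewrite /u2 eqxx.
have sum2 x : \sum_l u2 l (x l) = \sum_l u1 l (x l).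
  rewrite (bigD1 ord0)//= [RHS](bigD1 ord0)//= u2_0.
  rewrite (eq_bigr (fun l => u1 l (x l) - u1 l point)); last by move=> l /negPf l0; rewrite /u2 l0.
  by rewrite sumrB -/s; move: (\sum_(_ | _) _) => t; ring.
have u2a : admissible u2 by move=> x; rewrite sum2.
have u2l l : lip (u2 l).
  by move=> v w; rewrite /u2; case: eqP => _; have := u1l l v w; move: (B * _) => *; lra.
have val2 : dual_value u2 = dual_value u1.
  rewrite /dual_value (bigD1 ord0)//= [RHS](bigD1 ord0)//=.
  have -> : mean (mu ord0) (u2 ord0) = mean (mu ord0) (u1 ord0) + s.
    rewrite -mean_shift//; last exact: lip_continuous.
  rewrite [X in _ + X](eq_bigr (fun l => mean (mu l) (u1 l) - u1 l point)); last first.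
    move=> l /negPf l0; rewrite -mean_shift//; last exact: lip_continuous.
    by congr (mean _ _); apply/funext => v; rewrite /u2 l0.
  by rewrite sumrB -/s; move: (\sum_(_ | _) _) => t; ring.
have u2b l v : l != ord0 -> `|u2 l v| <= B * B.
  move=> /negPf l0; rewrite /u2 l0 ler_norml; have := u1l l v point; have := u1l l point v.
  rewrite (dsym point v).
  have : B * d v point <= B * B by rewrite ler_pM2l.
  by move: (B * d _ _) => *; apply/andP; split; lra.
have BB0 : 0 <= B * B by rewrite mulr_ge0// ltW.
exists (update u2 ord0 (ctransform u2 ord0)); split; first exact: ctransform_admissible.
- by move=> l; rewrite /update; case: eqP => _ //; exact: ctransform_lip.
- move=> l v; rewrite /update; case: eqP => [_|/eqP l0]; last first.
    apply: (le_trans (u2b _ _ l0)); apply: (@le_trans _ _ (m.+1%:R * (B * B))).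
      by rewrite ler_peMl// ler1n.
    by rewrite lerDr.
  have bnd z : `|\sum_(l' | l' != ord0) u2 l' (z l')| <= m.+1%:R * (B * B).
    apply: (le_trans (ler_norm_sum _ _ _)).
    apply: (@le_trans _ _ (\sum_(l' < m.+1 | l' != ord0) B * B)); first by apply: ler_sum => l' /u2b.
    apply: (@le_trans _ _ (\sum_(l' < m.+1) B * B)).
      by rewrite [leRHS](bigD1 ord0)//= lerDr.
    by rewrite sumr_const card_ord mulr_natl.
  rewrite ler_norml; apply/andP; split.
    apply: ctransform_ge => z _; have := bnd z; rewrite ler_norml /slack => /andP[_].
    by have := cost_ge0 hM cM reach z; move: (\sum_(_ | _) _) (_ * (B * B)) => *; lra.
  have := ctransform_le ord0 (fun=> v) u2a; have := bnd (fun=> v); rewrite ler_norml /slack => /andP[+ _].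
  by have := cT (fun=> v); move: (\sum_(_ | _) _) (_ * (B * B)) => *; lra.
rewrite (le_trans _ (_ : dual_value u2 <= _))//; last first.
  apply: dual_value_le => l; first exact: lip_continuous.
    by rewrite /update; case: eqP => _; apply: lip_continuous => //; exact: ctransform_lip.
  by move=> v; rewrite /update; case: eqP => [->|//]; exact: ctransform_improves.
by rewrite val2; apply: dual_value_le => // l; exact: lip_continuous.
Qed.

Lemma epsilon_net (e : R) : 0 < e -> exists s : seq M, forall v, exists2 w, w \in s & d w v < e.
Proof.
move=> e0; have := cM; rewrite compact_cover => /(_ M [set: M] (fun w : M => [set v | d w v < e]))[||D' _ D'P].
- by move=> w _; apply: (open_comp (f := d w) (D := [set t | t < e])); [move=> v _; exact: rdist_continuousr|exact: open_lt].
- by move=> v _; exists v => //=; rewrite rdistxx.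
by exists (finmap.enum_fset D') => v; have [w wD wv] := D'P v I; exists w.
Qed.

(** Tychonoff in place of Arzela-Ascoli: the cluster point approximates some [f k] on any finite
    set. A finite net and equal Lipschitz constants later make this uniform. *)
Lemma pointwise_cluster (I : choiceType) (T : R) (f : nat -> I -> R) : (forall k i, `|f k i| <= T) ->
  exists h : I -> R, (forall i, `|h i| <= T) /\
    forall (s : seq I) (e : R) (N : nat), 0 < e -> exists2 k, (N <= k)%N & forall i, i \in s -> `|f k i - h i| < e.
Proof.
move=> fT; have Tc : compact [set t : R | `|t| <= T].
  have -> : [set t : R | `|t| <= T] = `[- T, T]%classic.
    by apply/seteqP; split => t /=; rewrite in_itv/= ler_norml.
  exact: segment_compact.
have := @tychonoff I (fun=> R) (fun=> [set t : R | `|t| <= T]) (fun=> Tc).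
move=> /(_ (f @ \oo) _)[]; first by exists 0%N => // k _ i; exact: fT.
move=> h [hT hc]; exists h; split => // s e N e0.
have : nbhs (h : prod_topology (fun _ : I => R)) [set f' | forall i, i \in s -> `|f' i - h i| < e].
  apply: (@filter_seq _ (nbhs (h : prod_topology (fun _ : I => R))) _ _ s (fun i f' => `|f' i - h i| < e)) => i.
  have Hb : nbhs (h i) [set t : R | `|t - h i| < e].
    by apply/nbhs_ballP; exists e => //= t; rewrite -ball_normE/= distrC.
  exact: (@proj_continuous I (fun=> R) i h _ Hb).
move=> /(hc [set f' | exists2 k, (N <= k)%N & f k = f'])[|f' [[k Nk <-] H]].
  by exists N => // k Nk; exists k.
by exists k.
Qed.

Theorem dual_attained : exists u, [/\ admissible u, forall l, lip (u l),
  forall v, exists2 z, z ord0 = v & \sum_l u l (z l) = c z &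
  forall u', admissible u' -> (forall l, continuous (u' l)) -> dual_value u' <= dual_value u].
Proof.
have [T T0 norm] := dual_normalize.
pose V := [set dual_value u | u in [set u | admissible u /\ forall l, continuous (u l)]].
have V0 : V !=set0.
  exists (dual_value (fun _ _ => 0)), (fun _ _ => 0); split => //.
    by move=> x; rewrite big1//; exact: cost_ge0.
  by move=> l v; exact: cvg_cst.
have Vub : has_ubound V.
  exists (\sum_(l < m.+1) T) => _ [u [ua uc] <-]; have [u' [_ ul ub uu]] := norm u ua uc.
  apply: (le_trans uu); apply: ler_sum => l _; rewrite -[leRHS](mean_cst (mu l)).
  apply: mean_le => //; first exact: lip_continuous.
    by move=> v; exact: cvg_cst.
  by move=> v; apply: le_trans (ub l v); exact: ler_norm.
have /choice[f fP] (k : nat) : exists u, [/\ admissible u, forall l, lip (u l),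
    forall l v, `|u l v| <= T & sup V - k.+1%:R^-1 <= dual_value u].
  have k0 : 0 < (k.+1%:R^-1 : R) by rewrite invr_gt0.
  have [_ [u [ua uc] <-] uV] := sup_adherent k0 (conj V0 Vub).
  have [u' [H1 H2 H3 H4]] := norm u ua uc; exists u'; split => //.
  by apply: (le_trans _ H4); exact: ltW.
have [h [hT hP]] := @pointwise_cluster ('I_m.+1 * M)%type T (fun k lv => f k lv.1 lv.2)
  (fun k lv => let: And4 _ _ H _ := fP k in H lv.1 lv.2).
pose u l v := h (l, v).
have ua : admissible u.
  move=> x; apply: (@le_eps _ _ _ m.+1%:R) => // e e0.
  have [k _ kP] := hP [seq (l, x l) | l <- enum 'I_m.+1] e 0%N e0.
  have [fa _ _ _] := fP k; apply: (@le_trans _ _ (\sum_l (f k l (x l) + e))).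
    apply: ler_sum => l _; have := kP (l, x l) (map_f _ (mem_enum _ _)).
    by rewrite ltr_norml /u /= => /andP[? ?]; lra.
  by rewrite big_split/= sumr_const card_ord mulr_natl lerD2r; exact: fa.
have ul l : lip (u l).
  move=> v w; apply: (@le_eps _ _ _ 2) => // e e0.
  have [k _ kP] := hP [:: (l, v); (l, w)] e 0%N e0; have [_ fl _ _] := fP k.
  have := fl l v w; have := kP (l, v); rewrite inE eqxx => /(_ isT).
  have := kP (l, w); rewrite !inE eqxx orbT => /(_ isT); rewrite !ltr_norml /u /=.
  by move: (B * _) => ? /andP[? ?] /andP[? ?] *; lra.
have uc l : continuous (u l) by exact: lip_continuous.
have uV : sup V <= dual_value u.
  apply: (@le_eps _ _ _ (1 + m.+1%:R * (1 + 2 * B))).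
    by rewrite addr_ge0// mulr_ge0// addr_ge0// mulr_ge0// ltW.
  move=> e e0; have [s sP] := epsilon_net e0.
  have [N [N0 Ne]] := small_frac (ltr01 : 0 < (1 : R)) e0.
  have [k Nk kP] := hP [seq (l, w) | l <- enum 'I_m.+1, w <- s] e N e0.
  have [_ fl _ fV] := fP k.
  (* From [v] to a point [w] of the net and back, at the price of two Lipschitz bounds. *)
  have close l v : f k l v <= u l v + (1 + 2 * B) * e.
    have [w ws wv] := sP v; have := kP (l, w) (allpairs_f _ (mem_enum _ _) ws).
    have := fl l v w; have := ul l w v; rewrite (dsym v w).
    have : B * d w v <= B * e by rewrite ler_pM2l// ltW.
    rewrite ltr_norml /u /= (_ : (1 + 2 * B) * e = e + 2 * (B * e)); last by ring.
    by move: (B * d w v) (B * e) => *; lra.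
  have vk : dual_value (f k) <= dual_value u + m.+1%:R * ((1 + 2 * B) * e).
    apply: (@le_trans _ _ (\sum_l (mean (mu l) (u l) + (1 + 2 * B) * e))).
      apply: ler_sum => l _; rewrite -mean_shift//; apply: mean_le => //; first exact: lip_continuous.
      by move=> v; apply: cvgD; [exact: uc|exact: cvg_cst].
    by rewrite big_split/= sumr_const card_ord [m.+1%:R * _]mulr_natl.
  have ke : k.+1%:R^-1 <= e.
    apply: le_trans Ne; rewrite mul1r lef_pV2 ?posrE ?ltr0n// ler_nat.
    exact: leqW.
  move: fV vk ke; rewrite (_ : (1 + m.+1%:R * (1 + 2 * B)) * e = e + m.+1%:R * ((1 + 2 * B) * e)); last by ring.
  by move: (m.+1%:R * _) (k.+1%:R^-1) => *; lra.
(* One more conjugation provides a contact tuple over every point. *)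
pose u1 := update u ord0 (ctransform u ord0).
have u1l l : lip (u1 l) by rewrite /u1 /update; case: eqP => _ //; exact: ctransform_lip.
exists u1; split => //; first exact: ctransform_admissible.
  (* Overwriting the first entry encodes the constraint on it, so that the minimum can be taken over
     the whole compact power. *)
  move=> v; pose F z := slack u ord0 (replace z ord0 v).
  have Fc : continuous (F : power m.+1 M -> R).
    have B2 : 0 < 2 * B by rewrite mulr_gt0.
    apply: (lip_power_continuous B2) => x z; rewrite /F /slack.
    have := cost_lip hM cM reach (replace x ord0 v) (replace z ord0 v) dB.
    have S1 : \sum_l d (replace x ord0 v l) (replace z ord0 v l) <= \sum_l d (x l) (z l).
      apply: ler_sum => l _; rewrite /replace; case: eqP => _ //.
      by rewrite rdistxx rdist_ge0.
    have S2 : \sum_(l | l != ord0) u l (replace z ord0 v l) <=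
        \sum_(l | l != ord0) u l (replace x ord0 v l) + B * \sum_l d (x l) (z l).
      rewrite mulr_sumr [X in _ + X](bigD1 ord0)//= addrA addrAC.
      rewrite -[leLHS]addr0; apply: lerD; last by rewrite mulr_ge0 ?rdist_ge0// ltW.
      rewrite -big_split/=; apply: ler_sum => l /negPf l0; rewrite /replace l0.
      by rewrite (dsym (x l)); exact: ul.
    have S3 : B * \sum_l d (replace x ord0 v l) (replace z ord0 v l) <= B * \sum_l d (x l) (z l).
      by rewrite ler_pM2l.
    rewrite (_ : 2 * B * _ = B * \sum_l d (x l) (z l) + B * \sum_l d (x l) (z l)); last by ring.
    move: S2 S3; move: (B * _) (B * _) (\sum_(_ | _) _) (\sum_(_ | _) _) => *; lra.
  have cX := power_compact cM (k := m.+1).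
  have X0 : [set: power m.+1 M] !=set0 by exists (fun=> v).
  have [z _ zP] := compact_EVT_min X0 cX (continuous_subspaceT Fc).
  exists (replace z ord0 v); first by rewrite /replace eqxx.
  rewrite /u1 sum_update {1}/replace eqxx.
  suff -> : ctransform u ord0 v = slack u ord0 (replace z ord0 v) by rewrite /slack subrK.
  apply/eqP; rewrite eq_le; apply/andP; split.
    by have := ctransform_le ord0 (replace z ord0 v) ua; rewrite {1}/replace eqxx.
  apply: ctransform_ge => z' z'v; have := zP z'; rewrite inE => /(_ I)/le_trans; apply.
  rewrite le_eqVlt; apply/orP; left; apply/eqP; congr slack.
  by apply/funext => l; rewrite /replace; case: eqP => // ->.
move=> u' ua' uc'; apply: (@le_trans _ _ (sup V)).
  by apply: sup_upper_bound; [split|exists u'].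
apply: (le_trans uV); apply: dual_value_le => // l; first exact: lip_continuous.
by move=> v; rewrite /u1 /update; case: eqP => [->|//]; exact: ctransform_improves.
Qed.

End DualProblem.

(** * The transport map *)

Lemma push_probability {R : realType} {d d' : measure_display} {T : measurableType d}
  {T' : measurableType d'} (P : probability T R) (f : T -> T') : measurable_fun [set: T] f ->
  exists Q : probability T' R, (forall B, Q B = P (f @^-1` B)) /\
    forall h : T' -> \bar R, measurable_fun [set: T'] h -> P.-integrable [set: T] (h \o f) ->
      (\int[Q]_y h y = \int[P]_x h (f x))%E.
Proof.
move=> mf; pose X : {RV P >-> T'} := HB.pack f (isMeasurableFun.Build _ _ _ _ _ mf).
exists (distribution P X); split; first by [].
by move=> h mh ih; exact: (integral_distribution (X := X) mh ih).
Qed.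

Lemma continuous_borel_map {T U : ptopologicalType} (f : T -> U) : continuous f ->
  measurable_fun [set: borel T] (f : borel T -> borel U).
Proof.
move=> /continuousP cf; apply: (@measurability _ _ (borel T) (borel U) setT f (@open U) erefl).
by move=> _ [B oB <-]; rewrite setTI; apply: sub_sigma_algebra; exact: cf.
Qed.

(** * Borel probability measures are determined by integrals of continuous functions *)

Section MeansDetermine.
Context {R : realType} {n : nat} {M : ptopologicalType}.
Context {A : smooth_atlas R n M} (g : riemannian_metric A).
Hypothesis hM : hausdorff_space M.
Hypothesis cM : compact [set: M].
Hypothesis reach : forall x y, curve_lengths g x y !=set0.
Implicit Types (v w : M).

Local Notation d := (rdist g).

Variable C : set M.
Hypothesis C0 : C !=set0.
Hypothesis cC : closed C.

Definition setdist v := inf [set d v w | w in C].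

Lemma setdist_ge (t : R) v : (forall w, C w -> t <= d v w) -> t <= setdist v.
Proof.
move=> H; apply: lb_le_inf; first by have [w Cw] := C0; exists (d v w); exists w.
by move=> _ [w Cw <-]; exact: H.
Qed.

Lemma setdist_le v w : C w -> setdist v <= d v w.
Proof. by move=> Cw; apply: ge_inf; [exists 0 => _ [w' _ <-]; exact: rdist_ge0|exists w]. Qed.

Lemma setdist_continuous : continuous setdist.
Proof.
have lip v w : setdist v <= setdist w + d v w.
  rewrite -lerBlDr; apply: setdist_ge => y Cy; rewrite lerBlDr addrC.
  by apply: (le_trans (setdist_le v Cy)); exact: rdist_triangle.
move=> v; apply/cvgrPdist_lt => e e0.
apply: filterS (near_rdist hM reach v e0) => w vw; rewrite ltr_norml.
have := lip v w; have := lip w v; rewrite (rdist_sym reach w v) => *.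
by apply/andP; split; lra.
Qed.

(** Continuous functions that converge pointwise to the indicator of the closed set [C]. *)
Definition bump (k : nat) v : R := Order.max 0 (1 - k%:R * setdist v).

Lemma bump_continuous k : continuous (bump k).
Proof.
move=> v; apply: (@continuous_max R _ (fun=> 0) (fun v => 1 - k%:R * setdist v)).
  exact: cvg_cst.
apply: cvgB; first exact: cvg_cst.
by apply: cvgM; [exact: cvg_cst|exact: setdist_continuous].
Qed.

Lemma setdist_ge0 v : 0 <= setdist v.
Proof. by apply: setdist_ge => w _; exact: rdist_ge0. Qed.

Lemma bump_le1 k v : `|bump k v| <= 1.
Proof.
rewrite ger0_norm; last by rewrite le_max lexx.
by rewrite ge_max ler01 gerBl mulr_ge0// setdist_ge0.
Qed.

Lemma bump_cvg v : bump k v @[k --> \oo] --> (\1_C v : R).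
Proof.
rewrite indicE; have [/set_mem Cv|/negP] := boolP (v \in C).
  have -> : (fun k => bump k v) = fun=> 1; last exact: cvg_cst.
  apply/funext => k; rewrite /bump; have -> : setdist v = 0.
    apply/eqP; rewrite eq_le setdist_ge0 andbT; apply: (le_trans (setdist_le v Cv)).
    by rewrite rdistxx.
  by rewrite mulr0 subr0; apply/max_idPr.
rewrite inE => nCv; have nC : nbhs v (~` C) by apply: open_nbhs_nbhs; split => //; exact: closed_openC.
have [e e0 eP] := rdist_nbhs hM reach nC.
have dCe : e <= setdist v.
  by apply: setdist_ge => w Cw; rewrite leNgt; apply/negP => /eP.
apply: cvg_near_cst; exists (Num.bound e^-1) => //= k /= ek.
apply/max_idPl; rewrite subr_le0; apply: (@le_trans _ _ (k%:R * e)); last by rewrite ler_wpM2l.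
rewrite -ler_pdivrMr// mul1r; apply: ltW.
have /archi_boundP : 0 <= e^-1 by rewrite invr_ge0 ltW.
by move/lt_le_trans; apply; rewrite ler_nat.
Qed.

Lemma bump_integral_cvg (nu : probability (borel M) R) :
  (\int[nu]_x (bump k x)%:E)%E @[k --> \oo] --> nu C.
Proof.
have mC : measurable (C : set (borel M)) by exact: borel_closed.
have -> : nu C = (\int[nu]_x (\1_C x : R)%:E)%E by rewrite integral_indic// setIT.
have [|||||_ _ H] := @dominated_convergence _ (borel M) R nu setT measurableT
  (fun k x => (bump k x)%:E) (fun x => (\1_C x : R)%:E) (fun=> 1%E).
- by move=> k; apply/measurable_EFinP; apply: continuous_borel; exact: bump_continuous.
- by apply/measurable_EFinP; exact: measurable_indic.
- by apply: aeW => x _; apply: cvg_EFin; [exact: nearW|exact: bump_cvg].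
- by apply: (@bounded_integrable R _ (borel M) nu (fun=> 1) 1); [exact: measurable_cst|move=> _; rewrite normr1].
- by apply: aeW => x k _; rewrite abse_EFin lee_fin; exact: bump_le1.
exact: H.
Qed.

End MeansDetermine.

Section PushForward.
Context {R : realType} {n : nat} {M : ptopologicalType}.
Context {A : smooth_atlas R n M} (g : riemannian_metric A).
Hypothesis hM : hausdorff_space M.
Hypothesis cM : compact [set: M].
Hypothesis reach : forall x y, curve_lengths g x y !=set0.

(** Bumps give equality on closed sets, hence on open sets by complement; these are stable under
    intersection and generate the Borel sets. *)
Lemma means_determine (nu nu' : probability (borel M) R) :
  (forall f, continuous f -> mean nu f = mean nu' f) ->
  forall B : set (borel M), measurable B -> nu B = nu' B.
Proof.
move=> H; have Hc C : closed C -> nu C = nu' C.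
  move=> cC; have [C0|/set0P C0] := eqVneq C set0; first by rewrite C0 !measure0.
  have H1 := bump_integral_cvg hM reach C0 cC (nu := nu); have H2 := bump_integral_cvg hM reach C0 cC (nu := nu').
  have E : (fun k => \int[nu]_x (bump g C k x)%:E)%E = (fun k => \int[nu']_x (bump g C k x)%:E)%E.
    apply/funext => k; have bc := bump_continuous hM reach C0 (k := k).
    by rewrite !(mean_EFin cM)//; congr (_%:E); exact: H.
  by rewrite E in H1; exact: (cvg_unique _ H1 H2).
refine (@measure_unique _ R (borel M) (@open M) (fun=> setT) _ _ _ _ nu nu' _ _).
- by [].
- by move=> U V oU oV; exact: openI.
- by move=> _; exact: openT.
- by rewrite -subTset => x _; exists 0%N.
- move=> U oU; rewrite -[U]setCK.
  have mU : measurable (~` U : set (borel M)) by apply: borel_closed; exact: open_closedC.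
  transitivity (1 - nu (~` U : set (borel M)))%E; first exact: (probability_setC nu mU).
  rewrite (Hc (~` U)); last exact: open_closedC.
  by symmetry; exact: (probability_setC nu' mU).
- by move=> _; apply: (le_lt_trans (probability_le1 nu measurableT)); rewrite ltry.
Qed.

End PushForward.

(* [power m M] has no canonical [ptopologicalType] structure; importing this one inside the
   section below leaves the reading of the theorem unchanged. *)
Module PointedPower.
HB.instance Definition _ (I : Type) (T : I -> ptopologicalType) := Pointed.on (prod_topology T).
End PointedPower.

Section TransportMap.
Import PointedPower.
Context {R : realType} {n : nat} {M : ptopologicalType}.
Context {A : smooth_atlas R n M} (g : riemannian_metric A).
Hypothesis hM : hausdorff_space M.
Hypothesis cM : compact [set: M].
Hypothesis reach : forall x y, curve_lengths g x y !=set0.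
Variables (m : nat) (mu : 'I_m.+1 -> probability (borel M) R).
Variable B : R.
Hypothesis B0 : 0 < B.
Hypothesis dB : forall x y, rdist g x y <= B.
Variable u : 'I_m.+1 -> M -> R.
Hypothesis u_adm : admissible g u.
Hypothesis u_lip : forall l, lip g B (u l).
Hypothesis u_cover : forall v, exists2 z, z ord0 = v & contact g u z.
Hypothesis u_max : forall u', admissible g u' -> (forall l, continuous (u' l)) ->
  dual_value mu u' <= dual_value mu u.
Variable N : set M.
Hypothesis N_meas : measurable (N : set (borel M)).
Hypothesis N_null : mu ord0 N = 0%E.
Hypothesis N_regular : forall x, ~ N x -> regular g (u ord0) x.
Implicit Types (x v w : M) (z : 'I_m.+1 -> M) (l : 'I_m.+1).

Local Notation c := (cost g m.+1).

Lemma u_continuous l : continuous (u l).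
Proof. exact: (lip_continuous hM reach B0). Qed.

Lemma coordinate_continuous (f : M -> R) l : continuous f -> continuous (fun z : power m.+1 M => f (z l)).
Proof.
move=> cf z; apply: (@continuous_comp _ _ _ (fun z : power m.+1 M => z l) f); last exact: cf.
exact: (@proj_continuous _ (fun=> M) l z).
Qed.

Definition gap z : R := c z - \sum_l u l (z l).

Lemma gap_continuous : continuous (gap : power m.+1 M -> R).
Proof.
have cc := cost_continuous hM cM reach (k := m.+1).
have sc : continuous (fun z : power m.+1 M => \sum_l u l (z l)).
  by apply: sum_continuous => l; apply: coordinate_continuous; exact: u_continuous.
by move=> z; apply: cvgB; [exact: cc|exact: sc].
Qed.

Lemma gap_ge0 z : 0 <= gap z.
Proof. by rewrite subr_ge0; exact: u_adm. Qed.

Lemma gap_contact z : contact g u z <-> gap z = 0.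
Proof.
by rewrite /contact /gap; split => [->|/eqP]; [rewrite subrr|rewrite subr_eq0 => /eqP ->].
Qed.

Lemma contact_unique_off x z z' : ~ N x -> z ord0 = x -> z' ord0 = x ->
  contact g u z -> contact g u z' -> z = z'.
Proof.
move=> /N_regular[s [i [p [s0 tw up]]]] zx z'x cz cz'.
subst x; have zz : z ord0 = z' ord0 by [].
exact: (contact_unique hM cM reach u_adm s0 zz cz cz' tw up).
Qed.

(** Measurability: the contact tuples outside an open set [V] form a compact set, whose projection
    to the first entry is closed. Off [N], where contact tuples are unique, [G x] lies in [V]
    exactly when [x] is not in this projection. *)
Lemma transport_map : exists G : M -> 'I_m.+1 -> M, [/\ forall x, G x ord0 = x,
  forall x, ~ N x -> contact g u (G x) &
  measurable_fun [set: borel M] (G : borel M -> borel (power m.+1 M))].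
Proof.
have /choice[Z ZP] v : exists z, z ord0 = v /\ contact g u z by have [z] := u_cover v; exists z.
(* On [N] a continuous default that keeps the first entry, so that the preimages remain Borel
   there. *)
pose P x : power m.+1 M := dfwith (fun=> point) ord0 x.
pose G x := if `[< N x >] then P x else Z x.
have Pc : continuous P by exact: dfwith_continuous.
have GN x : N x -> G x = P x by rewrite /G => /asboolP ->.
have GnN x : ~ N x -> G x = Z x by rewrite /G => /asboolPn/negPf ->.
exists G; split.
- by move=> x; rewrite /G; case: ifP => _; [rewrite /P dfwithin|case: (ZP x)].
- by move=> x /GnN ->; case: (ZP x).
apply: (@measurability _ _ (borel M) (borel (power m.+1 M)) setT G (@open (power m.+1 M)) erefl).
move=> _ [V Vo <-]; rewrite setTI.
pose S := [set z : power m.+1 M | gap z <= 0] `&` ~` V.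
have cS : compact S.
  apply: (subclosed_compact _ (power_compact cM (k := m.+1))) => //.
  apply: closedI; last exact: open_closedC.
  apply: (preimage_closed (D := [set t : R | t <= 0])); last exact: closed_le.
  by move=> z _; exact: gap_continuous.
have cT : closed ((fun z : power m.+1 M => z ord0) @` S).
  apply: compact_closed => //; apply: continuous_compact => //; apply: continuous_subspaceT.
  by move=> z; exact: (@proj_continuous _ (fun=> M) ord0 z).
have -> : G @^-1` V = (N `&` P @^-1` V) `|` (~` N `&` ~` ((fun z : power m.+1 M => z ord0) @` S)).
  apply/seteqP; split => x /=.
    have [Nx|nNx] := pselect (N x); first by rewrite GN//; left.
    rewrite GnN// => VZ; right; split => // -[z [/= gz nV] zx]; apply: nV.
    have [Zx cZ] := ZP x.
    suff -> : z = Z x by [].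
    apply: (contact_unique_off nNx) => //; apply/gap_contact/eqP.
    by rewrite eq_le gz gap_ge0.
  move=> [[Nx]|[nNx nS]]; first by rewrite GN.
  rewrite GnN//; apply: contrapT => nV; apply: nS; have [Zx /gap_contact cZ] := ZP x.
  by exists (Z x) => //; split => //=; rewrite cZ.
apply: measurableU; apply: measurableI => //.
- by apply: borel_open; move/continuousP: Pc; exact.
- exact: measurableC.
- by apply: measurableC; exact: borel_closed.
Qed.

(** Quantitative uniqueness: over [x], the tuples whose value of [f] exceeds that of the contact
    tuple by [e] form a compact set without contact tuples, so the gap has a positive minimum
    there. *)
Lemma contact_gap f x z l (e : R) : continuous f -> ~ N x -> z ord0 = x -> contact g u z -> 0 < e ->
  exists2 dt : R, 0 < dt & forall z', z' ord0 = x -> f (z l) + e <= f (z' l) -> dt <= gap z'.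
Proof.
move=> cf nNx zx cz e0.
pose K := [set z' : power m.+1 M | z' ord0 = x] `&` [set z' : power m.+1 M | f (z l) + e <= f (z' l)].
have cK : compact K.
  apply: (subclosed_compact _ (power_compact cM (k := m.+1))) => //; apply: closedI.
    apply: (preimage_closed (f := fun z' : power m.+1 M => z' ord0) (D := [set x])).
      by move=> z' _; exact: (@proj_continuous _ (fun=> M) ord0 z').
    exact: accessible_closed_set1 (hausdorff_accessible hM) x.
  apply: (preimage_closed (D := [set t : R | f (z l) + e <= t])); last exact: closed_ge.
  by move=> z' _; exact: coordinate_continuous.
have [K0|/set0P K0] := eqVneq K set0.
  by exists 1 => // z' z'x fz'; have : K z' by []; rewrite K0.
have [z1 /set_mem[z1x fz1] zmin] := compact_EVT_min K0 cK (continuous_subspaceT gap_continuous).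
exists (gap z1); last by move=> z' z'x fz'; apply: zmin; exact: mem_set.
rewrite lt_neqAle gap_ge0 andbT eq_sym; apply/eqP => /gap_contact cz1.
have E := contact_unique_off nNx zx z1x cz cz1.
by move: fz1; rewrite /= -E gerDl leNgt e0.
Qed.

Lemma slack_gap z : slack g u ord0 z = u ord0 (z ord0) + gap z.
Proof. by rewrite /slack /gap [X in _ = _ + (_ - X)](bigD1 ord0)//=; move: (\sum_(_ | _) _) => t; ring. Qed.

Definition perturb f l (e : R) := update u l (fun v => u l v + e * f v).

Lemma perturb_admissible f l (e : R) : (forall v, f v <= 0) -> 0 <= e -> admissible g (perturb f l e).
Proof.
move=> f0 e0 x; rewrite sum_update; apply: le_trans (u_adm x); rewrite [leRHS](bigD1 l)//=.
by rewrite lerD2r gerDl mulr_ge0_le0.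
Qed.

Lemma perturb_slack f l (e : R) z : l != ord0 ->
  slack g (perturb f l e) ord0 z = u ord0 (z ord0) + gap z - e * f (z l).
Proof.
move=> l0; rewrite -slack_gap /slack (bigD1 l)//= [in RHS](bigD1 l)//= {1}/perturb /update eqxx.
rewrite (eq_bigr (fun l' => u l' (z l'))); first by move: (\sum_(_ | _) _) => t; ring.
by move=> l' /andP[_ /negPf l'l]; rewrite /perturb /update l'l.
Qed.

Variable G : M -> 'I_m.+1 -> M.
Hypothesis G_fst : forall x, G x ord0 = x.
Hypothesis G_contact : forall x, ~ N x -> contact g u (G x).
Hypothesis G_meas : measurable_fun [set: borel M] (G : borel M -> borel (power m.+1 M)).

Lemma transport_coordinate l : measurable_fun [set: borel M] ((fun x => G x l) : borel M -> borel M).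
Proof.
apply: (@measurableT_comp _ _ _ (borel M) (borel (power m.+1 M)) (borel M)
  (fun z : power m.+1 M => z l)) => //.
by apply: continuous_borel_map => z; exact: (@proj_continuous _ (fun=> M) l z).
Qed.

Lemma contact_off z : ~ N (z ord0) -> contact g u z -> z = G (z ord0).
Proof. by move=> nN cz; apply: (contact_unique_off nN) => //; exact: G_contact. Qed.

(** * First variation of the dual value *)

Section FirstVariation.
Variables (f : M -> R) (T : R) (l : 'I_m.+1).
Hypothesis l0 : l != ord0.
Hypothesis f_cont : continuous f.
Hypothesis f_le0 : forall v, f v <= 0.
Hypothesis f_ge : forall v, - T <= f v.

(** The difference quotient of the conjugate with respect to the size of the perturbation; its limit
    is an envelope formula. *)
Definition variation (e : R) x := (ctransform g (perturb f l e) ord0 x - u ord0 x) / e.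

Lemma variation_ge0 e x : 0 < e -> 0 <= variation e x.
Proof.
move=> e0; apply: divr_ge0; last exact: ltW.
rewrite subr_ge0; have := ctransform_improves ord0 x (perturb_admissible l f_le0 (ltW e0)).
by rewrite /perturb {1}/update eq_sym (negPf l0).
Qed.

Lemma variation_le e x : ~ N x -> 0 < e -> variation e x <= - f (G x l).
Proof.
move=> nN e0; rewrite ler_pdivrMr// lerBlDr.
have := ctransform_le ord0 (G x) (perturb_admissible l f_le0 (ltW e0)).
rewrite perturb_slack// G_fst; have /gap_contact -> := G_contact nN.
by move/le_trans; apply; rewrite addr0 addrC mulNr mulrC.
Qed.

(** Tuples whose [f] exceeds that of the contact tuple by [r] have a gap of at least [dt], which
    exceeds [T * e], hence [- f (G x l) * e], for small [e]. All other tuples satisfy the bound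
    directly. *)
Lemma variation_ge x (r : R) : ~ N x -> 0 < r ->
  exists2 e0 : R, 0 < e0 & forall e, 0 < e -> e <= e0 -> - f (G x l) - r <= variation e x.
Proof.
move=> nN r0; have T0 : 0 <= T by have := f_ge point; have := f_le0 point; lra.
have [dt dt0 dtP] := contact_gap l f_cont nN (G_fst x) (G_contact nN) r0.
exists (dt / (T + 1)); first by rewrite divr_gt0//; lra.
move=> e e0; rewrite ler_pdivlMr; last by lra.
move=> edt; rewrite ler_pdivlMr// lerBrDr; apply: ctransform_ge => z zx.
rewrite perturb_slack// zx; have [fz|fz] := leP (f (G x l) + r) (f (z l)).
  have := dtP z zx fz; have : - f (G x l) * e <= T * e by rewrite ler_pM2r// lerNl.
  have : e * f (z l) <= 0 by rewrite pmulr_rle0.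
  have : 0 <= r * e by rewrite mulr_ge0// ltW.
  move: edt; rewrite mulrDr mulr1 mulrBl [e * T]mulrC.
  by move: (T * e) (r * e) (e * _) (_ * e) => *; lra.
have : e * f (z l) <= e * (f (G x l) + r) by rewrite ler_pM2l// ltW.
have := gap_ge0 z; rewrite mulrDr mulrBl mulNr [f _ * e]mulrC [r * e]mulrC.
by move: (e * _) (e * _) (e * _) => *; lra.
Qed.

Lemma variation_cvg x : ~ N x -> variation k.+1%:R^-1 x @[k --> \oo] --> - f (G x l).
Proof.
move=> nN; apply/cvgrPdist_lt => r r0.
have r20 : 0 < r / 2 by rewrite divr_gt0.
have [e0 e00 eP] := variation_ge nN r20.
have := @near_infty_natSinv_lt R (PosNum e00); apply: filterS => k /= ke.
have k0 : 0 < (k.+1%:R^-1 : R) by rewrite invr_gt0.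
have := eP _ k0 (ltW ke); have := variation_le nN k0.
by move: (variation _ _) => t *; rewrite ltr_norml; apply/andP; split; lra.
Qed.

Lemma variation_continuous e : 0 < e -> continuous (variation e).
Proof.
move=> e0 x; apply: cvgM; last exact: cvg_cst.
apply: cvgB; last exact: u_continuous.
apply: (lip_continuous hM reach B0); apply: (ctransform_lip hM cM reach dB).
exact: perturb_admissible (ltW e0).
Qed.

(** Maximality of [u] against the perturbed tuple with conjugated first component: the components
    other than the first and the [l]-th cancel. *)
Lemma variation_mean e : 0 < e -> mean (mu ord0) (variation e) <= - mean (mu l) f.
Proof.
move=> e0.
have pa : admissible g (perturb f l e) by exact: perturb_admissible (ltW e0).
have pc l' : continuous (update (perturb f l e) ord0 (ctransform g (perturb f l e) ord0) l').
  rewrite {1}/update; case: eqP => _.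
    by apply: (lip_continuous hM reach B0); exact: (ctransform_lip hM cM reach dB).
  rewrite /perturb /update; case: eqP => _; last exact: u_continuous.
  move=> v; apply: cvgD; first exact: u_continuous.
  by apply: cvgM; [exact: cvg_cst|exact: f_cont].
have := u_max (ctransform_admissible ord0 pa) pc.
rewrite /dual_value (bigD1 ord0)//= [leRHS](bigD1 ord0)//= {1}/update eqxx.
rewrite (bigD1 l)//= [X in _ <= _ + X](bigD1 l)//=.
have -> : update (perturb f l e) ord0 (ctransform g (perturb f l e) ord0) l = fun v => u l v + e * f v.
  by rewrite /update (negPf l0) /perturb /update eqxx.
rewrite (eq_bigr (fun l' => mean (mu l') (u l'))); last first.
  by move=> l' /andP[/negPf l'0 /negPf l'l]; rewrite {1}/update l'0 /perturb /update l'l.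
have E1 : mean (mu ord0) (ctransform g (perturb f l e) ord0) =
    mean (mu ord0) (u ord0) + e * mean (mu ord0) (variation e).
  rewrite -mean_linear//; last 2 first.
  - exact: u_continuous.
  - exact: variation_continuous.
  congr (mean _ _); apply/funext => v; rewrite /variation mulrCA divff ?gt_eqF// mulr1.
  by rewrite addrC subrK.
rewrite E1 mean_linear//; last exact: u_continuous.
rewrite -[_ <= - _](ler_pM2l e0).
by rewrite mulrN; move: (\sum_(_ | _) _) (e * _) (e * _) => *; lra.
Qed.

(** [variation_mean] passes to the limit by dominated convergence with the constant bound [T], as
    [variation_cvg] holds off the null set [N]. *)
Lemma mean_le_transport (Q : probability (borel M) R) :
  (forall h : borel M -> \bar R, measurable_fun [set: borel M] h ->
    (mu ord0).-integrable [set: borel M] (h \o (fun x => G x l)) ->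
    (\int[Q]_y h y = \int[mu ord0]_x h (G x l))%E) ->
  mean (mu l) f <= mean Q f.
Proof.
move=> HQ; have mN : (mu ord0).-negligible N by exists N; split.
have T0 : 0 <= T by have := f_ge point; have := f_le0 point; lra.
have fGm : measurable_fun [set: borel M] ((fun x => f (G x l)) : borel M -> R).
  apply: (@measurableT_comp _ _ _ (borel M) (borel M) R f); last exact: transport_coordinate.
  exact: continuous_borel.
have [|||||_ _ H] := @dominated_convergence _ (borel M) R (mu ord0) setT measurableT
  (fun k x => (variation k.+1%:R^-1 x)%:E) (fun x => (- f (G x l))%:E) (fun=> T%:E).
- by move=> k; apply/measurable_EFinP; apply: continuous_borel; apply: variation_continuous; rewrite invr_gt0.
- by apply/measurable_EFinP; exact: measurableT_comp.
- apply: negligibleS mN => x /= H; apply: contrapT => nN; apply: H => _.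
  by apply: cvg_EFin; [exact: nearW|exact: variation_cvg].
- by apply: (@bounded_integrable R _ (borel M) _ (fun=> T) T); [exact: measurable_cst|move=> _; rewrite ger0_norm].
- apply: negligibleS mN => x /= H; apply: contrapT => nN; apply: H => k _.
  have k0 : 0 < (k.+1%:R^-1 : R) by rewrite invr_gt0.
  rewrite lee_fin ger0_norm ?variation_ge0//; apply: (le_trans (variation_le nN k0)).
  by rewrite lerNl.
have E : (\int[mu ord0]_x (- f (G x l))%:E)%E = (- mean Q f)%:E.
  have cNf : continuous (fun v => - f v) by move=> v; apply: cvgN; exact: f_cont.
  rewrite -(HQ (fun v => (- f v)%:E)).
  - rewrite mean_EFin//; congr (_%:E).
    transitivity (mean Q (fun v => 0 + -1 * f v)).
      by congr (mean _ _); apply/funext => v; rewrite add0r mulN1r.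
    rewrite mean_linear//; first by rewrite mean_cst add0r mulN1r.
    by move=> v; exact: cvg_cst.
  - by apply/measurable_EFinP; exact: continuous_borel.
  - apply: (@bounded_integrable R _ (borel M) _ (fun x => - f (G x l)) T); first exact: measurableT_comp.
    by move=> x; rewrite normrN ler_norml f_ge (le_trans (f_le0 _)).
rewrite E in H; rewrite -lerN2 -lee_fin; apply: (cvge_to_le H); apply: nearW => k.
have k0 : 0 < (k.+1%:R^-1 : R) by rewrite invr_gt0.
rewrite /= mean_EFin//; last exact: variation_continuous.
by rewrite lee_fin; exact: variation_mean.
Qed.

End FirstVariation.

(** First variation gives one inequality between the integrals of each continuous [f]; applied to
    [- f] it gives the other one, and the integrals determine the measure. *)
Lemma transport_pushforward l (D : set (borel M)) : measurable D ->
  mu ord0 ((fun x => G x l) @^-1` D) = mu l D.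
Proof.
have [->|l0] := eqVneq l ord0; first by move=> _; congr (mu _ _);
  apply/seteqP; split => x /=; rewrite G_fst.
have [Q [QE HQ]] := push_probability (mu ord0) (transport_coordinate l).
rewrite -QE; apply: (means_determine hM cM reach).
(* Subtracting a bound [T] makes [f] nonpositive, which keeps the perturbed potentials admissible;
   the constant cancels in the end. *)
have ineq f : continuous f -> mean (mu l) f <= mean Q f.
  move=> cf; have [T T0 fT] := continuous_bounded cM cf.
  have cfT : continuous (fun v => f v + - T) by move=> v; apply: cvgD; [exact: cf|exact: cvg_cst].
  have fT1 v : f v + - T <= 0 by rewrite subr_le0; apply: le_trans (fT v); exact: ler_norm.
  have fT2 v : - (2 * T) <= f v + - T by have := fT v; rewrite ler_norml => /andP[]; lra.
  by have := mean_le_transport l0 cfT fT1 fT2 HQ; rewrite !mean_shift// lerD2r.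
move=> f cf; apply/eqP; rewrite eq_le ineq// andbT.
have cNf : continuous (fun v => 0 + -1 * f v).
  by move=> v; apply: cvgD; [exact: cvg_cst|apply: cvgM; [exact: cvg_cst|exact: cf]].
have := ineq _ cNf; rewrite !mean_linear//; try by move=> v; exact: cvg_cst.
by rewrite !mean_cst !add0r !mulN1r lerN2.
Qed.

(** The infimum in the cost may be tested on a countable dense set, the union of the finite nets of
    mesh [1 / (k + 1)]. *)
Lemma cost_ltP : exists q : nat -> M, forall z (t : R),
  c z < t <-> exists k, \sum_l hsq g (q k) (z l) < t.
Proof.
have /choice[s sP] (k : nat) : exists s : seq M, forall v, exists2 w, w \in s & rdist g w v < k.+1%:R^-1.
  by apply: (epsilon_net hM cM reach); rewrite invr_gt0.
exists (fun k => if unpickle k is Some (i, j) then nth point (s i) j else point) => z t; split.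
  have [y ->] := cost_attained hM cM reach z => yt.
  have yc : continuous (fun y => \sum_l hsq g y (z l)).
    apply: sum_continuous => l v.
    have -> : (fun y => hsq g y (z l)) = hsq g (z l) by apply/funext => w; exact: hsq_sym.
    exact: hsq_continuous.
  have Un : nbhs y [set w | \sum_l hsq g w (z l) < t].
    apply: open_nbhs_nbhs; split => //.
    by apply: (open_comp (D := [set r : R | r < t])); [move=> w _; exact: yc|exact: open_lt].
  have [e e0 eP] := rdist_nbhs hM reach Un.
  have [i ie] : exists i : nat, i.+1%:R^-1 < e.
    by have [i _ /(_ i (leqnn i))] := @near_infty_natSinv_lt R (PosNum e0); exists i.
  have [w wi wy] := sP i y; exists (pickle (i, index w (s i))).
  rewrite pickleK nth_index//; apply: eP; rewrite rdist_sym//; exact: lt_trans ie.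
by move=> [k]; apply: le_lt_trans; exact: (cost_le g z).
Qed.

(** * Optimality of plans *)

Section Plan.
Context {dT : measure_display} {T : measurableType dT} (P : probability T R).
Variable X : T -> 'I_m.+1 -> M.
Hypothesis X_meas : forall l, measurable_fun [set: T] ((fun t => X t l) : T -> borel M).
Hypothesis X_law : forall l (D : set (borel M)), measurable D -> P ((fun t => X t l) @^-1` D) = mu l D.

Let total t : R := \sum_l u l (X t l).

Let continuous_measurable (f : M -> R) l : continuous f -> measurable_fun [set: T] (fun t => f (X t l)).
Proof.
move=> cf; apply: (@measurableT_comp _ _ _ T (borel M) R f); last exact: X_meas.
exact: continuous_borel.
Qed.

(** Plans are random tuples [X], which covers couplings (the identity on the power) and maps (the
    graph over [M]) at once. Such an [X] is known to be measurable entry by entry only; by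
    [cost_ltP] the strict sublevel sets of its cost are countable unions of sets defined by sums
    over entries. *)
Lemma plan_cost_measurable : measurable_fun [set: T] (fun t => c (X t)).
Proof.
have [q qP] := cost_ltP; apply: (measurability _ (RGenInftyO.measurableE R)).
move=> _ [_ [t ->] <-]; rewrite setTI.
have -> : (fun w : T => c (X w)) @^-1` `]-oo, t[%classic =
    \bigcup_k ((fun w : T => \sum_l hsq g (q k) (X w l)) @^-1` `]-oo, t[%classic).
  apply/seteqP; split => w /=; rewrite in_itv/=.
    by move=> /qP[k kt]; exists k => //=; rewrite in_itv.
  by move=> [k _ /=]; rewrite in_itv/= => kt; apply/qP; exists k.
apply: bigcupT_measurable => k; rewrite -[_ @^-1` _]setTI.
have mk : measurable_fun [set: T] (fun w : T => \sum_l hsq g (q k) (X w l)).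
  by apply: measurable_sum => l; apply: continuous_measurable; exact: hsq_continuous.
by apply: mk => //; exact: measurable_itv.
Qed.

Lemma plan_potential l : P.-integrable [set: T] (fun t => (u l (X t l))%:E).
Proof.
have [K _ uK] := continuous_bounded cM (@u_continuous l).
by apply: (@bounded_integrable R _ T P (fun t => u l (X t l)) K) => //; apply: continuous_measurable; exact: u_continuous.
Qed.

Lemma plan_total_integrable : P.-integrable [set: T] (fun t => (total t)%:E).
Proof.
have -> : (fun t => (total t)%:E) = (fun t => \sum_l (u l (X t l))%:E)%E by apply/funext => t; rewrite sumEFin.
by apply: integrable_sum => // l _; exact: plan_potential.
Qed.

Lemma plan_total : (\int[P]_t (total t)%:E)%E = (dual_value mu u)%:E.
Proof.
under eq_integral do rewrite -sumEFin.
rewrite integral_sum//; last by move=> l; exact: plan_potential.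
rewrite /dual_value -sumEFin; apply: eq_bigr => l _.
have [Q [QE HQ]] := push_probability P (X_meas l).
rewrite -(HQ (fun v => (u l v)%:E)); last 2 first.
- by apply/measurable_EFinP; apply: continuous_borel; exact: u_continuous.
- exact: plan_potential.
rewrite -mean_EFin//; last exact: u_continuous.
by apply: eq_measure_integral => D mD _; transitivity (P ((fun t => X t l) @^-1` D)); [exact: QE|exact: X_law].
Qed.

Lemma plan_cost_integrable : P.-integrable [set: T] (fun t => (c (X t))%:E).
Proof.
have [K _ cK] := cost_upper m B0 dB.
apply: (@bounded_integrable R _ T P (fun t => c (X t)) K); first exact: plan_cost_measurable.
by move=> t; rewrite ger0_norm//; exact: cost_ge0.
Qed.

Lemma plan_cost_ge : ((dual_value mu u)%:E <= \int[P]_t (c (X t))%:E)%E.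
Proof.
rewrite -plan_total; apply: le_integral => //; first exact: plan_total_integrable.
  exact: plan_cost_integrable.
by move=> t _; rewrite lee_fin; exact: u_adm.
Qed.

(** The gap is nonnegative, and by duality its integral along the plan is zero. *)
Lemma plan_optimal : (\int[P]_t (c (X t))%:E <= (dual_value mu u)%:E)%E ->
  P.-negligible [set t | ~ contact g u (X t)].
Proof.
move=> H; have E : (\int[P]_t (c (X t))%:E = (dual_value mu u)%:E)%E.
  by apply/eqP; rewrite eq_le H plan_cost_ge.
have E0 : (\int[P]_t ((c (X t))%:E - (total t)%:E) = 0)%E.
  rewrite integralB_EFin//; last 2 first.
  - exact: plan_cost_integrable.
  - exact: plan_total_integrable.
  by rewrite E plan_total subee.
have mgap : measurable_fun [set: T] (fun t => ((c (X t))%:E - (total t)%:E)%E).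
  apply: emeasurable_funB; first by apply/measurable_EFinP; exact: plan_cost_measurable.
  exact: measurable_int plan_total_integrable.
have : ae_eq P setT (fun t => ((c (X t))%:E - (total t)%:E)%E) (cst 0%E).
  apply/(ae_eq_integral_abs _ measurableT mgap); rewrite -[RHS]E0; apply: eq_integral => t _.
  by rewrite gee0_abs// -EFinB lee_fin; exact: gap_ge0.
apply: negligibleS => t /= nc E1; apply: nc; have := E1 I => /= -[] E2.
by apply/gap_contact.
Qed.

End Plan.

Lemma transport_cost : (\int[mu ord0]_x (c (G x))%:E)%E = (dual_value mu u)%:E.
Proof.
have Gl := transport_coordinate; have Gp l D := @transport_pushforward l D.
rewrite -(plan_total (P := mu ord0) (X := G))//.
apply: ae_eq_integral => //.
- by apply/measurable_EFinP; exact: (plan_cost_measurable (T := borel M) (X := G)).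
- - apply: measurable_int; exact: (plan_total_integrable (mu ord0) (X := G)).
exists N; split => // x /= H; apply: contrapT => nN; apply: H => _.
by congr (_%:E); rewrite (G_contact nN).
Qed.

Definition transport_components (j : 'I_m) x := G x (lift ord0 j).

Lemma graph_transport : graph_map transport_components = G.
Proof.
by apply/funext => x; apply/funext => l; rewrite /graph_map; case: unliftP => [j ->|->].
Qed.

Lemma graph_law F : monge_admissible mu F -> forall l,
  measurable_fun [set: borel M] ((fun x => graph_map F x l) : borel M -> borel M) /\
  forall D : set (borel M), measurable D -> mu ord0 ((fun x => graph_map F x l) @^-1` D) = mu l D.
Proof.
move=> Fa l; rewrite /graph_map; case: unliftP => [j ->|->]; first exact: Fa.
by split => // D mD.
Qed.

Lemma transport_monge : monge_solution c mu transport_components.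
Proof.
split; first by move=> j; split; [exact: transport_coordinate|move=> D mD; exact: transport_pushforward].
move=> F' /graph_law Fa; rewrite graph_transport transport_cost; apply: plan_cost_ge => l; first by case: (Fa l).
by case: (Fa l).
Qed.

Lemma monge_solution_ae F (j : 'I_m) : monge_solution c mu F -> {ae mu ord0, forall x, F j x = transport_components j x}.
Proof.
move=> [/graph_law Fa Fmin]; have [N' [mN' N'0 HN']] : (mu ord0).-negligible [set x | ~ contact g u (graph_map F x)].
  apply: plan_optimal; [by move=> l; case: (Fa l)|by move=> l; case: (Fa l)|].
  rewrite -transport_cost; by apply: (le_trans (Fmin _ (proj1 transport_monge))); rewrite graph_transport.
have NN : (mu ord0).-negligible (N `|` N').
  by apply: negligibleU; [exists N; split|exists N'; split].
apply: negligibleS NN => x /= H; have [Nx|nN] := pselect (N x); [by left|right].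
apply: HN' => /= cF; apply: H.
have x0 : graph_map F x ord0 = x by rewrite /graph_map unlift_none.
have nN0 : ~ N (graph_map F x ord0) by rewrite x0.
have := contact_off nN0 cF; rewrite x0 => E.
by rewrite /transport_components -E /graph_map liftK.
Qed.

Lemma coupling_negligible (gamma : probability (borel (power m.+1 M)) R) :
  kantorovich_solution c mu gamma -> gamma.-negligible [set z | z <> G (z ord0)].
Proof.
move=> [gc gmin]; have [Q [QE HQ]] := push_probability (mu ord0) G_meas.
have Qc : coupling mu Q by move=> l D mD; rewrite QE; exact: transport_pushforward.
have pm l : measurable_fun [set: borel (power m.+1 M)]
    ((fun z : power m.+1 M => z l) : borel (power m.+1 M) -> borel M).
  by apply: continuous_borel_map => z; exact: (@proj_continuous _ (fun=> M) l z).
have cc := cost_continuous hM cM reach (k := m.+1).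
have : gamma.-negligible [set z | ~ contact g u z].
  apply: (plan_optimal (T := borel (power m.+1 M)) (P := gamma) (X := fun z => z) pm gc).
  apply: (le_trans (gmin _ Qc)); rewrite -transport_cost (HQ (fun z => (c z)%:E))//.
    by apply/measurable_EFinP; exact: continuous_borel.
  apply: (plan_cost_integrable (mu ord0) (X := G)); first exact: transport_coordinate.
have : gamma.-negligible [set z | N (z ord0)].
  exists [set z | N (z ord0)]; split => //.
    by rewrite -[X in measurable X]setTI; exact: pm.
  by rewrite gc.
move=> n1 n2; apply: negligibleS (negligibleU n1 n2) => z /= H.
have [Nz|nN] := pselect (N (z ord0)); [by left|right => cz].
by apply: H; exact: contact_off.
Qed.

Lemma transport_kantorovich : exists gamma, kantorovich_solution c mu gamma.
Proof.
have [Q [QE HQ]] := push_probability (mu ord0) G_meas.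
have pm l : measurable_fun [set: borel (power m.+1 M)]
    ((fun z : power m.+1 M => z l) : borel (power m.+1 M) -> borel M).
  by apply: continuous_borel_map => z; exact: (@proj_continuous _ (fun=> M) l z).
have cc := cost_continuous hM cM reach (k := m.+1).
exists Q; split; first by move=> l D mD; rewrite QE; exact: transport_pushforward.
move=> gamma gc; rewrite (HQ (fun z => (c z)%:E)).
- rewrite transport_cost.
  exact: (plan_cost_ge (T := borel (power m.+1 M)) (P := gamma) (X := fun z => z) pm gc).
- by apply/measurable_EFinP; exact: continuous_borel.
- apply: (plan_cost_integrable (mu ord0) (X := G)); exact: transport_coordinate.
Qed.

(** Up to a negligible set [z] equals [G (z ord0)], so the mass of [D] is that of a condition on the
    first entry, which the first marginal determines. *)
Lemma kantorovich_unique (gamma : probability (borel (power m.+1 M)) R) (D : set (borel (power m.+1 M))) :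
  kantorovich_solution c mu gamma -> measurable D -> gamma D = mu ord0 (G @^-1` D).
Proof.
move=> gs mD; have [Z [mZ Z0 HZ]] := coupling_negligible gs.
have mGD : measurable (G @^-1` D : set (borel M)) by rewrite -[X in measurable X]setTI; exact: G_meas.
have [gc _] := gs; rewrite -(gc ord0 _ mGD).
pose D' : set (borel (power m.+1 M)) := [set z | (G @^-1` D) (z ord0)].
have mD' : measurable D'.
  rewrite -[X in measurable X]setTI.
  have pm : measurable_fun [set: borel (power m.+1 M)]
      ((fun z : power m.+1 M => z ord0) : borel (power m.+1 M) -> borel M).
    by apply: continuous_borel_map => z; exact: (@proj_continuous _ (fun=> M) ord0 z).
  exact: pm.
have le E E' : measurable E -> measurable E' -> E `<=` E' `|` Z -> (gamma E <= gamma E')%E.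
  move=> mE mE' EE; apply: (@le_trans _ _ (gamma (E' `|` Z))).
    by apply: le_measure => //; rewrite inE//; exact: measurableU.
  by rewrite measureU0.
apply/eqP; rewrite eq_le; apply/andP; split; apply: le => // z zD.
  have [zG|zG] := pselect (z = G (z ord0)); last by right; exact: HZ.
  by left; rewrite /= -zG.
have [zG|zG] := pselect (z = G (z ord0)); last by right; exact: HZ.
by left; rewrite zG.
Qed.

End TransportMap.

(* The number of marginals is m.+1. *)
Theorem theorem1p1 (R : realType) (n m : nat) (M : ptopologicalType)
    (A : smooth_atlas R n M) (g : riemannian_metric A)
    (mu : 'I_m.+1 -> probability (borel M) R) :
  (2 <= m.+1)%N ->
  hausdorff_space M -> compact [set: M] -> connected [set: M] ->
  abs_continuous A (mu ord0) ->
  [/\ exists gamma, kantorovich_solution (cost g m.+1) mu gamma,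
      forall gamma, kantorovich_solution (cost g m.+1) mu gamma ->
        exists F : 'I_m -> M -> M,
          gamma.-negligible (~` range (graph_map F)) /\
          monge_solution (cost g m.+1) mu F,
      forall gamma gamma',
        kantorovich_solution (cost g m.+1) mu gamma ->
        kantorovich_solution (cost g m.+1) mu gamma' ->
        forall B : set (borel (power m.+1 M)), measurable B ->
          gamma B = gamma' B
    & forall F F' : 'I_m -> M -> M,
        monge_solution (cost g m.+1) mu F ->
        monge_solution (cost g m.+1) mu F' ->
        forall j : 'I_m, {ae mu ord0, forall x, F j x = F' j x}].

Proof.
move=> _ hM cM hconn ac; have reach := reach_all g hconn.
have [B B0 dB] := rdist_bounded hM cM reach.
have [u [ua ul uz umax]] := dual_attained hM cM reach mu B0 dB.
(* A minimizer [y] for a contact tuple over [x] supplies the function that touches the first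
   potential from above; this is its semiconcavity. *)
have touch x : exists y e, (forall w, u ord0 w <= hsq g y w + e) /\ u ord0 x = hsq g y x + e.
  have [z <- cz] := uz x; have [y yP] := cost_attained hM cM reach z.
  exists y, (u ord0 (z ord0) - hsq g y (z ord0)); split; last by rewrite addrC subrK.
  by move=> w; have := contact_bound ua ord0 w yP cz; lra.
have [N [Nm N0 Nreg]] := singular_set hM cM reach (ul ord0) touch ac.
have [G [G0 Gc Gm]] := transport_map hM cM reach B0 ua ul uz Nm Nreg.
have sol := transport_monge hM cM reach B0 dB ua ul umax Nm N0 Nreg G0 Gc Gm.
split.
- exact: (transport_kantorovich hM cM reach B0 dB ua ul umax Nm N0 Nreg G0 Gc Gm).
- move=> gamma gs; exists (transport_components G); split => //.
  have := coupling_negligible hM cM reach B0 dB ua ul umax Nm N0 Nreg G0 Gc Gm gs.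
  apply: negligibleS => z /= nz zG; apply: nz; exists (z ord0) => //.
  by rewrite (graph_transport G0) -zG.
- move=> gamma gamma' gs gs' D mD.
  have key := kantorovich_unique hM cM reach B0 dB ua ul umax Nm N0 Nreg G0 Gc Gm.
  by rewrite (key _ _ gs mD) (key _ _ gs' mD).
- move=> F F' Fs Fs' j.
  have key := monge_solution_ae hM cM reach B0 dB ua ul umax Nm N0 Nreg G0 Gc Gm.
  apply: negligibleS (negligibleU (key _ j Fs) (key _ j Fs')) => x /= FF'.
  have [Fx|] := pselect (F j x = transport_components G j x); last by left.
  by right => F'x; apply: FF'; rewrite Fx F'x.
Qed.
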